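(* (a) Let $P\subset\mathbb R^3$ be a lattice polytope. The unimodular simplices contained in $P$ cover a neighborhood of the boundary $\partial P$ in $P$ (that is, the union $\operatorname{U}(P)$ of all unimodular simplices contained in $P$ is a neighborhood of $\partial P$ within $P$) if and only if $P$ is very ample. (b) Let $E\subset\mathbb R^3$ be an ellipsoid and let $P(E)=\operatorname{conv}\big(\operatorname{conv}(E)\cap\mathbb Z^3\big)$ be the convex hull of the lattice points in the solid ellipsoid bounded by $E$. Then $P(E)$ is covered by unimodular simplices, i.e., $P(E)$ is the union of the unimodular simplices contained in it. (c) For every integer $d\ge 6$, there exists an ellipsoid $E\subset\mathbb R^d$ such that the polytope $P(E)=\operatorname{conv}\big(\operatorname{conv}(E)\cap\mathbb Z^d\big)$ satisfies $\operatorname{gp}(P(E))=\mathbb Z^d$ and $P(E)$ is not normal.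
   Context: Polytopes are convex. A polytope $P\subset\mathbb R^d$ is a lattice polytope if all its vertices are in $\mathbb Z^d$. The boundary of a convex set $X$ is $\partial X=X\setminus\operatorname{int}X$, where $\operatorname{int}X$ is the relative interior. A lattice polytope $P\subset\mathbb R^d$ is normal if for every natural number $c$ and every $x\in(cP)\cap\mathbb Z^d$ there exist $x_1,\ldots,x_c\in P\cap\mathbb Z^d$ with $x_1+\cdots+x_c=x$. $\operatorname{gp}(P):=\sum_{x,y\in P\cap\mathbb Z^d}\mathbb Z(x-y)\subset\mathbb Z^d$. A lattice $n$-simplex $\operatorname{conv}(x_0,\ldots,x_n)\subset\mathbb R^d$ (with $x_0,\dots,x_n\in\mathbb Z^d$) is unimodular if $\{x_1-x_0,\ldots,x_n-x_0\}$ is a part of a basis of $\mathbb Z^d$. For a pointed, rational, finitely generated cone $C\subset\mathbb R^d$, the Hilbert basis $\operatorname{Hilb}(C)$ is the (finite) set of indecomposable elements of the additive monoid $C\cap\mathbb Z^d$, which is its smallest generating set. A lattice polytope $P$ is very ample if $\operatorname{Hilb}(\mathbb R_+(P-v))\subset P-v$ for every vertex $v$ of $P$. An ellipsoid $E\subset\mathbb R^d$ is a set of the form $\{x\in\mathbb R^d \mid (l_1(x)-a_1)^2+\cdots+(l_d(x)-a_d)^2=1\}$, where $l_1,\ldots,l_d$ is a full-rank system of real linear forms on $\mathbb R^d$ and $a_1,\ldots,a_d\in\mathbb R$. It need be neither centered at $0$ nor aligned with the coordinate axes. *)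

(* Defs.v *)
From HB Require Import structures.
From mathcomp Require Import all_boot all_order all_algebra.
From mathcomp Require Import all_classical all_reals all_analysis.

Set Implicit Arguments.
Unset Strict Implicit.
Unset Printing Implicit Defensive.

Import Order.TTheory GRing.Theory Num.Theory.
Import numFieldNormedType.Exports.

Local Open Scope classical_set_scope.
Local Open Scope ring_scope.

(* Points of R^d are row vectors 'rV[R]_d; a linear form on R^d is given by a
   column vector c, through x |-> x *m c. *)
Section LatticePolytopes.
Context {R : realType} {d : nat}.
Implicit Types (X P C S E : set 'rV[R]_d) (v x y : 'rV[R]_d).

(* Z^d inside R^d *)
Definition Zlat : set 'rV[R]_d := [set x | x \is a mxOver Num.int].

Definition convex_hull X : set 'rV[R]_d :=
  smallest (@convex_set R (convex_lmodType 'rV[R]_d)) X.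

Definition affine_hull X : set 'rV[R]_d :=
  [set y | exists (n : nat) (t : 'I_n -> R) (x : 'I_n -> 'rV[R]_d),
     [/\ forall i, X (x i), \sum_i t i = 1 & y = \sum_i t i *: x i]].

Definition rel_interior X : set 'rV[R]_d :=
  [set x | X x /\ within (affine_hull X) (nbhs x) X].

Definition rel_boundary X : set 'rV[R]_d := X `\` rel_interior X.

Definition polytope P := exists s : seq 'rV[R]_d, P = convex_hull [set` s].

(* v is a zero-dimensional face of P: some linear form attains its maximum
   over P at v and nowhere else. *)
Definition vertex P v :=
  P v /\ exists c : 'cV[R]_d,
    forall x, P x -> x <> v -> (x *m c) 0 0 < (v *m c) 0 0.

Definition lattice_polytope P :=
  polytope P /\ forall v, vertex P v -> Zlat v.

Definition normal_polytope P :=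
  forall (c : nat) x, ([set c%:R *: y | y in P] `&` Zlat) x ->
    exists y : 'I_c -> 'rV[R]_d,
      (forall i, (P `&` Zlat) (y i)) /\ \sum_i y i = x.

Definition gp P : set 'rV[R]_d :=
  [set z | exists (n : nat) (a : 'I_n -> int) (x y : 'I_n -> 'rV[R]_d),
     (forall i, (P `&` Zlat) (x i) /\ (P `&` Zlat) (y i)) /\
     z = \sum_i (x i - y i) *~ a i].

Definition Zbasis (b : 'I_d -> 'rV[R]_d) :=
  (forall i, Zlat (b i)) /\
  forall z, Zlat z -> exists! a : {ffun 'I_d -> int}, z = \sum_i b i *~ a i.

(* The family u consists of distinct members of some basis of Z^d. *)
Definition part_of_Zbasis (n : nat) (u : 'I_n -> 'rV[R]_d) :=
  exists (b : 'I_d -> 'rV[R]_d) (f : 'I_n -> 'I_d),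
    [/\ Zbasis b, injective f & forall i, u i = b (f i)].

(* The dimension n is arbitrary, possibly smaller than d. Affine independence
   of x_0, ..., x_n follows from the basis condition. *)
Definition unimodular_simplex S :=
  exists (n : nat) (x : 'I_n.+1 -> 'rV[R]_d),
    [/\ forall i, Zlat (x i),
        part_of_Zbasis (fun i : 'I_n => x (lift ord0 i) - x ord0)
      & S = convex_hull (range x)].

Definition unimodular_cover P : set 'rV[R]_d :=
  \bigcup_(S in [set S | unimodular_simplex S /\ S `<=` P]) S.

(* R_+ X; it is the conical hull of X whenever X is convex and nonempty. *)
Definition cone X : set 'rV[R]_d :=
  [set y | exists2 a : R, 0 <= a & exists2 x, X x & y = a *: x].

(* For C a pointed cone: the indecomposable elements of the monoid C `&` Zlat,
   whose only invertible element is 0. *)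
Definition Hilb C : set 'rV[R]_d :=
  [set x | [/\ (C `&` Zlat) x, x <> 0 &
     forall y z, (C `&` Zlat) y -> (C `&` Zlat) z -> x = y + z ->
       y = 0 \/ z = 0]].

Definition very_ample P :=
  forall v, vertex P v ->
    Hilb (cone [set x - v | x in P]) `<=` [set x - v | x in P].

(* The linear forms l_1, ..., l_d are the columns of L. *)
Definition ellipsoid E :=
  exists (L : 'M[R]_d) (a : 'rV[R]_d),
    \rank L = d /\ E = [set x | \sum_i ((x *m L) 0 i - a 0 i) ^+ 2 = 1].

(* P(E); convex_hull E is the solid ellipsoid bounded by E. *)
Definition ellipsoid_polytope E : set 'rV[R]_d := convex_hull (convex_hull E `&` Zlat).

End LatticePolytopes.

(* Main.v *)
(* Covering by unimodular simplices.  To cover a point y, homogenise and consider all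
   simplicial cones containing y that are spanned by linearly independent lattice
   vectors x_i, where those of positive weight are prescribed lattice points; choose
   one with |det| minimal.  If it is not unimodular, Z^n modulo the lattice of the x_i
   has a nonzero class a in [0,1)^n.  A lattice point with coordinates c_i < 1 whose
   negative coordinates sit at used x_i can be exchanged for some x_i and lowers |det|,
   so minimality forces a to be supported on the used x_i and, as a or 1 - a of
   coordinate sum 1 would be a lattice point of the simplex, forces four used x_i and
   coordinate sum 2.

   Ellipsoids in dimension 3.  With m = (sum a_i x_i) / 2, the points 2m - x_j are
   lattice points, and the mean of a quadratic function over the x_j with weights
   a_j / 2 is not changed by the reflection in m.  So some 2m - x_j lies in the
   ellipsoid, and exchanging it contradicts minimality.

   Very ample 3-polytopes.  A pointed 3-dimensional cone is covered by unimodular cones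
   on elements of its Hilbert basis (Sebo): LP duality gives an empty simplex with apex
   0 over y, White's theorem puts the lattice points needed to refine it on two
   neighbouring lattice planes.  For x0 on the boundary, the Hilbert cones at a vertex v
   of the face of x0 that contain N^2 (x0 - v) + N f + d for large N determine
   unimodular simplices around x0.  Conversely, a unimodular simplex of P that meets a
   small neighbourhood of v has v as a vertex, so that an indecomposable element of the
   cone at v is one of its edges.

   Non-normal ellipsoids.  In the lattice Z^d + Z h, h = (1/2)^6, the ball of centre
   (-1/4, .., -1/4) through e_1, .., e_d has {sum x_i = 1} as a supporting
   hyperplane of its lattice points, which meets them in e_1, .., e_d only; but h lies
   in 3 conv(e_i) and is not a sum of three e_i. *)
Require Import Defs.
From HB Require Import structures.
From mathcomp Require Import all_boot all_order all_algebra.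
From mathcomp Require Import ring lra zify.
From mathcomp Require Import all_classical all_reals all_analysis.

Set Implicit Arguments.
Unset Strict Implicit.
Unset Printing Implicit Defensive.

Import Order.TTheory GRing.Theory Num.Theory.
Import numFieldNormedType.Exports.

Local Open Scope classical_set_scope.
Local Open Scope ring_scope.

(** * Linear forms, conical hulls and Farkas' lemma *)

Section Dot.
Context {R : realFieldType} {n : nat}.
Implicit Types (x y : 'rV[R]_n) (c : 'cV[R]_n).

Definition dot x c : R := (x *m c) 0 0.

Lemma dotDl x y c : dot (x + y) c = dot x c + dot y c.
Proof. by rewrite /dot mulmxDl mxE. Qed.

Lemma dotNl x c : dot (- x) c = - dot x c.
Proof. by rewrite /dot mulNmx mxE. Qed.

Lemma dotBl x y c : dot (x - y) c = dot x c - dot y c.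
Proof. by rewrite dotDl dotNl. Qed.

Lemma dotZl a x c : dot (a *: x) c = a * dot x c.
Proof. by rewrite /dot -scalemxAl mxE. Qed.

Lemma dot0l c : dot 0 c = 0.
Proof. by rewrite /dot mul0mx mxE. Qed.

Lemma dotNr x c : dot x (- c) = - dot x c.
Proof. by rewrite /dot mulmxN mxE. Qed.

Lemma dotBr x c d : dot x (c - d) = dot x c - dot x d.
Proof. by rewrite /dot mulmxBr !mxE. Qed.

Lemma dotZr a x c : dot x (a *: c) = a * dot x c.
Proof. by rewrite /dot -scalemxAr mxE. Qed.

Lemma dot_suml I (r : seq I) (Q : pred I) (F : I -> 'rV[R]_n) c :
  dot (\sum_(i <- r | Q i) F i) c = \sum_(i <- r | Q i) dot (F i) c.
Proof. by rewrite /dot mulmx_suml summxE. Qed.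

Lemma dot_tr_gt0 x : x != 0 -> 0 < dot x x^T.
Proof.
move=> /rV0Pn[j xj]; rewrite /dot mxE (bigD1 j) //= mxE.
rewrite ltr_pwDl ?lt0r ?mulf_neq0 ?sqr_ge0 //.
by rewrite sumr_ge0 // => i _; rewrite mxE sqr_ge0.
Qed.

End Dot.

Section Conic.
Context {R : realFieldType}.

(** The conical hull, built by adding one weighted generator at a time, so that its properties are
    proved by induction on a combination. *)
Inductive conic n (S : set 'rV[R]_n) : 'rV[R]_n -> Prop :=
| conic0 : conic S 0
| conicD s h y : 0 <= s -> S h -> conic S y -> conic S (s *: h + y).

Context {n : nat}.
Implicit Types (S T : set 'rV[R]_n) (x y : 'rV[R]_n).

Lemma conic_add S x y : conic S x -> conic S y -> conic S (x + y).
Proof.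
move=> + cy; elim=> [|s h x' s0 Sh _ IH]; first by rewrite add0r.
by rewrite -addrA; exact: conicD.
Qed.

Lemma conic_scale S a x : 0 <= a -> conic S x -> conic S (a *: x).
Proof.
move=> a0; elim=> [|s h y s0 Sh _ IH]; first by rewrite scaler0; exact: conic0.
by rewrite scalerDr scalerA; apply: conicD => //; rewrite mulr_ge0.
Qed.

Lemma conic_in S x : S x -> conic S x.
Proof.
by move=> Sx; rewrite -[x]addr0 -[x]scale1r; apply: conicD => //; exact: conic0.
Qed.

Lemma conic_conic S T : (forall x, S x -> conic T x) -> forall x, conic S x -> conic T x.
Proof.
move=> ST x; elim=> [|s h y s0 Sh _ IH]; first exact: conic0.
by apply: conic_add => //; apply: conic_scale => //; exact: ST.
Qed.

Lemma conic_subset S T : S `<=` T -> conic S `<=` conic T.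
Proof. by move=> ST; apply: conic_conic => x Sx; apply/conic_in/ST. Qed.

Lemma conic_sum S I (r : seq I) (Q : pred I) (F : I -> 'rV[R]_n) :
  (forall i, Q i -> conic S (F i)) -> conic S (\sum_(i <- r | Q i) F i).
Proof.
by move=> H; elim/big_ind: _ => //; [exact: conic0 | exact: conic_add].
Qed.

Lemma conic_dot_ge0 S (c : 'cV[R]_n) x :
  (forall h, S h -> 0 <= dot h c) -> conic S x -> 0 <= dot x c.
Proof.
move=> H; elim=> [|s h y s0 Sh _ IH]; first by rewrite dot0l.
by rewrite dotDl dotZl addr_ge0 // mulr_ge0 // H.
Qed.

(** The induction is on the length of [s] rather than on [s], because the hypothesis is applied both
    to the tail and to its projection. *)
Lemma farkas (s : seq 'rV[R]_n) (b : 'rV[R]_n) :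
  conic [set` s] b \/
  exists c : 'cV[R]_n, (forall a, a \in s -> dot a c <= 0) /\ 0 < dot b c.
Proof.
move: s b; suff H k : forall s b, size s = k ->
    conic [set` s] b \/
    exists c : 'cV[R]_n, (forall a, a \in s -> dot a c <= 0) /\ 0 < dot b c.
  by move=> s b; exact: (H (size s)).
elim: k => [|k IH] [|a s] b //= sz.
  have [->|b0] := eqVneq b 0; first by left; exact: conic0.
  by right; exists b^T; split=> //; exact: dot_tr_gt0.
case: sz => sz.
case: (IH s b sz) => [cb|[c0 [c0s c0b]]].
  by left; apply: conic_subset cb => x /= xs; rewrite inE xs orbT.
have [c0a|c0a] := leP (dot a c0) 0.
  by right; exists c0; split=> // x /[!inE] /orP[/eqP->//|/c0s].
(* Bartl's induction step: project along [a] onto the kernel of [c0]. *)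
pose phi x := x - (dot x c0 / dot a c0) *: a.
have [H|[c [cs cb]]] := IH (map phi s) (phi b) (etrans (size_map _ _) sz).
  (* It suffices to lift [phi b] to some [w] in the cone of [s]: then [b - w] is a multiple of [a],
     with a nonnegative coefficient since [c0] is positive at [a] and [b] and nonpositive at [w]. *)
  left; suff [w [ws wE]] : exists w, conic [set` s] w /\ phi b = phi w.
    have w0 : 0 <= - dot w c0.
      rewrite -dotNr; apply: conic_dot_ge0 ws => h /= hs.
      by rewrite dotNr oppr_ge0 c0s.
    have -> : b = ((dot b c0 + - dot w c0) / dot a c0) *: a + w.
      apply/rowP => j; move/rowP/(_ j): wE; rewrite /phi !mxE => wE.
      by rewrite mulrDl mulrDl mulNr mulNr; lra.
    apply: conicD; [by apply: divr_ge0; lra | by rewrite /= inE eqxx |].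
    by apply: conic_subset ws => x /= xs; rewrite inE xs orbT.
  elim: H => [|t h y t0 /= /mapP[x xs ->] _ [w [ws ->]]].
    exists 0; split; first exact: conic0.
    by rewrite /phi dot0l mul0r scale0r subr0.
  exists (t *: x + w); split; first exact: conicD.
  by rewrite /phi dotDl dotZl; apply/rowP => j; rewrite !mxE; ring.
(* The pullback of [c] along [phi]; it vanishes at [a]. *)
right; exists (c - (dot a c / dot a c0) *: c0).
have E x : dot x (c - (dot a c / dot a c0) *: c0) = dot (phi x) c.
  by rewrite dotBr dotZr /phi dotBl dotZl; field; rewrite gt_eqF.
split=> [x|]; last by rewrite E.
rewrite E inE => /orP[/eqP->|xs]; last by apply: cs; rewrite map_f.
by rewrite /phi divff ?gt_eqF // scale1r subrr dot0l.
Qed.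

End Conic.

(** * Integer matrices *)

Notation intmx X := (X \is a mxOver Num.int).

Section IntMatrices.
Context {R : realType}.

Lemma intmx0 m n : intmx (0 : 'M[R]_(m, n)).
Proof. by apply/mxOverP => i j; rewrite mxE. Qed.

Lemma intmxD m n (A B : 'M[R]_(m, n)) : intmx A -> intmx B -> intmx (A + B).
Proof.
by move=> /mxOverP iA /mxOverP iB; apply/mxOverP => i j; rewrite mxE rpredD.
Qed.

Lemma intmxN m n (A : 'M[R]_(m, n)) : intmx A -> intmx (- A).
Proof. by move=> /mxOverP iA; apply/mxOverP => i j; rewrite mxE rpredN. Qed.

Lemma intmxB m n (A B : 'M[R]_(m, n)) : intmx A -> intmx B -> intmx (A - B).
Proof. by move=> iA iB; rewrite intmxD ?intmxN. Qed.

Lemma intmxM m n p (A : 'M[R]_(m, n)) (B : 'M[R]_(n, p)) :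
  intmx A -> intmx B -> intmx (A *m B).
Proof.
move=> /mxOverP iA /mxOverP iB; apply/mxOverP => i j.
by rewrite mxE rpred_sum // => k _; rewrite rpredM.
Qed.

Lemma intmxZ m n a (A : 'M[R]_(m, n)) : a \is a Num.int -> intmx A -> intmx (a *: A).
Proof. by move=> ia /mxOverP iA; apply/mxOverP => i j; rewrite mxE rpredM. Qed.

Lemma intmx1 n : intmx (1%:M : 'M[R]_n).
Proof. by apply/mxOverP => i j; rewrite mxE; case: eqP. Qed.

Lemma row_int m n i (A : 'M[R]_(m, n)) : intmx A -> intmx (row i A).
Proof. by move=> /mxOverP iA; apply/mxOverP => k j; rewrite mxE. Qed.

Lemma det_int m (X : 'M[R]_m) : intmx X -> \det X \is a Num.int.
Proof.
move=> /mxOverP iX; rewrite /determinant rpred_sum // => s _.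
by rewrite rpredM ?rpredX ?rpredN ?rpred1 // rpred_prod.
Qed.

End IntMatrices.

(** * Simplicial cones of minimal determinant *)

Section Frames.
Context {R : realType} {n : nat}.
Implicit Types (S : set 'rV[R]_n) (X : 'M[R]_n) (y t w c a : 'rV[R]_n).

(* The rows of [X] of weight 0 are arbitrary lattice vectors, which only complete the
   other ones to a basis of R^n. *)
Definition frame S y X t := [/\ intmx X, X \in unitmx, y = t *m X,
  forall i, 0 <= t 0 i & forall i, 0 < t 0 i -> S (row i X)].

Definition set_row X i w : 'M[R]_n := \matrix_k (if k == i then w else row k X).

Lemma row_set_row X i w k :
  row k (set_row X i w) = if k == i then w else row k X.
Proof. by rewrite rowK. Qed.

Lemma set_row_int X i w : intmx X -> intmx w -> intmx (set_row X i w).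
Proof.
move=> /mxOverP iX /mxOverP iw; apply/mxOverP => k j.
by rewrite mxE; case: ifP; rewrite ?mxE.
Qed.

(** Cramer's rule: the cofactors of row [i] do not involve that row, so they are those of [X], and
    [X *m \adj X] is scalar. *)
Lemma det_set_row X i c : \det (set_row X i (c *m X)) = c 0 i * \det X.
Proof.
rewrite (expand_det_row _ i).
have -> : \sum_j set_row X i (c *m X) i j * cofactor (set_row X i (c *m X)) i j =
    (c *m X *m \adj X) 0 i.
  rewrite [RHS]mxE; apply: eq_bigr => j _; rewrite [\adj X j i]mxE; congr (_ * _).
    by rewrite mxE eqxx.
  rewrite /cofactor; congr *%R; congr (\det _).
  by apply/matrixP => k l; rewrite !mxE eq_sym (negPf (neq_lift _ _)) mxE.
by rewrite -mulmxA mul_mx_adj mul_mx_scalar mxE mulrC.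
Qed.

Lemma sum_row_neq X i (v : 'rV[R]_n) :
  \sum_(j | j != i) v 0 j *: row j X = v *m X - v 0 i *: row i X.
Proof. by rewrite mulmx_sum_row [in RHS](bigD1 i) //= addrC addrK. Qed.

(** A pivot step of the simplex method: [w] enters with weight [t 0 i / c 0 i], row [i] leaves, and
    the determinant is multiplied by [c 0 i]. The ratio condition keeps the other weights
    nonnegative; the last condition ensures that only rows already in use gain weight. *)
Lemma frame_exchange S y X t i w c :
    frame S y X t -> intmx w -> w = c *m X -> 0 < c 0 i < 1 ->
    (0 < t 0 i -> S w) ->
    (forall j, j != i -> t 0 i / c 0 i * c 0 j <= t 0 j) ->
    (forall j, c 0 j < 0 -> 0 < t 0 j) ->
  exists X' t', frame S y X' t' /\ `|\det X'| < `|\det X|.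
Proof.
move=> [iX uX yE t0 tS] iw wE /andP[ci0 ci1] Sw le_ratio cneg.
pose th := t 0 i / c 0 i.
have th0 : 0 <= th by rewrite divr_ge0 // ltW.
exists (set_row X i w), (\row_j if j == i then th else t 0 j - th * c 0 j).
have dX : \det X != 0 by rewrite -unitfE -unitmxE.
split; last first.
  by rewrite wE det_set_row normrM gtr_pMl ?normr_gt0 // gtr0_norm.
split.
- exact: set_row_int.
- by rewrite unitmxE wE det_set_row unitfE mulf_neq0 // gt_eqF.
- rewrite mulmx_sum_row (bigD1 i) //= mxE eqxx row_set_row eqxx.
  under eq_bigr => j ji do rewrite mxE row_set_row (negPf ji) scalerBl.
  rewrite big_split /= sumrN sum_row_neq.
  under eq_bigr => j _ do rewrite -scalerA.
  rewrite -scaler_sumr sum_row_neq -yE -wE scalerBr scalerA /th divfK ?gt_eqF //.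
  by apply/rowP => j; rewrite !mxE; ring.
- move=> j; rewrite mxE; case: ifP => // /negbT ji.
  by rewrite subr_ge0 le_ratio.
- move=> j; rewrite mxE row_set_row; case: eqP => [_|_ h].
    by move=> h; apply: Sw; move: h; rewrite /th pmulr_lgt0 ?invr_gt0.
  apply: tS; have [//|tj] := ltP 0 (t 0 j).
  have cj : c 0 j < 0.
    rewrite ltNge; apply/negP => cj; move: h; rewrite ltNge => /negP; apply.
    by rewrite subr_le0 (le_trans tj) // mulr_ge0.
  by have := cneg _ cj; rewrite ltNge tj.
Qed.

Definition minimal_frame S y X t := frame S y X t /\
  forall X' t', frame S y X' t' -> `|\det X| <= `|\det X'|.

Lemma minimal_frame_exists S y :
  (exists X t, frame S y X t) -> exists X t, minimal_frame S y X t.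
Proof.
move=> [X0 [t0 F0]].
pose Q k := `[< exists X t, frame S y X t /\ `|\det X| = k%:R >].
have norm_nat X t : frame S y X t -> exists k : nat, `|\det X| = k%:R.
  by case=> iX _ _ _ _; apply/natrP; rewrite natr_norm_int // det_int.
have exQ : exists k, Q k.
  by have [k kE] := norm_nat _ _ F0; exists k; apply/asboolP; exists X0, t0.
case: (ex_minnP exQ) => k /asboolP[X [t [F Xk]]] kmin; exists X, t; split=> // X' t' F'.
have [k' k'E] := norm_nat _ _ F'.
by rewrite Xk k'E ler_nat kmin //; apply/asboolP; exists X', t'.
Qed.

(** The leaving row is the one of least ratio [t 0 i / c 0 i] among those with [c 0 i > 0]; as all
    coordinates are below 1, the determinant drops whichever row this is. *)
Lemma minimal_frame_no_exchange S y X t w c :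
    minimal_frame S y X t -> intmx w -> S w -> w = c *m X ->
    (forall i, c 0 i < 1) -> (exists i, 0 < c 0 i) ->
    (forall i, c 0 i < 0 -> 0 < t 0 i) -> False.
Proof.
move=> [F Fmin] iw Sw wE c1 [i0 ci0] cneg.
case: (arg_minP (fun i => t 0 i / c 0 i) (P := fun i => 0 < c 0 i) ci0) => i ci imin.
have [||j ji||X' [t' [F' ]]] := @frame_exchange S y X t i w c F iw wE.
- by rewrite ci c1.
- by [].
- have [_ _ _ t0 _] := F.
  have [cj|cj] := ltP 0 (c 0 j); first by rewrite -ler_pdivlMr // imin.
  by apply: le_trans (t0 j); rewrite mulr_ge0_le0 // divr_ge0 // ltW.
- exact: cneg.
by rewrite ltNge (Fmin _ _ F').
Qed.

(* A nonzero class of Z^n modulo the lattice spanned by the rows of [X], represented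
   by its coordinates in the half-open parallelepiped. *)
Definition lattice_class X a :=
  [/\ forall i, 0 <= a 0 i < 1, a != 0 & intmx (a *m X)].

(** A row of weight 0 could be exchanged for the lattice vector [a *m X], which then has weight 0 as
    well and need not belong to [S]. *)
Lemma minimal_frame_class_support S y X t a : minimal_frame S y X t ->
  lattice_class X a -> forall i, a 0 i != 0 -> 0 < t 0 i.
Proof.
move=> [F Fmin] [a01 _ iaX] i ai; have [_ _ _ t0 _] := F.
rewrite lt0r t0 andbT; apply/eqP => ti.
have /andP[ai0 ai1] := a01 i.
have [||j _|j|X' [t' [F' ]]] := @frame_exchange S y X t i (a *m X) a F iaX erefl.
- by rewrite ai1 lt0r ai ai0.
- by rewrite ti ltxx.
- by rewrite ti !mul0r.
- by have /andP[aj _] := a01 j; rewrite ltNge aj.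
by rewrite ltNge (Fmin _ _ F').
Qed.

Definition frac (x : R) : R := x - (Num.floor x)%:~R.

Lemma frac_itv x : 0 <= frac x < 1.
Proof. by rewrite subr_ge0 floor_le ltrBlDl -intrD1 floorD1_gt. Qed.

Lemma frac_eq0 x : (frac x == 0) = (x \is a Num.int).
Proof. by rewrite subr_eq0 eq_sym -intrEfloor. Qed.

(** The fractional parts of a row of [invmx X] with a nonintegral entry form a class, since the row
    itself is sent by [X] to a standard basis vector. *)
Lemma lattice_class_exists X : intmx X -> X \in unitmx ->
  ~~ intmx (invmx X) -> exists a, lattice_class X a.
Proof.
move=> iX uX; apply: contraNP => noclass.
apply/mxOverP => i j; rewrite -frac_eq0; apply: contrapT => /negP hij; apply: noclass.
exists (\row_k frac (invmx X i k)); split.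
- by move=> k; rewrite mxE frac_itv.
- by apply/rV0Pn; exists j; rewrite mxE.
have -> : \row_k frac (invmx X i k) =
    row i (invmx X) - \row_k (Num.floor (invmx X i k))%:~R.
  by apply/rowP => k; rewrite !mxE.
rewrite mulmxBl -row_mul mulVmx //; apply: intmxB; first exact/row_int/intmx1.
by apply: intmxM => //; apply/mxOverP => ? k; rewrite mxE intr_int.
Qed.

(** The representative of the class of [- a] in the half-open parallelepiped. *)
Definition opp_class a : 'rV[R]_n := \row_i if a 0 i == 0 then 0 else 1 - a 0 i.

Lemma opp_classP X a : intmx X -> lattice_class X a -> lattice_class X (opp_class a).
Proof.
move=> iX [a01 a0 iaX]; split.
- move=> i; rewrite mxE; have /andP[ai0 ai1] := a01 i.
  by case: eqP => [|/eqP ai]; rewrite ?lexx ?ltr01 // subr_ge0 ltW //= ltrBlDr ltrDl lt0r ai.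
- have /rV0Pn[i ai] := a0; apply/rV0Pn; exists i; rewrite mxE (negPf ai) subr_eq0.
  by have /andP[_ ai1] := a01 i; rewrite gt_eqF.
have -> : opp_class a = \row_i (a 0 i != 0)%:R - a.
  by apply/rowP => i; rewrite !mxE; case: eqP => //= ->; rewrite subrr.
rewrite mulmxBl intmxB // intmxM //.
by apply/mxOverP => ? i; rewrite mxE; case: (a 0 i != 0).
Qed.

Lemma sum_opp_class a :
  \sum_i opp_class a 0 i = #|[pred i | a 0 i != 0]|%:R - \sum_i a 0 i.
Proof.
rewrite -sum1_card natr_sum [X in X - _]big_mkcond /= -sumrB; apply: eq_bigr => i _.
by rewrite mxE ?inE; case: eqP => //= ->; rewrite subrr.
Qed.

Lemma opp_class_eq0 a i : (forall j, 0 <= a 0 j < 1) ->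
  (opp_class a 0 i == 0) = (a 0 i == 0).
Proof.
move=> /(_ i)/andP[_ ai1]; rewrite mxE; case: (a 0 i =P 0) => _; first by rewrite eqxx.
by rewrite subr_eq0 gt_eqF.
Qed.

Lemma conic_frame S y : (forall h, S h -> intmx h) -> conic S y ->
  exists X t, frame S y X t.
Proof.
move=> iS; elim=> [|s h y' s0 Sh _ [X [t [iX uX yE t0 tS]]]].
  exists 1%:M, 0; split.
  - exact: intmx1.
  - exact: unitmx1.
  - by rewrite mul0mx.
  - by move=> i; rewrite mxE.
  - by move=> i; rewrite mxE ltxx.
have [c hE] : exists c, h = c *m X by exists (h *m invmx X); rewrite mulmxKV.
have dX : \det X != 0 by rewrite -unitfE -unitmxE.
have [[i [ti ci]]|nofree] := pselect (exists i, t 0 i = 0 /\ c 0 i != 0).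
  exists (set_row X i h), (\row_j if j == i then s else t 0 j); split.
  - exact: set_row_int (iS _ Sh).
  - by rewrite unitmxE hE det_set_row unitfE mulf_neq0.
  - rewrite mulmx_sum_row (bigD1 i) //= mxE eqxx row_set_row eqxx; congr (_ + _).
    rewrite yE mulmx_sum_row (bigD1 i) //= ti scale0r add0r.
    by apply: eq_bigr => j ji; rewrite mxE row_set_row (negPf ji).
  - by move=> j; rewrite mxE; case: ifP.
  - by move=> j; rewrite mxE row_set_row; case: ifP => // _; exact: tS.
have tpos i : c 0 i != 0 -> 0 < t 0 i.
  move=> ci; rewrite lt0r t0 andbT; apply/eqP => ti; apply: nofree; by exists i.
have [allpos|] := pselect (forall i, 0 <= t 0 i + s * c 0 i).
  exists X, (t + s *: c); split=> //.
  - by rewrite mulmxDl -scalemxAl -hE yE addrC.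
  - by move=> i; rewrite !mxE.
  - move=> i; rewrite !mxE => h'; apply: tS.
    have [ci|/tpos//] := eqVneq (c 0 i) 0.
    by rewrite ci mulr0 addr0 in h'.
move=> /existsNP[i0 /negP]; rewrite -ltNge => hi0.
have ci0 : c 0 i0 < 0.
  rewrite ltNge; apply/negP => ?; move: hi0; rewrite ltNge => /negP; apply.
  by rewrite addr_ge0 // mulr_ge0.
(* [th] is the part of the weight [s] that can be spread until a first weight, at [i], vanishes; [h]
   then replaces this row with the remaining weight [s - th]. *)
case: (arg_minP (fun i => t 0 i / - c 0 i) (P := fun i => c 0 i < 0) ci0) => i ci imin.
pose th := t 0 i / - c 0 i.
have th0 : 0 <= th by rewrite divr_ge0 // oppr_ge0 ltW.
have ths : th <= s.
  apply: le_trans (imin _ ci0) _; rewrite ler_pdivrMr ?oppr_gt0 //.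
  by rewrite mulrN -subr_le0 opprK ltW.
exists (set_row X i h), (\row_j if j == i then s - th else t 0 j + th * c 0 j); split.
- exact: set_row_int (iS _ Sh).
- by rewrite unitmxE hE det_set_row unitfE mulf_neq0 // lt_eqF.
- rewrite mulmx_sum_row (bigD1 i) //= mxE eqxx row_set_row eqxx.
  under eq_bigr => j ji do rewrite mxE row_set_row (negPf ji).
  have -> : \sum_(j | j != i) (t 0 j + th * c 0 j) *: row j X = y' + th *: h.
    transitivity (\sum_(j | j != i) (t + th *: c) 0 j *: row j X).
      by apply: eq_bigr => j _; rewrite !mxE.
    rewrite sum_row_neq mulmxDl -scalemxAl -hE -yE !mxE.
    have -> : t 0 i + th * c 0 i = 0.
      by rewrite /th invrN mulrN mulNr divfK ?subrr // lt_eqF.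
    by rewrite scale0r subr0.
  by rewrite scalerBl addrCA subrK addrC.
- move=> j; rewrite mxE; case: ifP => [_|/negbT ji]; first by rewrite subr_ge0.
  have [cj|cj] := ltP (c 0 j) 0; last by rewrite addr_ge0 // mulr_ge0.
  have := imin _ cj; rewrite -/th ler_pdivlMr ?oppr_gt0 // mulrN.
  by rewrite -subr_ge0 opprK.
- move=> j; rewrite mxE row_set_row; case: ifP => // _ h'; apply: tS.
  have [cj|/tpos//] := eqVneq (c 0 j) 0.
  by rewrite cj mulr0 addr0 in h'.
Qed.

End Frames.

(** * The arithmetic of White's theorem *)

Section White.
Local Open Scope nat_scope.

(* Call [k] a jump of [Q] if [k * Q %/ m] exceeds [(k-1) * Q %/ m]. Every jump of
   [Q + R - 1] is a jump of exactly one of [Q] and [R]; since its jumps are at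
   distance more than [2] apart, the jumps of [Q] cannot stay in step with it
   after the first jump of [R]. *)
Lemma white_core m n Q R : 1 < R -> R <= Q -> 2 * n < m -> n + 1 = Q + R ->
    (forall k, 0 < k < m -> k * n %/ m = k * Q %/ m + k * R %/ m) ->
    (forall k, 0 < k < m -> ~~ (m %| k * Q)) ->
    (forall k, 0 < k < m -> ~~ (m %| k * R)) -> False.
Proof.
move=> R1 RQ nm nE NE ndQ ndR.
have m0 : 0 < m by lia.
have leD a x : (a <= x %/ m) = (a * m <= x) by rewrite leq_divRL.
have ltD a x : (x %/ m < a) = (x < a * m) by rewrite ltn_divLR.
have neQ k b : 0 < k < m -> k * Q != b * m.
  by move=> /ndQ; apply: contra => /eqP ->; rewrite dvdn_mull.
have neR k b : 0 < k < m -> k * R != b * m.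
  by move=> /ndR; apply: contra => /eqP ->; rewrite dvdn_mull.
have ceilE a b : 0 < b -> exists k, k * b <= a < k.+1 * b.
  by move=> b0; exists (a %/ b); rewrite leq_divM /= ltn_ceil.
have ltNE a c : a <= c -> a != c -> a < c by move=> ? ?; rewrite ltn_neqAle; apply/andP.
have Q1 := leq_trans R1 RQ.
(* The first jumps of [R] and [Q] are at [k.+1] and [t.+1]. *)
have [k /andP[klo khi]] := ceilE m R (ltnW R1).
have [t /andP[tlo thi]] := ceilE m Q (ltnW Q1).
have tk : t <= k.
  rewrite -ltnS -(ltn_pmul2r (ltnW R1)); apply: leq_ltn_trans khi.
  by apply: leq_trans tlo; rewrite leq_mul2l RQ orbT.
have k2 : k * 2 <= m by apply: leq_trans klo; rewrite leq_mul2l R1 orbT.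
have t0 : 0 < t.
  by case: posnP => // t0; move: thi; rewrite t0 mul1n; lia.
have k0 := leq_trans t0 tk.
have klo' : k * R < m.
  by apply: ltNE => //; have := neR k 1; rewrite mul1n; apply; lia.
have tlo' : t * Q < m.
  by apply: ltNE => //; have := neQ t 1; rewrite mul1n; apply; lia.
have km : k.*2.+1 <= m.
  by rewrite -muln2; apply: leq_ltn_trans klo'; rewrite leq_mul2l R1 orbT.
have C0 j : j <= k -> j * R %/ m = 0.
  move=> jk; apply: divn_small; apply: leq_ltn_trans klo'.
  by rewrite leq_mul2r jk orbT.
have C1 : 0 < k.+1 * R %/ m by rewrite leD mul1n ltnW.
set b := k * Q %/ m.
have hb : k * Q < b.+1 * m by rewrite -ltD.
have kN : k * n %/ m = b by rewrite NE ?C0 ?addn0 //; lia.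
have kN' : k * n < b.+1 * m by rewrite -ltD kN.
have Nk : k.+1 * n < b.+2 * m by rewrite mulSn (mulSn b.+1); lia.
move: Nk; rewrite -ltD NE; last by lia.
have mono : b <= k.+1 * Q %/ m by apply: leq_div2r; rewrite leq_mul2r leqnSn orbT.
(* The quotient of [n] at [k.+1] is at most [b.+1], and the jump of [R] there already accounts for
   the increase, so [Q] has none. *)
move=> Nk; have bE : k.+1 * Q %/ m = b by lia.
have tk' : t < k.
  rewrite ltn_neqAle tk andbT; apply/eqP => tE; subst t.
  have : 0 < k.+1 * Q %/ m by rewrite leD mul1n ltnW.
  by rewrite bE /b divn_small.
have b0 : 0 < b.
  rewrite leD mul1n; apply: leq_trans (ltnW thi) _.
  by rewrite leq_mul2r tk' orbT.
(* The last jump of [Q] up to [k] is at [s.+1]. *)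
have [s /andP[slo shi]] := ceilE (b * m) Q (ltnW Q1).
have bQ : b * m < k * Q.
  by apply: ltNE; rewrite -?leD // eq_sym; apply: neQ; lia.
have sk : s < k by rewrite -(ltn_pmul2r (ltnW Q1)) (leq_ltn_trans slo).
have s0 : 0 < s.
  have : m <= b * m by rewrite -[X in X <= _]mul1n leq_mul2r b0 orbT.
  by case: posnP => // -> in shi *; rewrite mul1n in shi; lia.
have slo' : s * Q < b * m.
  by apply: ltNE => //; apply: neQ; lia.
have Ns : s * n < b * m.
  rewrite -ltD NE; last by lia.
  by rewrite C0 ?addn0 ?ltD // ltnW.
have Nt : t * n < m.
  rewrite -[X in _ < X]mul1n -ltD NE; last by lia.
  by rewrite C0 // addn0 divn_small.
(* At [j] the quotient of [Q] is at least [b.+1] and that of [R] at least 1, but [j * n < b.+2 * m]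
   because [s * n < b * m], [t * n < m] and [2 * n < m]. *)
set j := s.+1 + t.+1.
have jm : 0 < j < m by rewrite /j; lia.
have jN : j * n %/ m < b.+2.
  by rewrite ltD mulnDl !mulSn; lia.
have jB : b < j * Q %/ m by rewrite leD /j mulnDl mulSn; lia.
have sN : b * m <= s.+1 * n.
  rewrite -leD NE; last by lia.
  by rewrite (leq_trans _ (leq_addr _ _)) // leD ltnW.
have tN : m <= t.+1 * n.
  rewrite -[X in X <= _]mul1n -leD NE; last by lia.
  by rewrite (leq_trans _ (leq_addr _ _)) // leD mul1n ltnW.
have n0 : 0 < n by lia.
have kj : k < j.
  rewrite -(ltn_pmul2r n0); apply: leq_trans kN' _.
  by rewrite /j mulnDl mulSn; lia.
have jC : 0 < j * R %/ m.
  rewrite leD mul1n; apply: leq_trans (ltnW khi) _.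
  by rewrite leq_mul2r kj orbT.
have := NE j jm; lia.
Qed.

(** With [n = m - P] the identity of three floors turns into the additivity of the floors of [Q] and
    [R] that [white_core] refutes; the case [k = 2] shows that [P] exceeds half of [m]. *)
Lemma white m P Q R : 0 < R -> R <= Q -> Q <= P -> P + Q + R = m.+1 ->
    (forall k, 0 < k < m -> k * P %/ m + k * Q %/ m + k * R %/ m = k.-1) ->
    (forall k, 0 < k < m -> [&& ~~ (m %| k * P), ~~ (m %| k * Q) & ~~ (m %| k * R)]) ->
  R = 1.
Proof.
move=> R0 RQ QP sE fE nd; apply/eqP; rewrite eqn_leq R0 andbT leqNgt; apply/negP => R1.
have m2 : 2 < m by lia.
have P2 : m < 2 * P.
  have fE2 := fE 2; have /and3P[nP _ _] := nd 2 m2.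
  rewrite ltn_neqAle; apply/andP; split; first by apply: contra nP => /eqP <-.
  rewrite leqNgt; apply/negP => Pm; move: (fE2 m2).
  by rewrite !divn_small ?m2 //; lia.
apply: (@white_core m (m - P) Q R) => //; [by lia | by lia | | |].
- move=> k km; have /and3P[nP _ _] := nd k km; have fk := fE k km.
  have kP : k * P < k * m by rewrite ltn_pmul2l; lia.
  rewrite mulnBr; have {}m2 : 0 < m by lia.
  move: fk (ltn_ceil (k * P) m2) (leq_divM (k * P) m); set q := k * P %/ m => fk hi lo.
  have lo' : q * m < k * P.
    by rewrite ltn_neqAle lo andbT; apply: contra nP => /eqP <-; rewrite dvdn_mull.
  have qk : q < k by rewrite -(ltn_pmul2r m2) (ltn_trans lo').
  suff : (k * m - k * P) %/ m = k - q.+1 by lia.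
  have E : k * m - k * P = (k - q.+1) * m + (q.+1 * m - k * P).
    by rewrite mulnBl; have : q.+1 * m <= k * m; [rewrite leq_mul2r qk orbT | have := hi; lia].
  rewrite E divnMDl ?divn_small ?addn0 //; rewrite mulSn; lia.
- by move=> k /nd /and3P[].
- by move=> k /nd /and3P[].
Qed.
(** The triple (1, p1, p2) / m stands for a generating class of an empty tetrahedron. The
    complements [P], [Q] and the excess [R] add up to [m.+1], and the conditions on residues become
    the floor identity of [white]. *)
Lemma white_residues m p1 p2 : 0 < p1 < m -> 0 < p2 < m -> m < 1 + p1 + p2 < 2 * m ->
    (forall k, 0 < k < m -> [/\ 0 < k * p1 %% m, 0 < k * p2 %% m &
       m < k + k * p1 %% m + k * p2 %% m < 2 * m]) ->
  [\/ p1 + 1 = m, p2 + 1 = m | p1 + p2 = m].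
Proof.
move=> p1m p2m p12 res.
have m0 : 0 < m by lia.
have divE a q r : r < m -> a = q * m + r -> a %/ m = q /\ a %% m = r.
  by move=> rm ->; rewrite divnMDl // divn_small // addn0 modnMDl modn_small.
pose P := m - p1; pose Q := m - p2; pose R := 1 + p1 + p2 - m.
have key k : 0 < k < m ->
    [/\ k * P %/ m + k * Q %/ m + k * R %/ m = k.-1,
        0 < k * P %% m, 0 < k * Q %% m & 0 < k * R %% m].
  move=> km; have [] := res k km.
  have := divn_eq (k * p1) m; have := divn_eq (k * p2) m.
  have h1 := ltn_pmod (k * p1) m0; have h2 := ltn_pmod (k * p2) m0.
  have kp p : p < m -> k * p < k * m by move=> pm; rewrite ltn_pmul2l //; lia.
  move: h1 h2 (kp p1) (kp p2).
  set q1 := k * p1 %/ m; set q2 := k * p2 %/ m.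
  set r1 := k * p1 %% m; set r2 := k * p2 %% m.
  move=> h1 h2 kp1 kp2 e2 e1 r10 r20 /andP[lo hi].
  have q1k : q1 < k by rewrite -(ltn_pmul2r m0); have := kp1; lia.
  have q2k : q2 < k by rewrite -(ltn_pmul2r m0); have := kp2; lia.
  have qle q : q < k -> q.+1 * m <= k * m by move=> qk; rewrite leq_mul2r qk orbT.
  have kq1 := qle _ q1k; have kq2 := qle _ q2k; rewrite mulSn in kq1 kq2.
  have PE : k * P = (k - q1.+1) * m + (m - r1).
    by rewrite /P mulnBr mulnBl mulSn; lia.
  have QE : k * Q = (k - q2.+1) * m + (m - r2).
    by rewrite /Q mulnBr mulnBl mulSn; lia.
  have kR : k * m <= q1 * m + q2 * m + m.
    have : k * m <= k * (1 + p1 + p2) by rewrite leq_mul2l; lia.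
    rewrite !mulnDr muln1 => kR.
    have : k < q1 + q2 + 2 by rewrite -(ltn_pmul2r m0) !mulnDl; lia.
    move=> kq; have : k * m <= (q1 + q2 + 1) * m by rewrite leq_mul2r; lia.
    by rewrite !mulnDl mul1n.
  have RE : k * R = (q1 + q2 + 1 - k) * m + (k + r1 + r2 - m).
    by rewrite /R mulnBr !mulnDr mulnBl !mulnDl muln1 mul1n; lia.
  have [|-> ->] := divE _ _ _ _ PE; first by lia.
  have [|-> ->] := divE _ _ _ _ QE; first by lia.
  have [|-> ->] := divE _ _ _ _ RE; first by lia.
  have : k <= q1 + q2 + 1 by rewrite -(leq_pmul2r m0) !mulnDl mul1n.
  by split; lia.
have key' k : 0 < k < m -> [&& ~~ (m %| k * P), ~~ (m %| k * Q) & ~~ (m %| k * R)].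
  by move=> /key[_]; rewrite !lt0n /dvdn => -> -> ->.
have [P0 Q0 R0] : [/\ 0 < P, 0 < Q & 0 < R] by rewrite /P /Q /R; split; lia.
have sE : P + Q + R = m.+1 by rewrite /P /Q /R; lia.
(* [white] expects its arguments in decreasing order; this form serves all six orders of [P], [Q],
   [R]. *)
have W A B C : [/\ 0 < A, 0 < B & 0 < C] -> A + B + C = m.+1 ->
    (forall k, k * A %/ m + k * B %/ m + k * C %/ m =
               k * P %/ m + k * Q %/ m + k * R %/ m) ->
    (forall k, 0 < k < m -> [&& ~~ (m %| k * A), ~~ (m %| k * B) & ~~ (m %| k * C)]) ->
    C <= B -> B <= A -> C = 1.
  move=> [? ? ?] ? fE nd CB BA; apply: (white (m := m) (P := A) (Q := B)) => // k km.
  by rewrite fE; have [] := key k km.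
have nd k (km : 0 < k < m) := and3P (key' k km).
suff : [\/ P = 1, Q = 1 | R = 1].
  by rewrite /P /Q /R => -[?|?|?]; [constructor 1|constructor 2|constructor 3]; lia.
have [QP|PQ] := leqP Q P; have [RQ|QR] := leqP R Q; have [RP|PR] := leqP R P; try lia.
- by constructor 3; apply: (W P Q R).
- constructor 2; apply: (W P R Q) => //; [lia|move=> k; lia| |lia].
  by move=> k km; have [-> -> ->] := nd k km.
- constructor 2; apply: (W R P Q) => //; [lia|move=> k; lia| |lia].
  by move=> k km; have [-> -> ->] := nd k km.
- constructor 3; apply: (W Q P R) => //; [lia|move=> k; lia| |lia].
  by move=> k km; have [-> -> ->] := nd k km.
- constructor 1; apply: (W Q R P) => //; [lia|move=> k; lia| |lia].
  by move=> k km; have [-> -> ->] := nd k km.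
- constructor 1; apply: (W R Q P) => //; [lia|move=> k; lia| |lia|lia].
  by move=> k km; have [-> -> ->] := nd k km.
Qed.
End White.

(** * The lattice width of empty tetrahedra *)

Section Width.
Context {R : realType}.

Lemma lattice_class_frac n (X : 'M[R]_n) (c : 'rV[R]_n) :
  intmx X -> intmx (c *m X) ->
  (forall i, c 0 i \is a Num.int) \/ lattice_class X (\row_i frac (c 0 i)).
Proof.
move=> iX icX; set a := \row_i _.
have [a0|a0] := eqVneq a 0.
  by left=> i; move/rowP/(_ i): a0; rewrite !mxE => /eqP; rewrite frac_eq0.
right; split=> //; first by move=> i; rewrite mxE frac_itv.
have -> : a = c - \row_i (Num.floor (c 0 i))%:~R by apply/rowP => i; rewrite !mxE.
rewrite mulmxBl; apply: intmxB => //; apply: intmxM => //.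
by apply/mxOverP => ? i; rewrite mxE intr_int.
Qed.

Lemma sum3 (F : 'I_3 -> R) : \sum_i F i = F 0 + F 1 + F 2.
Proof.
rewrite !big_ord_recr big_ord0 /= add0r.
by congr (_ + _ + _); congr F; apply: val_inj.
Qed.

Lemma forall3 (Q : 'I_3 -> Prop) : Q 0 -> Q 1 -> Q 2 -> forall i, Q i.
Proof.
move=> Q0 Q1 Q2 [[|[|[|//]]] h].
- by rewrite (_ : Ordinal h = 0) //; apply: val_inj.
- by rewrite (_ : Ordinal h = 1) //; apply: val_inj.
- by rewrite (_ : Ordinal h = 2) //; apply: val_inj.
Qed.

(* White's theorem: an empty lattice tetrahedron with a vertex at the origin has
   lattice width one with respect to a pair of opposite edges. *)
Lemma white_width (X : 'M[R]_3) : intmx X -> X \in unitmx ->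
    (forall a, lattice_class X a ->
       (forall i, 0 < a 0 i) /\ 1 < \sum_i a 0 i < 2) ->
  exists k, forall c : 'rV[R]_3, intmx (c *m X) ->
    \sum_(i | i != k) c 0 i \is a Num.int.
Proof.
move=> iX uX empty.
have [[a0 Ca0]|noclass] := pselect (exists a, lattice_class X a); last first.
  exists 0 => c /(lattice_class_frac iX)[ic|ca]; first by rewrite rpred_sum.
  by exfalso; apply: noclass; exists (\row_i frac (c 0 i)).
(* By Cramer's rule the first coordinates of classes are natural multiples of [D^-1], so some class
   [z] has the least one; it is positive by emptiness. *)
pose D := `|\det X|.
have D0 : 0 < D by rewrite normr_gt0 -unitfE -unitmxE.
have natD a : lattice_class X a -> exists n : nat, a 0 0 * D = n%:R.
  move=> [a01 _ iaX]; apply/natrP; rewrite natrEint mulr_ge0 ?andbT //; first last.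
  - exact: ltW.
  - by have /andP[] := a01 0.
  rewrite /D normrEsign mulrCA rpredM ?rpredX ?rpredN ?rpred1 //.
  have -> : a 0 0 * \det X = (a *m X *m \adj X) 0 0.
    by rewrite -mulmxA mul_mx_adj mul_mx_scalar mxE mulrC.
  apply: (mxOverP _); apply: intmxM => //; apply/mxOverP => i j.
  rewrite mxE /cofactor rpredM ?rpredX ?rpredN ?rpred1 // det_int //.
  by apply/mxOverP => k l; rewrite !mxE; exact: (mxOverP iX).
pose Q n := `[< exists a, lattice_class X a /\ a 0 0 * D = n%:R >].
have exQ : exists n, Q n.
  by have [n nE] := natD _ Ca0; exists n; apply/asboolP; exists a0.
case: (ex_minnP exQ) => n0 /asboolP[z [Cz zE]] zmin.
have z_min a : lattice_class X a -> z 0 0 <= a 0 0.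
  move=> Ca; have [n nE] := natD _ Ca.
  rewrite -(ler_pM2r D0) zE nE ler_nat zmin //; apply/asboolP; by exists a.
have [zpos zsum] := empty _ Cz; have [z01 _ izX] := Cz.
have e0 := zpos 0; set e := z 0 0 in e0 z_min zE *.
(* Subtracting a multiple of [z] makes the first coordinate an integer, hence all. *)
have red (c : 'rV[R]_3) : intmx (c *m X) ->
    exists q : int, c 0 0 = q%:~R * e /\ forall i, c 0 i - q%:~R * z 0 i \is a Num.int.
  move=> icX; pose q := Num.floor (c 0 0 / e); exists q.
  have := lattice_class_frac iX (c := c - q%:~R *: z).
  have lo : 0 <= c 0 0 - q%:~R * e.
    by rewrite subr_ge0 -ler_pdivlMr // floor_le.
  have hi : c 0 0 - q%:~R * e < e.
    rewrite ltrBlDr -[X in X + _]mul1r -mulrDl addrC -intrD1 -ltr_pdivrMr //.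
    by rewrite floorD1_gt.
  have e1 : e < 1 by have /andP[] := z01 0.
  have fE : frac (c 0 0 - q%:~R * e) = c 0 0 - q%:~R * e.
    rewrite /frac (_ : Num.floor _ = 0) ?subr0 //.
    by apply: floor_def; rewrite lo /= add0r (lt_trans hi).
  case.
  - rewrite mulmxBl -scalemxAl; apply: intmxB => //; exact: intmxZ.
  - move=> h; have hi' i : c 0 i - q%:~R * z 0 i \is a Num.int by move: (h i); rewrite !mxE.
    split=> //; apply/eqP; rewrite -subr_eq0; have := hi' 0; rewrite -/e.
    by rewrite -frac_eq0 fE.
  move=> Ca; have := z_min _ Ca; rewrite !mxE -/e fE => h.
  by move: hi; rewrite ltNge h.
(* For the first unit vector this says that 1 is a multiple of [e]: so [e] is some [m^-1], and [z]
   generates the cyclic group of classes. *)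
have [|q [q1 qz]] := red (delta_mx 0 0).
  by rewrite -rowE row_int.
rewrite mxE eqxx /= in q1.
have q0 : 0 < q%:~R :> R by rewrite -(pmulr_lgt0 _ e0) -q1.
have [m mE] : exists m : nat, q%:~R = m%:R :> R.
  by apply/natrP; rewrite natrEint intr_int ltW.
rewrite mE in q1 qz q0; have m0 : (m%:R : R) != 0 by rewrite gt_eqF.
have eE : e = m%:R^-1 by apply: (mulfI m0); rewrite -q1 divff.
have mzI i : m%:R * z 0 i \is a Num.int.
  have dI : (delta_mx 0 0 : 'rV[R]_3) 0 i \is a Num.int by rewrite mxE; case: (_ && _).
  by rewrite -(subKr ((delta_mx 0 0 : 'rV[R]_3) 0 i) (m%:R * z 0 i)) rpredB.
have mznat i : exists p : nat, z 0 i = p%:R / m%:R.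
  have [p pE] : exists p : nat, m%:R * z 0 i = p%:R.
    by apply/natrP; rewrite natrEint mzI mulr_ge0 // ltW.
  by exists p; rewrite -pE mulrAC divff // mul1r.
have [p1 p1E] := mznat 1; have [p2 p2E] := mznat 2.
have m0' : (0 < m)%N by move: q0; rewrite ltr0n.
have vm : 0 < (m%:R : R)^-1 by rewrite invr_gt0 ltr0n.
have pm i p : z 0 i = p%:R / m%:R -> (0 < p < m)%N.
  move=> zE'; have := z01 i; have := zpos i; rewrite zE' pmulr_lgt0 // ltr0n => ->.
  by rewrite ltr_pdivrMr ?ltr0n // mul1r ltr_nat => /andP[].
have sum_res r1 r2 k : 1 < (k%:R / m%:R + r1%:R / m%:R + r2%:R / m%:R : R) < 2 ->
    (m < k + r1 + r2 < 2 * m)%N.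
  rewrite -!mulrDl -!natrD ltr_pdivlMr ?ltr_pdivrMr ?ltr0n // mul1r -natrM.
  by rewrite !ltr_nat.
have pairI (c : 'rV[R]_3) (k : int) i j : (forall i, c 0 i - k%:~R * z 0 i \is a Num.int) ->
    z 0 i + z 0 j = 1 -> c 0 i + c 0 j \is a Num.int.
  move=> ckz zij.
  have -> : c 0 i + c 0 j = (c 0 i - k%:~R * z 0 i) + (c 0 j - k%:~R * z 0 j) + k%:~R.
    by rewrite -[X in _ = _ + X]mulr1 -zij; ring.
  exact: (rpredD (rpredD (ckz i) (ckz j)) (intr_int _ k)).
have := @white_residues m p1 p2 (pm _ _ p1E) (pm _ _ p2E).
case.
- by apply: sum_res; move: zsum; rewrite sum3 p1E p2E -/e eE mul1r.
- move=> k km.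
  (* The class of [k%:R *: z], whose numerators are residues modulo [m]. *)
  pose c := k%:R *: z - (\row_i (if i == 1 then (k * p1 %/ m)%N%:R else
              if i == 2 then (k * p2 %/ m)%N%:R else 0)).
  have resE p : k%:R * (p%:R / m%:R) - (k * p %/ m)%N%:R = (k * p %% m)%N%:R / m%:R :> R.
    rewrite mulrA -natrM {1}(divn_eq (k * p) m) natrD natrM mulrDl mulfK //.
    by rewrite addrAC subrr add0r.
  have c0E : c 0 0 = k%:R / m%:R by rewrite !mxE /= subr0 -/e eE.
  have c1E : c 0 1 = (k * p1 %% m)%N%:R / m%:R by rewrite !mxE /= p1E resE.
  have c2E : c 0 2 = (k * p2 %% m)%N%:R / m%:R by rewrite !mxE /= p2E resE.
  have rm r : (r < m)%N -> 0 <= (r%:R : R) / m%:R < 1.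
    by move=> rm; rewrite divr_ge0 ?ler0n //= ltr_pdivrMr ?ltr0n // mul1r ltr_nat.
  have Cc : lattice_class X c.
    split.
    - apply: forall3; rewrite ?c0E ?c1E ?c2E; apply: rm; rewrite ?ltn_pmod //.
      by case/andP: km.
    - apply/rV0Pn; exists 0; rewrite c0E mulf_neq0 ?gt_eqF //.
      by rewrite ltr0n; case/andP: km.
    - rewrite mulmxBl -scalemxAl; apply: intmxB; first by apply: intmxZ => //; rewrite natr_int.
      apply: intmxM => //; apply/mxOverP => ? i; rewrite mxE.
      by do 2?case: ifP => _; rewrite ?natr_int ?rpred0 //.
  have [cpos csum] := empty _ Cc.
  split.
  - by have := cpos 1; rewrite c1E pmulr_lgt0 // ltr0n.
  - by have := cpos 2; rewrite c2E pmulr_lgt0 // ltr0n.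
  - by apply: sum_res; move: csum; rewrite sum3 c0E c1E c2E.
(* In each of the three cases two coordinates of [z] add up to 1, and the witness is the third
   index. *)
- move=> h; exists 2 => c /red[k [_ kz]].
  have -> : \sum_(i | i != 2) c 0 i = c 0 0 + c 0 1.
    by rewrite big_mkcond sum3 /= addr0.
  by apply: (pairI c k) => //; rewrite -/e eE p1E addrC -[X in _ + X]mul1r -mulrDl natr1 -addn1 h divff.
- move=> h; exists 1 => c /red[k [_ kz]].
  have -> : \sum_(i | i != 1) c 0 i = c 0 0 + c 0 2.
    by rewrite big_mkcond sum3 /= addr0.
  by apply: (pairI c k) => //; rewrite -/e eE p2E addrC -[X in _ + X]mul1r -mulrDl natr1 -addn1 h divff.
- move=> h; exists 0 => c /red[k [_ kz]].
  have -> : \sum_(i | i != 0) c 0 i = c 0 1 + c 0 2.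
    by rewrite big_mkcond sum3 /= add0r.
  by apply: (pairI c k) => //; rewrite p1E p2E -mulrDl -natrD h divff.
Qed.

End Width.

(** * Homogenisation *)

Section Homogeneous.
Context {R : realType} {n : nat}.
Implicit Types (x y : 'rV[R]_n).

(** [hrow 1 x] is the point [x] placed at height 1, so that affine combinations turn into linear
    ones; directions sit at height 0. *)
Definition hrow (r : R) x : 'rV[R]_(1 + n) := row_mx r%:M x.

Lemma hrowD r s x y : hrow (r + s) (x + y) = hrow r x + hrow s y.
Proof. by rewrite /hrow add_row_mx raddfD. Qed.

Lemma hrowZ a r x : hrow (a * r) (a *: x) = a *: hrow r x.
Proof. by rewrite /hrow scale_row_mx scale_scalar_mx. Qed.

Lemma hrowN r x : hrow (- r) (- x) = - hrow r x.
Proof. by rewrite -[- r]mulN1r -[- x]scaleN1r hrowZ scaleN1r. Qed.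

Lemma hrowB r s x y : hrow (r - s) (x - y) = hrow r x - hrow s y.
Proof. by rewrite hrowD hrowN. Qed.

Lemma hrow00 : hrow 0 0 = 0.
Proof. by rewrite /hrow raddf0 row_mx0. Qed.

Lemma hrow_inj r s x y : hrow r x = hrow s y -> r = s /\ x = y.
Proof.
move=> /eq_row_mx[rs ->]; split=> //.
by move/matrixP/(_ 0 0): rs; rewrite !mxE.
Qed.

Lemma hrowE (u : 'rV[R]_(1 + n)) : u = hrow (u 0 0) (rsubmx u).
Proof.
rewrite -[LHS]hsubmxK; congr row_mx; apply/rowP => j.
by rewrite !ord1 !mxE eqxx mulr1n; congr (u _ _); apply: val_inj.
Qed.

Lemma dot_hrow r x (c : 'cV[R]_(1 + n)) :
  dot (hrow r x) c = r * c 0 0 + dot x (dsubmx c).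
Proof.
rewrite /dot -[c in LHS]vsubmxK mul_row_col mxE mul_scalar_mx mxE; congr (_ * _ + _).
by rewrite mxE; congr (c _ _); apply: val_inj.
Qed.

Lemma dot_hrow_col r x a (c : 'cV[R]_n) :
  dot (hrow r x) (col_mx a%:M c) = r * a + dot x c.
Proof. by rewrite /dot mul_row_col mxE mul_scalar_mx !mxE eqxx mulr1n. Qed.

End Homogeneous.

(** * Linear programming duality *)

Section LP.
Context {R : realType}.

Lemma eventually_small_seq (T : eqType) (s : seq T) (Q : T -> R -> Prop) :
    (forall x, x \in s -> exists2 e, 0 < e & forall d, 0 < d <= e -> Q x d) ->
  exists2 e, 0 < e & forall d, 0 < d <= e -> forall x, x \in s -> Q x d.
Proof.
elim: s => [|x s IH] H; first by exists 1.
have [|e1 e10 H1] := IH; first by move=> y ys; apply: H; rewrite inE ys orbT.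
have [e2 e20 H2] := H x (mem_head _ _).
exists (Num.min e1 e2); first by rewrite lt_min e10.
move=> d /andP[d0]; rewrite le_min => /andP[d1 d2] y /[!inE] /orP[/eqP->|ys].
  by apply: H2; rewrite d0.
by apply: H1 => //; rewrite d0.
Qed.

Lemma conic_cons n (a : 'rV[R]_n) s b : conic [set` a :: s] b ->
  exists2 mu, 0 <= mu & conic [set` s] (b - mu *: a).
Proof.
elim=> [|t h y t0 /= /[!inE] hs _ [mu mu0 ch]].
  by exists 0; rewrite // scale0r subr0; exact: conic0.
case/orP: hs => [/eqP->|hs].
  exists (t + mu); first exact: addr_ge0.
  by rewrite scalerDl opprD addrACA subrr add0r.
by exists mu => //; rewrite -addrA; exact: conicD.
Qed.

(** Strong duality with complementary slackness: [l] is an optimal dual solution, and [y] is a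
    combination of the generators on which it is tight. The optimum [M] is the supremum of the total
    weights [r] of representations of [y] by [H]. *)
Lemma lp_duality n (H : seq 'rV[R]_n) (lam : 'cV[R]_n) y :
    (forall h, h \in H -> 1 <= dot h lam) -> conic [set` H] y ->
  exists l : 'cV[R]_n, (forall h, h \in H -> 1 <= dot h l) /\
    conic [set h | h \in H /\ dot h l = 1] y.
Proof.
move=> Hlam cy.
pose hH := [seq hrow 1 h | h <- H].
pose W := [set r : R | conic [set` hH] (hrow r y)].
have W_le r (c : 'cV[R]_n) : (forall h, h \in H -> 1 <= dot h c) -> W r -> r <= dot y c.
  move=> Hc Wr; rewrite -subr_ge0.
  have -> : dot y c - r = dot (hrow r y) (col_mx (- 1)%:M c).
    by rewrite dot_hrow_col mulrN1 addrC.
  apply: conic_dot_ge0 Wr => _ /mapP[h hs ->].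
  by rewrite dot_hrow_col mul1r addrC subr_ge0 Hc.
have W0 : exists r, conic [set` hH] (hrow r y).
  elim: cy => [|s h y' s0 hs _ [r Wr]].
    by exists 0; rewrite hrow00; exact: conic0.
  exists (s * 1 + r); rewrite hrowD hrowZ; apply: conicD => //.
  by rewrite /= map_f.
have supW : has_sup W.
  by split=> //; exists (dot y lam) => r; exact: W_le.
pose M := sup W.
have [l [Hl lyM]] : exists l : 'cV[R]_n, (forall h, h \in H -> 1 <= dot h l) /\ dot y l <= M.
  (* Were there no [l] of value at most [M] at [y], Farkas' lemma would give representations of [y]
     of too large weight: unbounded ones if [mu] is 0, one of weight [mu^-1 + M] otherwise. *)
  have [/conic_cons[mu mu0]|[c [cs]]] := farkas (hrow (- M) (- y) :: hH) (hrow 1 0).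
    rewrite hrowN scalerN opprK -hrowZ -hrowD add0r => cmu.
    have [mu_eq0|mu_neq0] := eqVneq mu 0.
      have Wmu r : W r -> W (1 + r).
        move: cmu; rewrite mu_eq0 mul0r scale0r addr0 => c1 Wr.
        by rewrite /W /= -[y]add0r hrowD; exact: conic_add.
      have [r Wr] := W0.
      have Wk k : W (k%:R + r).
        by elim: k => [|k IH]; rewrite ?add0r // -nat1r -addrA; exact: Wmu.
      have := archi_boundP (x := Num.max 0 (dot y lam - r)).
      rewrite le_max lexx => /(_ isT); set k := Num.bound _ => hk.
      have := W_le _ _ Hlam (Wk k); rewrite -lerBrDr leNgt.
      by rewrite (le_lt_trans _ hk) // le_max lexx orbT.
    have mup : 0 < mu by rewrite lt0r mu_neq0.
    have : W (mu^-1 + M).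
      rewrite /W /=; have := conic_scale (a := mu^-1) _ cmu.
      rewrite invr_ge0 => /(_ mu0); rewrite -hrowZ mulrDr mulr1 mulKf // scalerA.
      by rewrite mulVf // scale1r.
    by move=> /(sup_upper_bound supW); rewrite -/M gerDr leNgt invr_gt0 mup.
  rewrite dot_hrow dot0l addr0 mul1r => c0.
  exists (- (c 0 0)^-1 *: dsubmx c); split.
    move=> h hs; have := cs (hrow 1 h).
    rewrite inE map_f // orbT => /(_ isT); rewrite dot_hrow mul1r => hc.
    by rewrite dotZr mulNr -mulrN ler_pdivlMl // mulr1; lra.
  have := cs (hrow (- M) (- y)); rewrite inE eqxx => /(_ isT).
  by rewrite dot_hrow dotNl => hc; rewrite dotZr mulNr -mulrN ler_pdivrMl //; lra.
exists l; split=> //.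
pose H1 := [seq h <- H | dot h l == 1].
have [cH1|[c [cs cy0]]] := farkas H1 y.
  apply: conic_subset cH1 => h /=; rewrite mem_filter => /andP[/eqP ? ?]; by split.
(* A form [c] separating [y] from the tight generators would allow a move from [l] to [l - e *: c],
   which stays feasible but has a value below [M] at [y]. *)
exfalso.
have [|e e0 He] := @eventually_small_seq _ H (fun h d => 1 <= dot h (l - d *: c)).
  move=> h hs; have h1 := Hl _ hs.
  have [hc|hc] := leP (dot h c) 0.
    exists 1 => // d /andP[d0 _]; rewrite dotBr dotZr.
    by rewrite (le_trans h1) // lerDl oppr_ge0 mulr_ge0_le0 // ltW.
  have hl : dot h l != 1.
    apply/eqP => hl; have := cs h; rewrite mem_filter hl eqxx hs => /(_ isT).
    by rewrite leNgt hc.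
  exists ((dot h l - 1) / dot h c).
    by rewrite divr_gt0 // subr_gt0 lt_neqAle eq_sym hl.
  move=> d /andP[_]; rewrite ler_pdivlMr // => hd.
  by rewrite dotBr dotZr; lra.
have := He e; rewrite e0 lexx => /(_ isT) Hle.
have : M <= dot y (l - e *: c).
  by apply: sup_le_ub => // r; exact: W_le.
rewrite dotBr dotZr => h; have : 0 < e * dot y c by rewrite mulr_gt0.
by lra.
Qed.

End LP.

(** * Unimodular covers of three-dimensional cones *)

Section Sebo.
Context {R : realType}.
Implicit Types (X Y : 'M[R]_3) (w y a b c : 'rV[R]_3).

Lemma class_card n (a : 'rV[R]_n) :
  (forall i, a 0 i != 0) -> #|[pred i | a 0 i != 0]| = n.
Proof. by move=> h; rewrite -[RHS]card_ord; apply: eq_card => i; rewrite !inE h. Qed.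

Lemma class_card_full n (a : 'rV[R]_n) :
  (n <= #|[pred i | (a 0 i != 0)%R]|)%N -> forall i, a 0 i != 0.
Proof.
rewrite -[X in (X <= _)%N]card_ord => h i.
have E : #|[pred i | a 0 i != 0]| = #|(predT : pred 'I_n)|.
  by apply/eqP; rewrite eqn_leq max_card; apply: leq_trans h; rewrite card_ord.
by have := elimT (subset_cardP E) (subset_predT _) i; rewrite !inE.
Qed.

Lemma frac_id (x : R) : 0 <= x < 1 -> frac x = x.
Proof. by move=> x01; rewrite /frac (_ : Num.floor x = 0) ?subr0 //; exact: floor_def. Qed.

Lemma int_itv01_eq0 (x : R) : x \is a Num.int -> 0 <= x < 1 -> x = 0.
Proof. by rewrite -frac_eq0 => /eqP h /frac_id <-. Qed.

Lemma class_sum_gt0 n (a : 'rV[R]_n) :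
  (forall i, 0 <= a 0 i < 1) -> a != 0 -> 0 < \sum_i a 0 i.
Proof.
move=> a01 /rV0Pn[i ai]; rewrite (bigD1 i) //= ltr_pwDl //.
  by rewrite lt0r ai; have /andP[] := a01 i.
by apply: sumr_ge0 => j _; have /andP[] := a01 j.
Qed.

Lemma class_comb_neq0 n (X : 'M[R]_n) (a : 'rV[R]_n) : X \in unitmx -> a != 0 -> a *m X != 0.
Proof.
move=> uX; apply: contra => /eqP h.
by rewrite -[a](mulmxK uX) h mul0mx.
Qed.

Lemma dot_mulmx n (X : 'M[R]_n) (a : 'rV[R]_n) l :
  dot (a *m X) l = \sum_i a 0 i * dot (row i X) l.
Proof. by rewrite mulmx_sum_row dot_suml; apply: eq_bigr => i _; rewrite dotZl. Qed.

Lemma conic_mulmx n (S : set 'rV[R]_n) (X : 'M[R]_n) (a : 'rV[R]_n) :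
  (forall i, 0 <= a 0 i) -> (forall i, a 0 i != 0 -> conic S (row i X)) ->
  conic S (a *m X).
Proof.
move=> a0 aS; rewrite mulmx_sum_row; apply: conic_sum => i _.
have [->|ai] := eqVneq (a 0 i) 0; first by rewrite scale0r; exact: conic0.
by apply: conic_scale => //; exact: aS.
Qed.

Lemma dot_col_invmx n (X : 'M[R]_n) (w : 'rV[R]_n) i :
  dot w (col i (invmx X)) = (w *m invmx X) 0 i.
Proof. by rewrite /dot !mxE; apply: eq_bigr => j _; rewrite mxE. Qed.

(* By White's theorem all generators to be used, except the [k]-th vertex, lie on one
   lattice plane [phi = 1], so that the coordinate sums of classes are integers. *)
Lemma empty_simplex_refine X y t (K : set 'rV[R]_3) :
    frame K y X t -> (forall i, K (row i X)) ->
    (forall c, intmx (c *m X) -> (forall i, 0 < c 0 i < 1) -> K (c *m X)) ->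
    (forall a, lattice_class X a -> (forall i, 0 < a 0 i) /\ 1 < \sum_i a 0 i < 2) ->
  exists Y s, frame K y Y s /\ intmx (invmx Y).
Proof.
move=> [iX uX yE t0 _] KX Kpar empty.
have [k kP] := white_width iX uX empty.
(* The vertices of the simplex and the lattice points of the open parallelepiped. *)
pose S2 := [set w | exists c : 'rV[R]_3, [/\ w = c *m X, intmx w &
  (exists i, c = delta_mx 0 i) \/ forall i, 0 < c 0 i < 1]].
have S2K w : S2 w -> K w.
  move=> [c [-> ic [[i ->]|h]]]; last exact: Kpar.
  by rewrite -rowE.
(* [phi] is the coordinate sum without the [k]-th term, integral on the lattice by White's theorem;
   [kap] is the [k]-th coordinate. *)
pose phi : 'cV[R]_3 := invmx X *m \col_i (i != k)%:R.
pose kap : 'cV[R]_3 := col k (invmx X).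
have phiE c : dot (c *m X) phi = \sum_(i | i != k) c 0 i.
  rewrite /dot /phi mulmxA -(mulmxA c) mulmxV // mulmx1 mxE [RHS]big_mkcond.
  by apply: eq_bigr => i _; rewrite mxE; case: ifP; rewrite ?mulr1 ?mulr0.
have kapE c : dot (c *m X) kap = c 0 k.
  by rewrite dot_col_invmx mulmxK.
have phiI w : intmx w -> dot w phi \is a Num.int.
  move=> iw; have wE : w = w *m invmx X *m X by rewrite mulmxKV.
  by rewrite wE phiE kP // -wE.
have mem_S2 c : intmx (c *m X) -> (forall i, i != k -> 0 <= c 0 i) ->
    dot (c *m X) phi = 1 -> 0 <= c 0 k < 1 -> S2 (c *m X).
  move=> ic c0 cphi ck; exists c; split=> //.
  rewrite phiE in cphi.
  have c1 i : i != k -> c 0 i <= 1.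
    move=> ik; rewrite -cphi (bigD1 i) //= lerDl sumr_ge0 // => j /andP[jk _].
    exact: c0.
  have [ci|Cf] := lattice_class_frac iX ic; last first.
    right=> i; have [fpos _] := empty _ Cf.
    have ciN : c 0 i \isn't a Num.int by rewrite -frac_eq0 gt_eqF //; have := fpos i; rewrite mxE.
    have ci0 : c 0 i != 0 by apply: contraNN ciN => /eqP ->; exact: rpred0.
    have ci1 : c 0 i != 1 by apply: contraNN ciN => /eqP ->; exact: rpred1.
    have [ik|ik] := eqVneq i k.
      by move: ck ci0; rewrite -ik lt0r => /andP[-> ->] ->.
    by rewrite lt0r ci0 c0 // lt_neqAle ci1 c1.
  have ck0 : c 0 k = 0 by apply: int_itv01_eq0.
  left; have [i [ik ci0]] : exists i, i != k /\ c 0 i != 0.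
    apply: contrapT => h; move: cphi; rewrite big1 => [/eqP|i ik].
      by rewrite eq_sym oner_eq0.
    by apply/eqP; apply: contrapT => /negP ci0; apply: h; exists i.
  have ci1 : c 0 i = 1.
    apply/eqP; rewrite -subr_eq0 -oppr_eq0 opprB; apply/eqP/int_itv01_eq0.
      by rewrite rpredB ?rpred1.
    by rewrite subr_ge0 c1 //= ltrBlDr ltrDl lt0r ci0 c0.
  exists i; apply/rowP => j; rewrite mxE eqxx /= eq_sym.
  have [->//|ji] := eqVneq j i.
  have [->//|jk] := eqVneq j k.
  move: cphi; rewrite (bigD1 i) //= ci1 -[X in _ = X]addr0 => /addrI.
  move=> /psumr_eq0P -> //; last by rewrite jk.
  by move=> l /andP[lk _]; exact: c0.
have S2_phi w : S2 w -> w = row k X \/ [/\ dot w phi = 1,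
    forall i, i != k -> 0 <= dot w (col i (invmx X)) & 0 <= dot w kap < 1].
  have colE' c i : dot (c *m X) (col i (invmx X)) = c 0 i.
    by rewrite dot_col_invmx mulmxK.
  move=> [c [-> ic [[i ->]|c01]]].
    have [->|ik] := eqVneq i k; first by left; rewrite -rowE.
    right; split.
    - rewrite phiE (bigD1 i) //= mxE !eqxx big1 ?addr0 // => j /andP[_ ji].
      by rewrite mxE (negPf ji) andbF.
    - by move=> j _; rewrite colE' mxE; case: (_ && _).
    - by rewrite kapE mxE eq_sym (negPf ik) lexx ltr01.
  right.
  have Cc : lattice_class X c.
    split=> //; first by move=> i; have /andP[/ltW-> ->] := c01 i.
    by apply/rV0Pn; exists k; have /andP[/gt_eqF->] := c01 k.
  have [_ /andP[s1 s2]] := empty _ Cc.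
  have /andP[ck0 ck1] := c01 k.
  split.
  - apply/eqP; rewrite -subr_eq0; have := phiI _ ic; rewrite phiE.
    move: s1 s2; rewrite (bigD1 k) //=; set f := \sum_(i | _) _ => s1 s2 fI.
    have [f1|f1] := leP 1 f.
      by apply/eqP/int_itv01_eq0; [rewrite rpredB ?rpred1 | lra].
    have f0 : f = 0 by apply: int_itv01_eq0 => //; lra.
    by move: s1; rewrite f0 addr0 ltNge (ltW ck1).
  - by move=> j _; rewrite colE'; have /andP[/ltW] := c01 j.
  - by rewrite kapE ltW.
have F2 : frame S2 y X t.
  split=> // i _; exists (delta_mx 0 i); rewrite -rowE; split=> //; first exact: row_int.
  by left; exists i.
have [Y [s mY]] := minimal_frame_exists (ex_intro _ X (ex_intro _ t F2)).
have [[iY uY yE2 s0 sS2] _] := mY.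
exists Y, s; split; first by split=> // i /sS2/S2K.
apply: contrapT => /negP/(lattice_class_exists iY uY)[b Cb].
have wX w : w = (w *m invmx X) *m X by rewrite mulmxKV.
have colw w i := dot_col_invmx X w i.
have kapw w : dot w kap = (w *m invmx X) 0 k by rewrite -colw.
(* A class of coordinate sum 1 that avoids the [k]-th vertex is a member of [S2] on the plane
   [phi = 1] and can be exchanged. *)
have on_plane c : lattice_class Y c -> (forall i, c 0 i != 0 -> row i Y <> row k X) ->
    \sum_i c 0 i = 1 -> False.
  move=> Cc ck c1; have [c01 c0 icY] := Cc.
  have suppS i : c 0 i != 0 -> S2 (row i Y).
    by move=> /(minimal_frame_class_support mY Cc); exact: sS2.
  have rows i : c 0 i != 0 -> [/\ dot (row i Y) phi = 1,
      forall j, j != k -> 0 <= dot (row i Y) (col j (invmx X)) & 0 <= dot (row i Y) kap < 1].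
    by move=> ci; have [/(ck _ ci)|] := S2_phi _ (suppS _ ci).
  have c_ge0 i : 0 <= c 0 i by have /andP[] := c01 i.
  apply: (minimal_frame_no_exchange mY icY (c := c)) => //.
  - rewrite [c *m Y]wX; apply: mem_S2; rewrite -?wX //.
    + move=> j jk; rewrite -colw dot_mulmx sumr_ge0 // => i _.
      have [->|/rows[_ h _]] := eqVneq (c 0 i) 0; first by rewrite mul0r.
      by rewrite mulr_ge0 // h.
    + rewrite dot_mulmx -c1; apply: eq_bigr => i _.
      have [->|/rows[-> _ _]] := eqVneq (c 0 i) 0; first by rewrite mul0r.
      by rewrite mulr1.
    + rewrite -kapw dot_mulmx; apply/andP; split.
        apply: sumr_ge0 => i _.
        have [->|/rows[_ _ /andP[h _]]] := eqVneq (c 0 i) 0; first by rewrite mul0r.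
        by rewrite mulr_ge0.
      have /rV0Pn[i ci] := c0.
      rewrite -c1 (bigD1 i) //= [X in _ < X](bigD1 i) //=; apply: ltr_leD.
        have [_ _ /andP[_ h]] := rows _ ci.
        by rewrite gtr_pMr // lt0r ci c_ge0.
      apply: ler_sum => j _.
      have [->|/rows[_ _ /andP[_ h]]] := eqVneq (c 0 j) 0; first by rewrite mul0r.
      by rewrite ler_piMr // ltW.
  - by move=> i; have /andP[] := c01 i.
  - by have /rV0Pn[i ci] := c0; exists i; rewrite lt0r ci c_ge0.
  - by move=> i; rewrite ltNge c_ge0.
have sumI c : lattice_class Y c -> (forall i, c 0 i != 0 -> dot (row i Y) phi = 1) ->
    \sum_i c 0 i \is a Num.int.
  move=> [_ _ icY] c1; have := phiI _ icY; rewrite dot_mulmx.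
  rewrite (_ : \sum_i c 0 i * _ = \sum_i c 0 i) //; apply: eq_bigr => i _.
  by have [->|/c1->] := eqVneq (c 0 i) 0; rewrite ?mul0r ?mulr1.
have [b01 b0 ibY] := Cb.
have suppb i : b 0 i != 0 -> 0 < s 0 i := minimal_frame_class_support mY Cb (i := i).
have b_ge0 i : 0 <= b 0 i by have /andP[] := b01 i.
(* If [b] avoids the [k]-th vertex, its coordinate sum and that of its opposite are positive
   integers with total at most 3, so one of them is 1. *)
have [[i0 [bi0 ri0]]|noexc] := pselect (exists i, b 0 i != 0 /\ row i Y = row k X); last first.
  have nob i : b 0 i != 0 -> row i Y <> row k X.
    by move=> bi h; apply: noexc; exists i.
  have bphi i : b 0 i != 0 -> dot (row i Y) phi = 1.
    by move=> bi; have [/(nob _ bi)|[]] := S2_phi _ (sS2 _ (suppb _ bi)).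
  have [b1|b1] := eqVneq (\sum_i b 0 i) 1; first exact: on_plane Cb nob b1.
  have Co := opp_classP iY Cb.
  apply: (on_plane _ Co); first by move=> i; rewrite opp_class_eq0 //; exact: nob.
  have := sum_opp_class b; have := class_sum_gt0 b01 b0.
  have [q01 q0 _] := Co; have := class_sum_gt0 q01 q0.
  have : \sum_i opp_class b 0 i \is a Num.int.
    apply: sumI => // i; rewrite opp_class_eq0 //; exact: bphi.
  have := sumI _ Cb bphi.
  have : (#|[pred i | (b 0 i != 0)%R]| <= 3)%N by rewrite -[X in (_ <= X)%N]card_ord max_card.
  set N := #|_|; rewrite -(ler_nat R).
  set sb := \sum_i b 0 i; set so := \sum_i opp_class b 0 i => N3 sbI soI so0 sb0 soE.
  have sb2 : 2 <= sb.
    rewrite leNgt; apply/negP => sb2; move: b1; rewrite -subr_eq0.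
    have [h|h] := leP 1 sb.
      by rewrite (int_itv01_eq0 (x := sb - 1)) ?eqxx ?rpredB ?rpred1 //; lra.
    by have := sb0; rewrite (int_itv01_eq0 sbI) ?ltxx //; lra.
  apply/eqP; rewrite -subr_eq0 -oppr_eq0 opprB; apply/eqP/int_itv01_eq0.
    by rewrite rpredB ?rpred1.
  by lra.
have others i : i != i0 -> b 0 i != 0 -> [/\ dot (row i Y) phi = 1,
    forall j, j != k -> 0 <= dot (row i Y) (col j (invmx X)) & 0 <= dot (row i Y) kap < 1].
  move=> ii0 bi; have [h|//] := S2_phi _ (sS2 _ (suppb _ bi)).
  exfalso; have : (delta_mx 0 i - delta_mx 0 i0 : 'rV[R]_3) != 0.
    by apply/rV0Pn; exists i; rewrite !mxE !eqxx (negPf ii0) subr0 oner_eq0.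
  move=> /(class_comb_neq0 uY)/eqP; apply.
  by rewrite mulmxBl -!rowE h ri0 subrr.
(* Otherwise [phi] is 1 at [w] and [kap] lies in [0, 2). Depending on whether [kap] is below 1,
   either [w] or [w - row k X] belongs to [S2] and can be exchanged. *)
pose w := b *m Y.
have wphi : dot w phi = \sum_(i | i != i0) b 0 i.
  rewrite dot_mulmx (bigD1 i0) //= ri0 rowE phiE big1 ?mulr0 ?add0r.
    apply: eq_bigr => i ii0; have [->|/(others _ ii0)[-> _ _]] := eqVneq (b 0 i) 0.
      by rewrite mul0r.
    by rewrite mulr1.
  by move=> i ik; rewrite mxE (negPf ik) andbF.
have wphi2 : dot w phi < 2.
  rewrite wphi; apply: (@lt_le_trans _ _ (\sum_(i | i != i0) 1)).
    have [i ii0] : exists i, i != i0.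
      have [/eqP->|] := boolP (i0 == 0); first by exists 1.
      by exists 0; rewrite eq_sym.
    rewrite (bigD1 i) // [X in _ < X](bigD1 i) //=; apply: ltr_leD.
      by have /andP[] := b01 i.
    by apply: ler_sum => j _; have /andP[_ /ltW] := b01 j.
  have : \sum_(i < 3) (1 : R) = 3 by rewrite sum3; ring.
  by rewrite (bigD1 i0) //=; lra.
have wphi0 : 0 <= dot w phi by rewrite wphi sumr_ge0.
have wI : dot w phi \is a Num.int := phiI _ ibY.
have wphi_neq0 : dot w phi != 0.
  apply/eqP; rewrite wphi => h.
  have bz i : i != i0 -> b 0 i = 0 by move: i; exact: psumr_eq0P h.
  have wE : w = (b 0 i0 *: delta_mx 0 k) *m X.
    rewrite /w mulmx_sum_row (bigD1 i0) //= big1 ?addr0.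
      by rewrite ri0 -scalemxAl -rowE.
    by move=> i ii0; rewrite bz // scale0r.
  (* A class of [X] supported on a single coordinate contradicts emptiness. *)
  have Ck : lattice_class X (b 0 i0 *: delta_mx 0 k).
    split; last by rewrite -wE.
    - by move=> i; rewrite !mxE /=; case: (i == k); rewrite ?mulr1 ?mulr0 ?lexx ?ltr01.
    - by apply/rV0Pn; exists k; rewrite !mxE !eqxx mulr1.
  have [Ckpos _] := empty _ Ck.
  have [i ik] : exists i, i != k.
    have [/eqP->|] := boolP (k == 0); first by exists 1.
    by exists 0; rewrite eq_sym.
  by have := Ckpos i; rewrite !mxE (negPf ik) andbF mulr0 ltxx.
have wphi1 : dot w phi = 1.
  apply/eqP; rewrite -subr_eq0; have [h|h] := leP 1 (dot w phi).
    by apply/eqP/int_itv01_eq0; [rewrite rpredB ?rpred1 | lra].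
  by move/eqP: wphi_neq0; rewrite (int_itv01_eq0 wI) ?wphi0.
have wcol j : j != k -> 0 <= dot w (col j (invmx X)).
  move=> jk; rewrite dot_mulmx sumr_ge0 // => i _.
  have [->|bi] := eqVneq (b 0 i) 0; first by rewrite mul0r.
  rewrite mulr_ge0 //; have [->|ii0] := eqVneq i i0.
    rewrite ri0 colw -row_mul mulmxV // !mxE; by case: (_ == _).
  by have [_ + _] := others _ ii0 bi; apply.
have wkap : 0 <= dot w kap < 2.
  rewrite dot_mulmx (bigD1 i0) //= ri0 kapw -row_mul mulmxV // !mxE eqxx mulr1.
  have le1 : \sum_(i | i != i0) b 0 i * dot (row i Y) kap <= 1.
    rewrite -wphi1 wphi; apply: ler_sum => i ii0.
    have [->|/(others _ ii0)[_ _ /andP[_ h]]] := eqVneq (b 0 i) 0; first by rewrite mul0r.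
    by rewrite ler_piMr // ltW.
  have ge0 : 0 <= \sum_(i | i != i0) b 0 i * dot (row i Y) kap.
    apply: sumr_ge0 => i ii0.
    have [->|/(others _ ii0)[_ _ /andP[h _]]] := eqVneq (b 0 i) 0; first by rewrite mul0r.
    by rewrite mulr_ge0.
  by have /andP[? ?] := b01 i0; lra.
have [i1 [i1i0 bi1]] : exists i, i != i0 /\ 0 < b 0 i.
  apply: contrapT => h; move/eqP: wphi_neq0; apply; rewrite wphi big1 // => i ii0.
  apply/eqP; apply: contrapT => /negP bi; apply: h; exists i.
  by rewrite lt0r bi b_ge0.
have [wk1|wk1] := ltP (dot w kap) 1.
  apply: (minimal_frame_no_exchange mY ibY (c := b)) => //.
  - rewrite -/w [w]wX; apply: mem_S2; rewrite -?wX //.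
      by move=> i ik; rewrite -colw wcol.
    by rewrite -kapw wk1 andbT; case/andP: wkap.
  - by move=> i; have /andP[] := b01 i.
  - by exists i1.
  - by move=> i; rewrite ltNge b_ge0.
have w'E : w - row k X = (b - delta_mx 0 i0) *m Y by rewrite mulmxBl -rowE ri0.
have iw' : intmx (w - row k X) by apply: intmxB => //; exact: row_int.
have coord : (w - row k X) *m invmx X = w *m invmx X - delta_mx 0 k.
  rewrite mulmxBl; congr (_ - _).
  by rewrite rowE -mulmxA mulmxV // mulmx1.
apply: (minimal_frame_no_exchange mY iw' (c := b - delta_mx 0 i0)) => //.
- rewrite [w - _]wX; apply: mem_S2; rewrite -?wX //.
  + move=> i ik; rewrite coord !mxE (negPf ik) andbF subr0.
    by have := wcol _ ik; rewrite colw mxE.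
  + rewrite dotBl wphi1 rowE phiE big1 ?subr0 // => i ik.
    by rewrite mxE (negPf ik) andbF.
  + rewrite coord; move: wk1 wkap; rewrite kapw.
    by move: (w *m invmx X) => u; rewrite !mxE !eqxx /= => ? /andP[? ?]; lra.
- move=> i; rewrite !mxE; have /andP[_ bi] := b01 i.
  by rewrite (le_lt_trans _ bi) // gerDl oppr_le0 ler0n.
- by exists i1; rewrite !mxE (negPf i1i0) andbF subr0.
- move=> i; have [->|ii0] := eqVneq i i0; first by move=> _; exact: suppb.
  by rewrite !mxE (negPf ii0) andbF subr0 ltNge b_ge0.
Qed.

(* Sebo's theorem in dimension 3. *)
Theorem sebo (H : seq 'rV[R]_3) (lam : 'cV[R]_3) y :
    (forall h, h \in H -> intmx h) -> (forall h, h \in H -> 1 <= dot h lam) ->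
    (forall z, intmx z -> conic [set` H] z ->
       exists2 s : seq 'rV[R]_3, {subset s <= H} & z = \sum_(h <- s) h) ->
    conic [set` H] y ->
  exists X t, frame [set` H] y X t /\ intmx (invmx X).
Proof.
move=> iH Hlam gen cy.
have [l [Hl cH1]] := lp_duality Hlam cy.
set H1 := [set h | _ /\ _] in cH1.
have iH1 h : H1 h -> intmx h by case=> /iH.
have [X [t mX]] := minimal_frame_exists (conic_frame iH1 cH1).
have [[iX uX yE t0 tH1] _] := mX.
have [iX'|/(lattice_class_exists iX uX)[a0 Ca0]] := boolP (intmx (invmx X)).
  by exists X, t; split=> //; split=> // i /tH1[].
have supp a i : lattice_class X a -> a 0 i != 0 -> H1 (row i X).
  by move=> Ca /(minimal_frame_class_support mX Ca); exact: tH1.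
have dotE a : lattice_class X a -> dot (a *m X) l = \sum_i a 0 i.
  move=> Ca; rewrite dot_mulmx; apply: eq_bigr => i _.
  by have [->|/(supp _ _ Ca)[_ ->]] := eqVneq (a 0 i) 0; rewrite ?mul0r ?mulr1.
(* Members of [H] have height at least 1 under [l], so a nonzero sum of them of height below 2 is a
   single member. *)
have inH a : lattice_class X a -> \sum_i a 0 i < 2 -> a *m X \in H.
  move=> Ca a2; have [a01 an0 iaX] := Ca.
  have [|s sH sE] := gen _ iaX.
    apply: conic_mulmx => i; first by have /andP[] := a01 i.
    by move=> /(supp _ _ Ca)[hH _]; exact: conic_in.
  have : (size s)%:R <= dot (a *m X) l.
    rewrite sE dot_suml -sum1_size natr_sum big_seq [X in _ <= X]big_seq.
    by apply: ler_sum => h /sH; exact: Hl.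
  rewrite dotE // => /le_lt_trans/(_ a2); rewrite ltr_nat.
  have := class_comb_neq0 uX an0; rewrite sE.
  case: s sH sE => [|h [|//]] sH sE; first by rewrite big_nil eqxx.
  by rewrite big_seq1 => _ _; apply: sH; rewrite inE.
have sum_gt1 a : lattice_class X a -> 1 < \sum_i a 0 i.
  move=> Ca; rewrite ltNge; apply/negP => a1; have [a01 an0 iaX] := Ca.
  have aH : a *m X \in H by apply: inH => //; apply: le_lt_trans a1 _; rewrite ltr1n.
  have aH1 : H1 (a *m X).
    by split=> //; apply/eqP; rewrite eq_le Hl // dotE // a1.
  apply: (minimal_frame_no_exchange mX iaX aH1 erefl).
  - by move=> i; have /andP[] := a01 i.
  - by have /rV0Pn[i ai] := an0; exists i; rewrite lt0r ai; have /andP[] := a01 i.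
  - by move=> i; have /andP[ai _] := a01 i; rewrite ltNge ai.
(* The sums of a class and of its opposite both exceed 1 and add up to the size of the support,
   which is therefore 3. *)
have empty a : lattice_class X a -> (forall i, 0 < a 0 i) /\ 1 < \sum_i a 0 i < 2.
  move=> Ca; have a1 := sum_gt1 _ Ca.
  have := sum_gt1 _ (opp_classP iX Ca); rewrite sum_opp_class => o1.
  have [a01 _ _] := Ca.
  have card3 : (#|[pred i | (a 0 i != 0)%R]| <= 3)%N by rewrite -[X in (_ <= X)%N]card_ord max_card.
  have card3' : (3 <= #|[pred i | (a 0 i != 0)%R]|)%N.
    by rewrite -(ltr_nat R); lra.
  have an0 := class_card_full card3'.
  split; first by move=> i; rewrite lt0r an0; have /andP[] := a01 i.
  by rewrite a1 /=; move: o1; rewrite class_card // ; lra.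
have tpos i : 0 < t 0 i.
  apply: (minimal_frame_class_support mX Ca0); have [pos _] := empty _ Ca0.
  by rewrite gt_eqF.
have XH i : [set` H] (row i X) by have [] := tH1 _ (tpos i).
apply: (@empty_simplex_refine X y t) => //.
move=> c icX c01; apply: inH.
  split=> //; first by move=> i; have /andP[/ltW-> ->] := c01 i.
  by apply/rV0Pn; exists 0; have /andP[/gt_eqF->] := c01 0.
have [] : (forall i, 0 < c 0 i) /\ 1 < \sum_i c 0 i < 2; last by move=> _ /andP[].
apply: empty; split=> //; first by move=> i; have /andP[/ltW-> ->] := c01 i.
by apply/rV0Pn; exists 0; have /andP[/gt_eqF->] := c01 0.
Qed.

End Sebo.

(** * Convex hulls as slices of cones; simplices from unimodular frames *)

Section Hull.
Context {R : realType} {n : nat}.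
Implicit Types (x y : 'rV[R]_n) (X V : set 'rV[R]_n).

Lemma convex_setP (A : set 'rV[R]_n) :
  @convex_set R (convex_lmodType 'rV[R]_n) A <->
  forall x y (l : R), 0 <= l <= 1 -> A x -> A y -> A (l *: x + (1 - l) *: y).
Proof.
split=> [cA x y l l01 Ax Ay|cA x y l].
  have /andP[l0 l1] := l01.
  have := cA x y (Itv01 l0 l1); rewrite !inE; exact.
rewrite !inE => Ax Ay; apply: cA => //.
by rewrite ge0 le1.
Qed.

Lemma convex_hull_convex X x y l : 0 <= l <= 1 ->
  convex_hull X x -> convex_hull X y -> convex_hull X (l *: x + (1 - l) *: y).
Proof.
move=> l01 hx hy A CA; move: (CA) => [/convex_setP cA _].
by apply: cA => //; [exact: hx | exact: hy].
Qed.

Lemma sub_convex_hull X : X `<=` convex_hull X.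
Proof. by move=> x Xx A [_]; exact. Qed.

Lemma conic_hrow_inv X u : conic [set hrow 1 x | x in X] u ->
  exists r w, [/\ u = hrow r w, 0 <= r, r = 0 -> w = 0 &
    0 < r -> convex_hull X (r^-1 *: w)].
Proof.
elim=> [|s _ u' s0 [x Xx <-] _ [r [w [-> r0 rw0 rA]]]].
  by exists 0, 0; rewrite hrow00 ltxx.
exists (s * 1 + r), (s *: x + w); rewrite hrowD hrowZ mulr1; split=> //.
- exact: addr_ge0.
- move=> /eqP; rewrite paddr_eq0 // => /andP[/eqP -> /eqP/rw0 ->].
  by rewrite scale0r addr0.
move=> sr; have [r00|rn0] := eqVneq r 0.
  move: sr; rewrite r00 rw0 // !addr0 => sp; rewrite scalerA mulVf ?gt_eqF // scale1r.
  exact: sub_convex_hull.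
have rp : 0 < r by rewrite lt0r rn0.
rewrite scalerDr; have := @convex_hull_convex X x (r^-1 *: w) (s / (s + r)).
have -> : 1 - s / (s + r) = r / (s + r) by field; rewrite gt_eqF.
rewrite !scalerA mulrAC divff // mul1r [_^-1 * s]mulrC; apply; last exact: rA.
  by rewrite divr_ge0 ?addr_ge0 //= ler_pdivrMr // mul1r lerDl.
exact: sub_convex_hull.
Qed.

(** Moves convexity to height 1 of a cone, where induction on combinations and Farkas' lemma
    apply. *)
Lemma convex_hull_conic X y :
  convex_hull X y <-> conic [set hrow 1 x | x in X] (hrow 1 y).
Proof.
split.
  apply: (@smallest_sub _ _ X [set y | conic [set hrow 1 x | x in X] (hrow 1 y)]).
    apply/convex_setP => x z l /andP[l0 l1] /= cx cz.
    have -> : hrow 1 (l *: x + (1 - l) *: z) = l *: hrow 1 x + (1 - l) *: hrow 1 z.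
      by rewrite -!hrowZ -hrowD !mulr1; congr hrow; ring.
    by apply: conic_add; apply: conic_scale; rewrite ?subr_ge0.
  by move=> x Xx /=; apply: conic_in; exists x.
move=> /conic_hrow_inv[r [w [/hrow_inj[<- <-] _ _]]].
by move=> /(_ ltr01); rewrite invr1 scale1r.
Qed.

Lemma convex_hull_sub X V : X `<=` convex_hull V -> convex_hull X `<=` convex_hull V.
Proof.
move=> XV y /convex_hull_conic cy; apply/convex_hull_conic.
by apply: conic_conic cy => _ [x /XV/convex_hull_conic cx <-].
Qed.

Lemma convex_hullS X V : X `<=` V -> convex_hull X `<=` convex_hull V.
Proof. by move=> XV; apply: convex_hull_sub => x /XV; exact: sub_convex_hull. Qed.

Lemma hrow_int r x : r \is a Num.int -> intmx x -> intmx (hrow r x).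
Proof.
move=> ir /mxOverP ix; apply/mxOverP => i j; rewrite mxE; case: splitP => k _.
  by rewrite mxE; case: (_ == _); rewrite ?mulr1n ?mulr0n ?rpred0.
exact: ix.
Qed.

Lemma hrow_int_inv r x : intmx (hrow r x) -> intmx x.
Proof.
move=> /mxOverP ix; apply/mxOverP => i j.
by have := ix i (rshift 1 j); rewrite row_mxEr.
Qed.

Lemma hrow00E r x : hrow r x 0 0 = r.
Proof.
have /hrow_inj[<- _] : hrow r x = hrow (hrow r x 0 0) (rsubmx (hrow r x)) by exact: hrowE.
by [].
Qed.

Lemma height1 (u : 'rV[R]_(1 + n)) : u 0 0 = 1 -> u = hrow 1 (rsubmx u).
Proof. by move=> u1; rewrite -u1 -hrowE. Qed.

Lemma unimodular_frame_simplex V y (X : 'M[R]_(1 + n)) t :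
    frame [set hrow 1 x | x in V `&` Zlat] (hrow 1 y) X t -> intmx (invmx X) ->
  exists S, [/\ unimodular_simplex S, S y & S `<=` convex_hull V].
Proof.
move=> [iX uX yE t0 tS] iX'.
pose K := [pred i | 0 < t 0 i].
have K0 : (0 < #|K|)%N.
  rewrite lt0n; apply/eqP => /card0_eq K0.
  have /rowP/(_ 0) : hrow 1 y = 0.
    rewrite yE (_ : t = 0) ?mul0mx //; apply/rowP => i; rewrite mxE; apply/eqP.
    by have := K0 i; rewrite !inE => /negbT; rewrite -leNgt eq_le t0 andbT.
  by rewrite hrow00E mxE => /eqP; rewrite oner_eq0.
have [m [e [e_inj eK]]] : exists m (e : 'I_m.+1 -> 'I_(1 + n)),
    injective e /\ forall i, 0 < t 0 i <-> exists j, e j = i.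
  exists #|K|.-1, (fun j => enum_val (cast_ord (prednK K0) j)); split.
    by move=> i j /enum_val_inj/cast_ord_inj.
  move=> i; split=> [ti|[j <-]]; last by have := enum_valP (cast_ord (prednK K0) j).
  have iK : i \in K by [].
  exists (cast_ord (esym (prednK K0)) (enum_rank_in iK i)).
  by rewrite cast_ordKV enum_rankK_in.
pose g i := X i 0; pose p i := rsubmx (row i X).
have rowXE i : row i X = hrow (g i) (p i).
  by rewrite [LHS]hrowE mxE.
have rowe j : [/\ g (e j) = 1, V (p (e j)) & Zlat (p (e j))].
  have : 0 < t 0 (e j) by apply/eK; exists j.
  by move=> /tS[x [Vx Zx]]; rewrite rowXE => /hrow_inj[<- <-].
pose x j := p (e j).
have pZ i : intmx (p i) by apply: (@hrow_int_inv (g i)); rewrite -rowXE row_int.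
have gZ i : g i \is a Num.int by exact: (mxOverP iX).
exists (convex_hull (range x)); split; last first.
- by apply: convex_hullS => _ [j _ <-]; have [] := rowe j.
- apply/convex_hull_conic; rewrite yE; apply: conic_mulmx => // i ti.
  have /eK[j ej] : 0 < t 0 i by rewrite lt0r ti t0.
  apply: conic_in; exists (x j); first by exists j.
  by rewrite rowXE -ej; have [-> _ _] := rowe j.
exists m, x; split=> //; first by move=> j; have [] := rowe j.
pose k0 := e ord0.
have [gk0 _ _] := rowe ord0; rewrite -/k0 in gk0.
have /choice[f fP] : forall i : 'I_m, exists j : 'I_n, e (lift ord0 i) = lift k0 j.
  move=> i; have : k0 != e (lift ord0 i).
    by apply/eqP => /e_inj /eqP; rewrite (negPf (neq_lift _ _)).
  by move=> /unlift_some[j ->]; exists j.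
(* Subtracting from each row its height times the base row [k0] brings it to height 0. For used rows
   the result is an edge, and all the results together form a basis of the lattice. *)
pose b (j : 'I_n) : 'rV[R]_n := p (lift k0 j) - g (lift k0 j) *: p k0.
exists b, f; split; last first.
- move=> i; rewrite /b /x -fP; have [-> _ _] := rowe (lift ord0 i).
  by rewrite scale1r.
- move=> i j fij; apply: (@lift_inj _ ord0); apply: e_inj.
  by rewrite !fP fij.
split=> [j|z Zz]; first by apply: intmxB => //; exact: intmxZ.
pose al := hrow 0 z *m invmx X.
have al_int : intmx al by apply: intmxM => //; exact: hrow_int.
have alE : al *m X = hrow 0 z by rewrite mulmxKV.
have comb (c : 'rV[R]_(1 + n)) : c *m X = hrow (\sum_i c 0 i * g i) (\sum_i c 0 i *: p i).
  rewrite mulmx_sum_row (eq_bigr (fun i => hrow (c 0 i * g i) (c 0 i *: p i))).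
    apply: (big_ind3 (fun u v w => u = hrow v w)) => //.
      by rewrite hrow00.
    by move=> ? ? ? ? ? ? -> ->; rewrite hrowD.
  by move=> i _; rewrite hrowZ -rowXE.
(* For a vector of height 0 the coordinate at [k0] is determined by the others. *)
have b_sum (c : 'I_n -> R) : hrow 0 (\sum_j c j *: b j) =
    (\row_i (if unlift k0 i is Some j then c j
             else - \sum_j c j * g (lift k0 j))) *m X.
  set v := \row_i _; have vl j : v 0 (lift k0 j) = c j by rewrite mxE liftK.
  have v0 : v 0 k0 = - \sum_j c j * g (lift k0 j) by rewrite mxE unlift_none.
  rewrite comb !(bigD1_ord k0) //= v0 gk0 mulr1; congr hrow.
    rewrite [X in _ + X](eq_bigr (fun j => c j * g (lift k0 j))) ?addNr // => j _.
    by rewrite vl.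
  rewrite [X in _ + X](eq_bigr (fun j => c j *: p (lift k0 j))); last first.
    by move=> j _; rewrite vl.
  rewrite scaleNr scaler_suml addrC -sumrB; apply: eq_bigr => j _.
  by rewrite /b scalerBr scalerA.
exists [ffun j => Num.floor (al 0 (lift k0 j))]; split.
  have : hrow 0 z = hrow 0 (\sum_j al 0 (lift k0 j) *: b j).
    rewrite b_sum -alE; congr (_ *m X); apply/rowP => i; rewrite [RHS]mxE.
    case: (unliftP k0 i) => [j ->//|->].
    have : hrow 0 z = hrow (\sum_i al 0 i * g i) (\sum_i al 0 i *: p i).
      by rewrite -alE comb.
    move=> /hrow_inj[+ _]; rewrite (bigD1_ord k0) //= gk0 mulr1 => /eqP.
    by rewrite eq_sym addr_eq0 => /eqP.
  move=> /hrow_inj[_ ->]; apply: eq_bigr => j _.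
  rewrite ffunE -scaler_int; congr (_ *: _); apply/esym/eqP.
  by rewrite -intrEfloor (mxOverP al_int).
move=> a aE; apply/ffunP => j; rewrite ffunE.
have : hrow 0 z = hrow 0 (\sum_j (a j)%:~R *: b j).
  by rewrite aE; congr hrow; apply: eq_bigr => i _; rewrite scaler_int.
rewrite b_sum /al => ->; rewrite mulmxK // mxE liftK.
by rewrite intrKfloor.
Qed.

End Hull.

(** * Classes supported at height 1 *)

Section AffineClass.
Context {R : realType} {n : nat}.

(** The coordinate sum is the height of a lattice point, hence an integer. Height 1 would give a
    point of [S] to exchange, so the sum is at least 2; the same holds for the opposite class. *)
Lemma affine_class_card (S T : set 'rV[R]_(1 + n)) y (X : 'M[R]_(1 + n)) t a :
    minimal_frame S y X t -> lattice_class X a ->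
    (forall i, a 0 i != 0 -> T (row i X)) -> (forall u, T u -> u 0 0 = 1) ->
    (forall u, intmx u -> u 0 0 = 1 -> conic T u -> S u) ->
  [/\ \sum_i a 0 i \is a Num.int, 2 <= \sum_i a 0 i &
      2 <= #|[pred i | (a 0 i != 0)%R]|%:R - \sum_i a 0 i].
Proof.
move=> mX Ca aT T1 TS; have [[iX uX _ _ _] _] := mX.
have heightE (c : 'rV[R]_(1 + n)) : (forall i, c 0 i != 0 -> T (row i X)) -> (c *m X) 0 0 = \sum_i c 0 i.
  move=> cT; rewrite mxE; apply: eq_bigr => i _.
  have [->|ci] := eqVneq (c 0 i) 0; first by rewrite mul0r.
  by have := T1 _ (cT _ ci); rewrite mxE => ->; rewrite mulr1.
have ge2 c : lattice_class X c -> (forall i, c 0 i != 0 -> T (row i X)) ->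
    \sum_i c 0 i \is a Num.int /\ 2 <= \sum_i c 0 i.
  move=> [c01 c0 icX] cT.
  have cI : \sum_i c 0 i \is a Num.int by rewrite -heightE // (mxOverP icX).
  split=> //; have cpos := class_sum_gt0 c01 c0.
  have [c1|c1] := eqVneq (\sum_i c 0 i) 1.
    have c_ge0 i : 0 <= c 0 i by have /andP[] := c01 i.
    exfalso; apply: (minimal_frame_no_exchange mX icX (c := c)) => //.
    - apply: TS => //; first by rewrite heightE.
      by apply: conic_mulmx => // i /cT; exact: conic_in.
    - by move=> i; have /andP[] := c01 i.
    - by have /rV0Pn[i ci] := c0; exists i; rewrite lt0r ci c_ge0.
    - by move=> i; rewrite ltNge c_ge0.
  rewrite leNgt; apply/negP => c2; move: c1; rewrite -subr_eq0.
  have [h|h] := leP 1 (\sum_i c 0 i).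
    by rewrite (int_itv01_eq0 (x := _ - 1)) ?eqxx ?rpredB ?rpred1 //; lra.
  by have := cpos; rewrite (int_itv01_eq0 cI) ?ltxx //; lra.
have [aI a2] := ge2 _ Ca aT; split=> //.
have [a01 _ _] := Ca.
have [] := ge2 _ (opp_classP iX Ca).
  by move=> i; rewrite opp_class_eq0 //; exact: aT.
by rewrite sum_opp_class.
Qed.

End AffineClass.

(** * Solid ellipsoids *)

Section Ellipsoid.
Context {R : realType} {d : nat}.
Context (L : 'M[R]_d) (a : 'rV[R]_d).
Implicit Types x y : 'rV[R]_d.

Definition quad x : R := \sum_i ((x *m L) 0 i - a 0 i) ^+ 2.

Lemma quad_convex x y l : 0 <= l <= 1 ->
  quad (l *: x + (1 - l) *: y) <= l * quad x + (1 - l) * quad y.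
Proof.
move=> /andP[l0 l1]; rewrite /quad !mulr_sumr -big_split /=; apply: ler_sum => i _.
rewrite mulmxDl -!scalemxAl !mxE.
set p := \sum_j _; set q := \sum_j _; rewrite -subr_ge0.
have -> : l * (p - a 0 i) ^+ 2 + (1 - l) * (q - a 0 i) ^+ 2 -
    (l * p + (1 - l) * q - a 0 i) ^+ 2 = l * (1 - l) * (p - q) ^+ 2 by ring.
by rewrite mulr_ge0 ?sqr_ge0 // mulr_ge0 // subr_ge0.
Qed.

(** A point inside lies on the chord in the direction [u] that [L] maps to a unit vector; along it
    [quad] is a monic quadratic polynomial, equal to 1 at the parameters [- be + rt] and
    [- be - rt]. *)
Lemma convex_hull_ellipsoid : (0 < d)%N -> L \in unitmx ->
  convex_hull [set x | quad x = 1] = [set x | quad x <= 1].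
Proof.
move=> d0 uL; apply/seteqP; split.
  apply: smallest_sub; last by move=> x /= ->.
  apply/convex_setP => x y l l01 /= qx qy.
  apply: le_trans (quad_convex _ _ l01) _.
  by have /andP[l0 l1] := l01; nra.
move=> x /= qx.
pose i0 := Ordinal d0.
pose u : 'rV[R]_d := delta_mx 0 i0 *m invmx L.
pose be := (x *m L) 0 i0 - a 0 i0.
have line s : quad (x + s *: u) = quad x + 2 * s * be + s ^+ 2.
  rewrite /quad mulmxDl -scalemxAl mulmxKV // /be; move: (x *m L) => v.
  rewrite (bigD1 i0) //= [in RHS](bigD1 i0) //= !mxE !eqxx mulr1.
  rewrite (eq_bigr (fun i => (v 0 i - a 0 i) ^+ 2)); first by ring.
  by move=> i ii0; rewrite !mxE (negPf ii0) andbF mulr0 addr0.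
pose rt := Num.sqrt (be ^+ 2 + (1 - quad x)).
have rad0 : 0 <= be ^+ 2 + (1 - quad x) by rewrite addr_ge0 ?sqr_ge0 // subr_ge0.
have rt2 : rt ^+ 2 = be ^+ 2 + (1 - quad x) by rewrite sqr_sqrtr.
have rt0 : 0 <= rt by exact: sqrtr_ge0.
have q1 : quad (x + (- be + rt) *: u) = 1.
  by rewrite line sqrrD rt2; ring.
have q2 : quad (x + (- be - rt) *: u) = 1.
  by rewrite line sqrrB rt2; ring.
have be_rt : `|be| <= rt by rewrite -sqrtr_sqr ler_wsqrtr // lerDl subr_ge0.
(* A chord of length 0: the point [x] itself lies on the ellipsoid. *)
have [rt00|rtn0] := eqVneq rt 0.
  apply: sub_convex_hull => /=; rewrite -[in LHS](addr0 x) -(scale0r u).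
  by move: be_rt q1; rewrite rt00 normr_le0 => /eqP ->; rewrite oppr0 addr0.
have rtp : 0 < rt by rewrite lt0r rtn0.
pose l := (rt + be) / (2 * rt).
have -> : x = l *: (x + (- be + rt) *: u) + (1 - l) *: (x + (- be - rt) *: u).
  rewrite !scalerDr !scalerA addrACA -!scalerDl.
  have -> : l + (1 - l) = 1 by ring.
  have -> : l * (- be + rt) + (1 - l) * (- be - rt) = 0 by rewrite /l; field.
  by rewrite scale0r scale1r addr0.
have cE := sub_convex_hull (X := [set x | quad x = 1]).
apply: convex_hull_convex; [|exact: cE | exact: cE].
move: be_rt; rewrite ler_norml => /andP[h1 h2].
rewrite divr_ge0 /=; [|lra|lra].
by rewrite ler_pdivrMr; lra.
Qed.

End Ellipsoid.

(** * Unimodular covers of ellipsoid polytopes in dimension 3 *)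

Section EllipsoidCover.
Context {R : realType}.

(* Reflecting the vertices of a simplex in the point m = (sum a_j x_j) / 2, weighted
   by the a_j, preserves the mean of any quadratic function. *)
Lemma quad_reflection m n (L : 'M[R]_n) (al : 'rV[R]_n) (x : 'I_m -> 'rV[R]_n) (a : 'I_m -> R) :
  \sum_j a j = 2 ->
  \sum_j a j * quad L al (\sum_i a i *: x i - x j) = \sum_j a j * quad L al (x j).
Proof.
move=> a2; rewrite /quad.
under eq_bigr do rewrite mulr_sumr.
rewrite exchange_big /=; under [RHS]eq_bigr do rewrite mulr_sumr.
rewrite [RHS]exchange_big /=; apply: eq_bigr => k _.
pose q j := (x j *m L) 0 k - al 0 k.
pose Q := \sum_i a i * q i.
have E j : ((\sum_i a i *: x i - x j) *m L) 0 k - al 0 k = Q - q j.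
  rewrite mulmxBl mulmx_suml !mxE summxE /Q /q.
  have -> : \sum_i a i * ((x i *m L) 0 k - al 0 k) =
      \sum_i (a i *: x i *m L) 0 k - 2 * al 0 k.
    rewrite -a2 mulr_suml -sumrB; apply: eq_bigr => i _.
    by rewrite -scalemxAl [in RHS]mxE; ring.
  by rewrite !mxE; ring.
under eq_bigr do rewrite E.
rewrite (eq_bigr (fun j => (Q ^+ 2 * a j - 2 * Q * (a j * q j)) + a j * q j ^+ 2)); last first.
  by move=> j _; ring.
rewrite big_split /= sumrB -!mulr_sumr a2 -/Q.
by rewrite (_ : _ - _ = 0) ?add0r //; ring.
Qed.

Lemma ellipsoid_unimodular_cover (E : set 'rV[R]_3) : ellipsoid E ->
  ellipsoid_polytope E = unimodular_cover (ellipsoid_polytope E).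
Proof.
move=> [L [al [rL EE]]]; apply/seteqP; split; last by move=> y [T [_ TP]] /TP.
move=> y; rewrite /ellipsoid_polytope.
have uL : L \in unitmx by rewrite -row_free_unit /row_free rL.
have hE : convex_hull E = [set x | quad L al x <= 1].
  by rewrite -convex_hull_ellipsoid // EE.
set V := convex_hull E `&` Zlat => Vy.
have Vq x : V x <-> quad L al x <= 1 /\ intmx x by rewrite /V hE.
have hullV x : convex_hull V x -> quad L al x <= 1.
  move=> h; suff : convex_hull E x by rewrite hE.
  have VE : V `<=` convex_hull E by move=> z [].
  exact: convex_hull_sub VE _ h.
pose S := [set hrow 1 x | x in V].
have iS h : S h -> intmx h by move=> [x /Vq[_ ix] <-]; exact: hrow_int.
have /convex_hull_conic/(conic_frame iS)/minimal_frame_exists[X [t mX]] := Vy.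
have [FX _] := mX; have [iX uX yE t0 tS] := FX.
suff iX' : intmx (invmx X).
  have SE : S = [set hrow 1 x | x in V `&` Zlat].
    by congr image; rewrite /V -setIA setIid.
  rewrite /minimal_frame SE in FX.
  have [T [uT Ty TV]] := unimodular_frame_simplex FX iX'.
  by exists T.
apply: contrapT => /negP/(lattice_class_exists iX uX)[a Ca].
have [a01 a0 iaX] := Ca.
have supp i : a 0 i != 0 -> S (row i X).
  by move=> /(minimal_frame_class_support mX Ca); exact: tS.
have S1 u : S u -> u 0 0 = 1 by move=> [x _ <-]; rewrite hrow00E.
have closedS (u : 'rV[R]_(1 + 3)) : intmx u -> u 0 0 = 1 -> conic S u -> S u.
  move=> iu /height1 uE; rewrite uE => cu; exists (rsubmx u) => //.
  apply/Vq; split; last by apply: (@hrow_int_inv _ _ 1); rewrite -uE.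
  by apply: hullV; apply/convex_hull_conic.
(* Both [a] and its opposite have coordinate sum at least 2, so all four rows are used and the sum
   is exactly 2. *)
have [aI a2 an2] := affine_class_card mX Ca supp S1 closedS.
have card4 : (#|[pred i | (a 0 i != 0)%R]| <= 4)%N by rewrite -[X in (_ <= X)%N](card_ord 4) max_card.
have an0 : forall i, a 0 i != 0.
  by apply: class_card_full; rewrite -(ler_nat R) ; lra.
rewrite class_card // in an2.
have sum2 : \sum_i a 0 i = 2 by apply/eqP; rewrite eq_le a2 andbT; lra.
have /choice[x xP] : forall i, exists x, V x /\ row i X = hrow 1 x.
  by move=> i; have [x Vx xE] := supp _ (an0 i); exists x.
have apos i : 0 < a 0 i by rewrite lt0r an0; have /andP[] := a01 i.
(* The reflection of [x j] in the mean of the vertices with weights [a 0 i / 2]. *)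
pose z j := \sum_i a 0 i *: x i - x j.
have zX j : hrow 1 (z j) = (a - delta_mx 0 j) *m X.
  rewrite mulmxBl -rowE (proj2 (xP j)) mulmx_sum_row.
  have -> : \sum_i a 0 i *: row i X = hrow 2 (\sum_i a 0 i *: x i).
    rewrite -sum2; rewrite (eq_bigr (fun i => hrow (a 0 i) (a 0 i *: x i))).
      apply: (big_ind3 (fun u v w => u = hrow v w)) => //; first by rewrite hrow00.
      by move=> ? ? ? ? ? ? -> ->; rewrite hrowD.
    by move=> i _; rewrite (proj2 (xP i)) -hrowZ mulr1.
  by rewrite -hrowB; congr hrow; ring.
have iz j : intmx (hrow 1 (z j)).
  by rewrite zX mulmxBl; apply: intmxB => //; rewrite -rowE row_int.
have [j zj] : exists j, quad L al (z j) <= 1.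
  apply: contrapT => h.
  have : \sum_j a 0 j * quad L al (z j) <= \sum_j a 0 j.
    rewrite quad_reflection //; apply: ler_sum => i _.
    have [/Vq[qx _] _] := xP i.
    by rewrite ler_piMr // ltW.
  rewrite leNgt => /negP; apply.
  have hz i : 1 < quad L al (z i).
    by rewrite ltNge; apply/negP => hi; apply: h; exists i.
  rewrite (bigD1 0) //= [X in _ < X](bigD1 0) //=; apply: ltr_leD.
    by rewrite ltr_pMr.
  by apply: ler_sum => i _; rewrite ler_pMr // ltW.
have Sz : S (hrow 1 (z j)).
  by exists (z j) => //; apply/Vq; split=> //; exact: hrow_int_inv (iz j).
(* Only the coordinate at [j] is negative, which is allowed since every row is used. *)
apply: (minimal_frame_no_exchange mX (iz j) Sz (zX j)).
- move=> i; rewrite !mxE; have /andP[_ ai] := a01 i.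
  by rewrite (le_lt_trans _ ai) // gerDl oppr_le0 ler0n.
- have [i ij] : exists i, i != j.
    have [/eqP->|] := boolP (j == 0); first by exists 1.
    by exists 0; rewrite eq_sym.
  by exists i; rewrite !mxE (negPf ij) andbF subr0.
- by move=> i _; apply: (minimal_frame_class_support mX Ca).
Qed.

End EllipsoidCover.

(** * Non-normal ellipsoid polytopes in dimension at least 6 *)

Section Nonnormal.
Context {R : realType} {m : nat}.
Local Notation d := m.+4.+2.
Implicit Types z : 'rV[R]_d.

Lemma sum_first6 (F : nat -> R) : (forall j, (6 <= j)%N -> F j = 0) ->
  \sum_(j < d) F j = F 0%N + F 1%N + F 2%N + F 3%N + F 4%N + F 5%N.
Proof.
move=> F0; do 6!rewrite big_ord_recl; rewrite big1 ?addr0 ?addrA //.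
by move=> j _; apply: F0.
Qed.

(* The rows of [half_mx] are a basis of the lattice Z^d + Z (1/2, .., 1/2, 0, .., 0)
   with six halves. *)
Definition half_mx : 'M[R]_d :=
  \matrix_(i, j) (if i == 0 then (if (j < 6)%N then 2^-1 else 0) else (i == j)%:R).

Lemma mul_half_mx z j : (z *m half_mx) 0 j =
  (if (j < 6)%N then z 0 0 / 2 else 0) + (if j == 0 then 0 else z 0 j).
Proof.
rewrite mxE (bigD1 0) //= mxE eqxx (fun_if ( *%R (z 0 0))) mulr0; congr (_ + _).
have [->|j0] := eqVneq j 0.
  by rewrite big1 // => i i0; rewrite mxE (negPf i0) mulr0.
rewrite (bigD1 j) //= mxE (negPf j0) eqxx mulr1 big1 ?addr0 // => i /andP[i0 ij].
by rewrite mxE (negPf i0) (negPf ij) mulr0.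
Qed.

Lemma half_mx_unit : half_mx \in unitmx.
Proof.
rewrite -row_free_unit -kermx_eq0; apply/eqP/row_matrixP => i; rewrite row0.
have : row i (kermx half_mx) *m half_mx = 0 by rewrite -row_mul mulmx_ker row0.
move: (row i _) => z zM.
have E j := mul_half_mx z j; rewrite zM in E.
have z0 : z 0 0 = 0.
  by have := E 0; rewrite mxE /= addr0 => /esym/eqP; rewrite mulf_eq0 invr_eq0 pnatr_eq0 orbF => /eqP.
apply/rowP => j; rewrite [RHS]mxE; have [->//|j0] := eqVneq j 0.
by have := E j; rewrite z0 mul0r if_same add0r (negPf j0) mxE.
Qed.

(** The squared distance from (-1/4, .., -1/4) to a unit vector: 25/16 + (d - 1)/16. *)
Definition rho2 : R := 3 / 2 + d%:R / 16.
(** For w = z half_mx the squared distance of w to (-1/4, .., -1/4) is [half_form z + d%:R / 16], so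
    the ball is given by [half_form z <= 3 / 2]. *)
Definition half_form z : R := \sum_j ((z *m half_mx) 0 j ^+ 2 + (z *m half_mx) 0 j / 2).
Definition half_height z : R := \sum_j (z *m half_mx) 0 j.

Lemma rho2_gt0 : 0 < rho2.
Proof. by rewrite ltr_pwDl ?divr_gt0 // divr_ge0. Qed.

Definition ball_mx : 'M[R]_d := (Num.sqrt rho2)^-1 *: half_mx.
Definition ball_center : 'rV[R]_d := const_mx (- (4 * Num.sqrt rho2)^-1).

Lemma sqrt_rho2_gt0 : 0 < Num.sqrt rho2.
Proof. by rewrite sqrtr_gt0 rho2_gt0. Qed.

Lemma ball_mx_unit : ball_mx \in unitmx.
Proof.
rewrite /ball_mx unitmxZ ?half_mx_unit // unitfE invr_eq0 gt_eqF //.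
exact: sqrt_rho2_gt0.
Qed.

Lemma quad_ball z : (quad ball_mx ball_center z <= 1) = (half_form z <= 3 / 2).
Proof.
have r0 := sqrt_rho2_gt0.
have -> : quad ball_mx ball_center z = (half_form z + d%:R / 16) / rho2.
  have -> : d%:R / 16 = \sum_(j < d) (16^-1 : R).
    by rewrite sumr_const card_ord -[RHS]mulr_natl.
  rewrite /quad /half_form -big_split /= mulr_suml; apply: eq_bigr => j _.
  rewrite /ball_mx -scalemxAr mxE [ball_center _ _]mxE.
  move: (_ 0 j) => w; rewrite -[X in _ / X](sqr_sqrtr (ltW rho2_gt0)).
  by field; rewrite gt_eqF.
rewrite ler_pdivrMr ?rho2_gt0 // mul1r /rho2.
by apply/idP/idP => h; lra.
Qed.

(** If [z 0 0] is even, the point has integer coordinates, each at most its square, and the form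
    bounds 3/2 times the height by 3/2. If it is odd, six coordinates are at least 1/2 in absolute
    value, their squares already amount to 3/2, and the height is at most 0. *)
Lemma half_lattice z : intmx z -> half_form z <= 3 / 2 ->
  half_height z <= 1 /\ (half_height z = 1 -> z 0 0 / 2 \is a Num.int).
Proof.
move=> /mxOverP iz fz.
have E : half_form z = \sum_j (z *m half_mx) 0 j ^+ 2 + half_height z / 2.
  by rewrite /half_form big_split /= -mulr_suml.
have [ih|nih] := boolP (z 0 0 / 2 \is a Num.int).
  split=> //; suff : half_height z <= \sum_j (z *m half_mx) 0 j ^+ 2 by lra.
  apply: ler_sum => j _; set w := _ 0 j.
  have : w \is a Num.int.
    by rewrite /w mul_half_mx; do 2!case: ifP => _; rewrite ?add0r ?addr0 // rpredD.
  move=> /intrP[k ->]; rewrite -rmorphXn /= ler_int; nia.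
suff : 3 / 2 <= \sum_j (z *m half_mx) 0 j ^+ 2.
  by move=> h; split; [lra | move=> h1; exfalso; lra].
apply: (@le_trans _ _ (\sum_(j < d) (if (j < 6)%N then 4^-1 else 0 : R))).
  rewrite (sum_first6 (F := fun j => if (j < 6)%N then 4^-1 else 0)) /=; first by lra.
  by move=> j; rewrite leqNgt; case: ifP.
apply: ler_sum => j _; rewrite mul_half_mx; case: ifP => j6; last exact: sqr_ge0.
set w := (if _ then _ else _).
have iw : w \is a Num.int by rewrite /w; case: ifP.
have : 2 * (z 0 0 / 2 + w) \is a Num.int.
  have -> : 2 * (z 0 0 / 2 + w) = z 0 0 + (w + w) by lra.
  exact: rpredD (iz _ _) (rpredD iw iw).
have : z 0 0 / 2 + w != 0.
  by apply: contraNneq nih => /eqP; rewrite addr_eq0 => /eqP ->; rewrite rpredN.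
move: (z 0 0 / 2 + w) => u u0 /intrP[k kE].
have k0 : k != 0 by apply: contraNneq u0 => k0; move: kE; rewrite k0 => ?; apply/eqP; lra.
have : (1 : int) <= k ^+ 2 by nia.
by rewrite -(ler_int R) rmorphXn /= -kE; lra.
Qed.

(** The unit vector e_i in coordinates with respect to the basis [half_mx], whose first member is
    h. *)
Definition unit_pt (i : 'I_d) : 'rV[R]_d := delta_mx 0 i *m invmx half_mx.

Lemma unit_ptE i : i != 0 -> unit_pt i = delta_mx 0 i.
Proof.
move=> i0; rewrite /unit_pt; apply: (canLR (mulmxK half_mx_unit)).
apply/rowP => j; rewrite mul_half_mx !mxE eqxx /= [0 == i]eq_sym (negPf i0) mul0r if_same add0r.
by have [->|] := eqVneq j 0; rewrite // eq_sym (negPf i0).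
Qed.

Lemma sum_unit_pt : \sum_(i < d | (i < 6)%N) unit_pt i = 2 *: delta_mx 0 0.
Proof.
rewrite /unit_pt -mulmx_suml; apply: (canLR (mulmxK half_mx_unit)).
apply/rowP => j; rewrite mul_half_mx summxE !mxE eqxx mulr1 divff ?pnatr_eq0 //.
have -> : (if j == 0 then 0 else 2 * (j == 0)%:R) = 0 :> R.
  by case: (j == 0); rewrite ?mulr0.
rewrite addr0; case: ifP => j6.
  rewrite (bigD1 j) //= mxE !eqxx big1 ?addr0 // => i /andP[_ ij].
  by rewrite mxE eq_sym (negPf ij) andbF.
rewrite big1 // => i i6; rewrite mxE eqxx /=; case: (eqVneq j i) => // ji.
by move: j6; rewrite ji i6.
Qed.

Lemma unit_pt_int i : intmx (unit_pt i).
Proof.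
have di (k : 'I_d) : intmx (delta_mx 0 k : 'rV[R]_d).
  by apply/mxOverP => ? ?; rewrite mxE; case: (_ && _).
have [->|i0] := eqVneq i 0; last by rewrite unit_ptE.
(* The remaining vector is e_0 = 2 h - e_1 - .. - e_5. *)
have := sum_unit_pt; rewrite (bigD1 0) //= => /(canRL (addrK _)) ->.
apply: intmxB; first exact: intmxZ.
apply: (big_ind (fun u : 'rV[R]_d => intmx u)) => [|? ?|k /andP[_ k0]].
- exact: intmx0.
- exact: intmxD.
- by rewrite unit_ptE.
Qed.

Lemma half_form_unit_pt i : half_form (unit_pt i) = 3 / 2.
Proof.
rewrite /half_form /unit_pt mulmxKV ?half_mx_unit // (bigD1 i) //= !mxE !eqxx big1 ?addr0.
  by rewrite /=; lra.
by move=> j ji; rewrite mxE (negPf ji) andbF expr0n /= mul0r addr0.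
Qed.

Lemma nonnormal_ellipsoid : exists E : set 'rV[R]_d,
  [/\ ellipsoid E, gp (ellipsoid_polytope E) = Zlat
    & ~ normal_polytope (ellipsoid_polytope E)].
Proof.
pose E := [set z | quad ball_mx ball_center z = 1].
have hE : convex_hull E = [set z | half_form z <= 3 / 2].
  rewrite convex_hull_ellipsoid ?ball_mx_unit //.
  by apply/seteqP; split=> z /=; rewrite quad_ball.
have PE z : ellipsoid_polytope E z -> half_form z <= 3 / 2.
  move=> Pz; suff : convex_hull E z by rewrite hE.
  by apply: (convex_hull_sub _ Pz) => ? [].
have inP z : intmx z -> half_form z <= 3 / 2 -> (ellipsoid_polytope E `&` Zlat) z.
  by move=> iz fz; split=> //; apply: sub_convex_hull; split=> //; rewrite hE.
exists E; split.
- exists ball_mx, ball_center; split=> //.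
  by apply/eqP; rewrite -/(row_free _) row_free_unit ball_mx_unit.
- apply/seteqP; split=> z.
    move=> [n [c [x [y [xy ->]]]]]; rewrite /Zlat /=.
    apply: (big_ind (fun u : 'rV[R]_d => intmx u)) => [|? ?|k _].
    + exact: intmx0.
    + exact: intmxD.
    rewrite -scaler_int; apply: intmxZ; first exact: intr_int.
    by have [[_ ix] [_ iy]] := xy k; exact: intmxB.
  move=> /mxOverP iz.
  (* [w] stands for h - e_3 - e_4 - e_5, with three coordinates 1/2 and three -1/2. It lies in the
     ball and generates the lattice together with the e_j for j > 0; every z is [z 0 0] times [w]
     plus multiples [z 0 j + s j * z 0 0] of these. *)
  pose s (j : 'I_d) : R := ((2 < j)%N && (j < 6)%N)%:R.
  pose w : 'rV[R]_d := \row_j (if j == 0 then 1 else - s j).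
  have iw : intmx w.
    by apply/mxOverP => ? j; rewrite mxE /s; case: ifP => // _; rewrite rpredN natr_int.
  have fw : half_form w <= 3 / 2.
    rewrite /half_form.
    pose u (j : nat) : R := if (j < 3)%N then 2^-1 else if (j < 6)%N then - 2^-1 else 0.
    have wE (j : 'I_d) : (w *m half_mx) 0 j = u j.
      rewrite mul_half_mx !mxE eqxx /u /s.
      case: j => [[|[|[|[|[|[|j]]]]]] hj] //=; rewrite ?addr0 ?mul1r ?oppr0 ?addr0 //; lra.
    rewrite (eq_bigr (fun j : 'I_d => u j ^+ 2 + u j / 2)); last by move=> j _; rewrite wE.
    rewrite (sum_first6 (F := fun j => u j ^+ 2 + u j / 2)).
      by rewrite /u /=; lra.
    move=> j j6; rewrite /u ltnNge (leq_trans _ j6) //= ltnNge j6 /=.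
    by rewrite expr0n /= mul0r addr0.
  exists d, (fun j => Num.floor (z 0 j + (if j == 0 then 0 else s j * z 0 0))),
    (fun j => if j == 0 then w else unit_pt j), (fun=> 0); split.
    move=> j; split.
      by case: ifP => _; apply: inP => //; [exact: unit_pt_int | rewrite half_form_unit_pt].
    apply: inP; first exact: intmx0.
    rewrite /half_form mul0mx big1 ?divr_ge0 // => k _.
    by rewrite mxE expr0n /= mul0r addr0.
  rewrite (eq_bigr (fun j => (z 0 j + (if j == 0 then 0 else s j * z 0 0)) *:
             (if j == 0 then w else delta_mx 0 j))); last first.
    move=> j _; rewrite subr0 -scaler_int; congr (_ *: _).
      apply/eqP; rewrite -intrEfloor; case: ifP => _; first by rewrite addr0.
      exact: rpredD (iz _ _) (rpredM (natr_int _ _) (iz _ _)).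
    by case: ifP => // /negbT /unit_ptE.
  apply/rowP => k; rewrite summxE (bigD1 0) //= addr0 !mxE.
  have [->|k0] := eqVneq k 0.
    rewrite mulr1 big1 ?addr0 // => j j0.
    by rewrite !mxE (negPf j0) !mxE [0 == j]eq_sym (negPf j0) mulr0.
  rewrite (bigD1 k) //= (negPf k0) !mxE !eqxx mulr1 big1 ?addr0; first by ring.
  by move=> j /andP[j0 jk]; rewrite (negPf j0) !mxE eq_sym (negPf jk) andbF mulr0.
(* The witness against normality is h, three times the mean of e_0, .., e_5. *)
move=> /(_ 3%N (delta_mx 0 0)) [].
  split; last by apply/mxOverP => ? ?; rewrite mxE; case: (_ && _).
  exists (3^-1 *: delta_mx 0 0); last by rewrite scalerA divff ?pnatr_eq0 // scale1r.
  apply/convex_hull_conic.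
  have -> : hrow 1 (3^-1 *: delta_mx 0 0) =
      \sum_(i < d | (i < 6)%N) 6^-1 *: hrow 1 (unit_pt i) :> 'rV[R]_(1 + d).
    rewrite (eq_bigr (fun i => hrow 6^-1 (6^-1 *: unit_pt i))); last first.
      by move=> i _; rewrite -hrowZ mulr1.
    transitivity (hrow (\sum_(i < d | (i < 6)%N) 6^-1) (\sum_(i < d | (i < 6)%N) 6^-1 *: unit_pt i)).
      congr hrow.
        rewrite big_mkcond (sum_first6 (F := fun j => if (j < 6)%N then 6^-1 else 0)) /=.
          by lra.
        by move=> j; rewrite leqNgt; case: ifP.
      rewrite -scaler_sumr sum_unit_pt scalerA; congr (_ *: _); lra.
    apply: (big_ind3 (fun u v w => hrow u v = w)) => //; first by rewrite hrow00.
    by move=> ? ? ? ? ? ? <- <-; rewrite hrowD.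
  apply: conic_sum => i _; apply: conic_scale; first by rewrite invr_ge0.
  apply: conic_in; exists (unit_pt i) => //.
  have [] := inP (unit_pt i) (unit_pt_int i); first by rewrite half_form_unit_pt.
  by move=> _ iu; split=> //; rewrite hE /= half_form_unit_pt.
move=> y [yP ysum].
(* As h has height 3, three summands of height at most 1 all have height 1 and thus an even first
   coordinate, whereas that of h is 1. *)
have hsum : \sum_i half_height (y i) = 3.
  have -> : \sum_i half_height (y i) = half_height (delta_mx 0 0).
    rewrite -ysum /half_height exchange_big /=; apply: eq_bigr => j _.
    by rewrite mulmx_suml summxE.
  rewrite /half_height (eq_bigr (fun j : 'I_d => if (j < 6)%N then 2^-1 else 0)).
    rewrite (sum_first6 (F := fun j => if (j < 6)%N then 2^-1 else 0)) /=; first by lra.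
    by move=> j; rewrite leqNgt; case: ifP.
  move=> j _; rewrite mul_half_mx !mxE !eqxx mul1r; case: ifP => _; rewrite ?add0r.
    by case: (j == 0); rewrite addr0.
  by case: (j == 0).
have hy i : half_height (y i) <= 1 /\ (half_height (y i) = 1 -> y i 0 0 / 2 \is a Num.int).
  by have [/PE fy iy] := yP i; exact: half_lattice.
have h1 i : half_height (y i) = 1.
  apply/eqP; rewrite eq_le (proj1 (hy i)) leNgt; apply/negP => lt1.
  have : \sum_i half_height (y i) < \sum_(i < 3) 1.
    rewrite (bigD1 i) //= [X in _ < X](bigD1 i) //=; apply: ltr_leD => //.
    by apply: ler_sum => j _; case: (hy j).
  by rewrite hsum sumr_const card_ord ltxx.
have : (\sum_i y i) 0 0 / 2 \is a Num.int.
  rewrite summxE mulr_suml rpred_sum // => i _.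
  by have [_] := hy i; apply.
rewrite ysum mxE eqxx mul1r => /intrP[k kE].
have : (2 * k)%:~R = 1 :> R by rewrite intrM -kE mulfV ?pnatr_eq0.
by move=> /eqP; rewrite -[1]/(1%:~R) eqr_int => /eqP; lia.
Qed.

End Nonnormal.

(** * Linear images of cones *)

Section ConicMap.
Context {R : realType}.

Lemma conic_image n p (S : set 'rV[R]_n) (T : set 'rV[R]_p) (N : 'M[R]_(n, p)) u :
  (forall h, S h -> conic T (h *m N)) -> conic S u -> conic T (u *m N).
Proof.
move=> ST; elim=> [|s h y s0 Sh _ IH]; first by rewrite mul0mx; exact: conic0.
rewrite mulmxDl -scalemxAl; apply: conic_add => //; apply: conic_scale => //.
exact: ST.
Qed.

Lemma conic_range n k (f : 'I_k -> 'rV[R]_n) u : conic (range f) u ->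
  exists2 t : 'I_k -> R, (forall i, 0 <= t i) & u = \sum_i t i *: f i.
Proof.
elim=> [|s _ y s0 [j _ <-] _ [t t0 ->]].
  by exists (fun=> 0) => //; rewrite big1 // => i _; rewrite scale0r.
exists (fun i => (if i == j then s else 0) + t i).
  by move=> i; rewrite addr_ge0 //; case: ifP.
rewrite [in RHS](bigD1 j) //= eqxx scalerDl -addrA; congr (_ + _).
rewrite (bigD1 j) //=; congr (_ + _); apply: eq_bigr => i ij.
by rewrite (negPf ij) add0r.
Qed.

(** The linear map (r, w) -> w - r v, which takes the homogenised cone of a polytope to its cone at
    [v]. *)
Definition drop_mx n (v : 'rV[R]_n) : 'M[R]_(1 + n, n) := col_mx (- v) 1%:M.

Lemma hrow_drop n (v : 'rV[R]_n) r w : hrow r w *m drop_mx v = w - r *: v.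
Proof.
by rewrite /hrow mul_row_col mul_scalar_mx mulmx1 scalerN addrC.
Qed.

Lemma conic_hrow_drop n (S : set 'rV[R]_n) (v : 'rV[R]_n) r w :
  conic [set hrow 1 x | x in S] (hrow r w) -> conic [set x - v | x in S] (w - r *: v).
Proof.
rewrite -hrow_drop; apply: conic_image => _ [x Sx <-].
by rewrite hrow_drop scale1r; apply: conic_in; exists x.
Qed.

End ConicMap.

(** * Polytopes, their vertices and their lattice points *)

Section Polytopes.
Context {R : realType} {n : nat}.
Implicit Types (P V : set 'rV[R]_n) (v w x y : 'rV[R]_n).

Lemma nbhs_rowP x (B : set 'rV[R]_n) : nbhs x B <->
  exists2 e : R, 0 < e & forall y, (forall j, `|y 0 j - x 0 j| < e) -> B y.
Proof.
split=> [/nbhs_ballP[e /= e0 eB]|[e e0 eB]].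
  exists e => // y hy; apply: eB; split=> // i j; rewrite !ord1 /ball /=.
  by rewrite distrC.
apply/nbhs_ballP; exists e => //= y [_ hy]; apply: eB => j.
by have := hy 0 j; rewrite /ball /= distrC.
Qed.

Lemma intmx_enum (s : R) : exists l : seq 'rV[R]_n,
  forall x, intmx x -> (forall j, `|x 0 j| <= s) -> x \in l.
Proof.
pose N := Num.bound s.
pose F (g : {ffun 'I_n -> 'I_(N + N).+1}) : 'rV[R]_n := \row_j ((g j)%:R - N%:R).
exists (map F (enum {ffun 'I_n -> 'I_(N + N).+1})) => x /mxOverP ix xs.
have key j : exists k : 'I_(N + N).+1, x 0 j = k%:R - N%:R.
  have xN : `|x 0 j| < N%:R.
    by apply: le_lt_trans (xs j) _; apply/archi_boundP/(le_trans _ (xs j)).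
  have [k kE] : exists k : nat, x 0 j + N%:R = k%:R.
    apply/natrP; rewrite natrEint rpredD ?natr_int //=.
    by move: xN; rewrite ltr_norml => /andP[h _]; lra.
  have kN : (k < (N + N).+1)%N.
    rewrite ltnS -(ler_nat R) natrD -kE; move: xN; rewrite ltr_norml => /andP[_ h]; lra.
  by exists (Ordinal kN) => /=; rewrite -kE addrK.
have /choice[g gP] := key.
apply/mapP; exists [ffun j => g j]; first by rewrite mem_enum.
by apply/rowP => j; rewrite mxE ffunE.
Qed.

Lemma lattice_points_enum P : polytope P ->
  exists l : seq 'rV[R]_n, forall x, x \in l <-> P x /\ Zlat x.
Proof.
move=> [s ->].
have [B HB] : exists B : R, forall q, q \in s -> forall j, `|q 0 j| <= B.
  exists (\sum_(q <- s) \sum_j `|q 0 j|) => q qs j.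
  rewrite (big_rem q) //= (bigD1 j) //= -addrA lerDl addr_ge0 //.
    by rewrite sumr_ge0.
  by rewrite sumr_ge0 // => p _; rewrite sumr_ge0.
have PB x : convex_hull [set` s] x -> forall j, `|x 0 j| <= B.
  move=> + j; apply: (@smallest_sub _ _ _ [set x : 'rV[R]_n | `|x 0 j| <= B]) => /=.
    apply/convex_setP => p q l /andP[l0 l1] /= hp hq; rewrite !mxE.
    apply: le_trans (ler_normD _ _) _; rewrite !normrM (ger0_norm l0).
    have -> : `|1 - l| = 1 - l by rewrite ger0_norm // subr_ge0.
    have h1 : l * `|p 0 j| <= l * B by rewrite ler_wpM2l.
    have h2 : (1 - l) * `|q 0 j| <= (1 - l) * B by rewrite ler_wpM2l // subr_ge0.
    by lra.
  by move=> q /= qs; exact: HB.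
have [l lP] := intmx_enum B.
exists [seq x <- l | `[< convex_hull [set` s] x /\ Zlat x >]] => x.
rewrite mem_filter; split=> [/andP[/asboolP]//|h].
by rewrite (asboolT h) /=; have [Px Zx] := h; apply: lP => //; exact: PB.
Qed.

(** In a generating list of least length no point lies in the hull of the others, and a form
    separating it from them exposes it as a vertex. *)
Lemma polytope_vertices P : polytope P ->
  exists s : seq 'rV[R]_n, P = convex_hull [set` s] /\ forall v, v \in s -> vertex P v.
Proof.
move=> [s0 Ps0].
pose Q k := `[< exists s : seq 'rV[R]_n, P = convex_hull [set` s] /\ size s = k >].
have exQ : exists k, Q k by exists (size s0); apply/asboolP; exists s0.
case: (ex_minnP exQ) => k /asboolP[s [Ps sk]] kmin; exists s; split=> // v vs.
have sub_s : perm_eq s (v :: rem v s) by exact: perm_to_rem.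
have notin : ~ convex_hull [set` rem v s] v.
  move=> hv; have : Q (size (rem v s)).
    apply/asboolP; exists (rem v s); split=> //; rewrite Ps; apply/seteqP; split.
      apply: convex_hull_sub => x /=; rewrite (perm_mem sub_s) inE => /orP[/eqP->//|].
      exact: sub_convex_hull.
    by apply: convex_hullS => x /= /mem_rem.
  move=> /kmin; rewrite -sk size_rem //.
  by case: (s) vs => //= a l _; rewrite ltnn.
have Pv : P v by rewrite Ps; exact: sub_convex_hull.
split=> //.
have homE (l : seq 'rV[R]_n) : [set hrow 1 x | x in [set` l]] = [set` map (hrow 1) l].
  by apply/seteqP; split=> [_ [x xl <-]|_ /mapP[x xl ->]]; [exact: map_f | exists x].
have [cv|[c [cs cv]]] := farkas (map (hrow 1) (rem v s)) (hrow 1 v).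
  by exfalso; apply: notin; apply/convex_hull_conic; rewrite homE.
exists (dsubmx c) => x Px xv.
have : conic [set` hrow 1 v :: map (hrow 1) (rem v s)] (hrow 1 x).
  move: Px; rewrite Ps => /convex_hull_conic; rewrite homE; apply: conic_subset => u /=.
  by rewrite -map_cons (perm_mem (perm_map _ sub_s)).
move=> /conic_cons[mu mu0]; rewrite -hrowZ mulr1 -hrowB => ch.
have := conic_dot_ge0 (c := - c) _ ch.
rewrite dotNr oppr_ge0 => /(_ _) le0.
have {}le0 : dot (hrow (1 - mu) (x - mu *: v)) c <= 0.
  by apply: le0 => h hs; rewrite dotNr oppr_ge0; exact: cs.
rewrite -!homE in ch; have [r [w [/hrow_inj[rE wE] r0 rw0 _]]] := conic_hrow_inv ch.
move: le0 cv; rewrite !dot_hrow mul1r dotBl dotZl -/(dot x _) -/(dot v _) => le0 cv.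
(* [x] is [mu *: v] plus a part of height [1 - mu] generated by the other points; for [mu = 1] that
   part would vanish and [x] would be [v]. *)
have mu1 : mu < 1.
  rewrite lt_neqAle -subr_ge0 rE r0 andbT; apply/eqP => mu1; apply: xv.
  apply/eqP; rewrite -subr_eq0; have : x - mu *: v = 0 by rewrite wE rw0 // -rE mu1 subrr.
  by rewrite mu1 scale1r => ->.
by nra.
Qed.

Lemma lattice_polytope_hull P (l : seq 'rV[R]_n) : lattice_polytope P ->
  (forall x, x \in l <-> P x /\ Zlat x) -> P = convex_hull [set` l].
Proof.
move=> [pP Pv] lP; have [s [PE sv]] := polytope_vertices pP.
apply/seteqP; split.
  rewrite {1}PE; apply: convex_hullS => v /= /sv vv; apply/lP.
  by split; [case: vv | exact: Pv].
rewrite PE; apply: convex_hull_sub => v /= /lP[]; by rewrite PE.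
Qed.

Lemma cone_conic P v w : convex_hull P = P -> P v ->
  cone [set x - v | x in P] w <-> conic [set x - v | x in P] w.
Proof.
move=> cP Pv; split=> [[a a0 [_ [x Px <-] ->]]|].
  by apply: conic_scale => //; apply: conic_in; exists x.
elim=> [|s _ y s0 [x Px <-] _ [a a0 [_ [z Pz <-] ->]]].
  by exists 0 => //; exists 0; [exists v; rewrite ?subrr | rewrite scaler0].
have [sa0|sa0] := eqVneq (s + a) 0.
  move: sa0 => /eqP; rewrite paddr_eq0 // => /andP[/eqP-> /eqP->].
  by exists 0 => //; exists 0; [exists v; rewrite ?subrr | rewrite !scale0r addr0].
have sap : 0 < s + a by rewrite lt0r sa0 addr_ge0.
exists (s + a); first exact: ltW.
exists ((s / (s + a)) *: x + (1 - s / (s + a)) *: z - v).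
  eexists; last by [].
  rewrite -cP; apply: convex_hull_convex; [|exact: sub_convex_hull..].
  by rewrite divr_ge0 ?(ltW sap) //= ler_pdivrMr // mul1r lerDl.
apply/rowP => j; rewrite !mxE; field.
exact: sa0.
Qed.

Lemma lattice_hull P (l : seq 'rV[R]_n) v w : P = convex_hull [set` l] -> P v ->
  cone [set x - v | x in P] w <-> conic [set x - v | x in [set` l]] w.
Proof.
move=> PE Pv.
have PP : convex_hull P = P.
  apply/seteqP; split; last exact: sub_convex_hull.
  by rewrite PE; exact: convex_hull_sub.
rewrite cone_conic //; split; last first.
  apply: conic_subset => _ [x /= xl <-]; exists x => //.
  by rewrite PE; exact: sub_convex_hull.
apply: conic_conic => _ [x Px <-].
rewrite -[v in x - v]scale1r; apply: conic_hrow_drop.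
by apply/convex_hull_conic; rewrite -PE.
Qed.

(** If [v] were interior, the segment from [x] to [v] could be prolonged inside [P], and the form
    exposing [v] would increase beyond its maximum. *)
Lemma vertex_rel_boundary P v x : vertex P v -> P x -> x != v -> rel_boundary P v.
Proof.
move=> [Pv [c cv]] Px xv; split=> // -[_].
move=> /nbhs_rowP[e e0 he].
pose K := 1 + \sum_j `|x 0 j - v 0 j|.
have K0 : 0 < K by rewrite ltr_pwDl // sumr_ge0.
pose s := e / (2 * K).
have s0 : 0 < s by rewrite divr_gt0 // mulr_gt0.
pose y := v - s *: (x - v).
have Py : P y.
  apply: he => [j|].
    rewrite !mxE addrAC subrr add0r normrN normrM gtr0_norm // /s mulrAC ltr_pdivrMr; last first.
      by rewrite mulr_gt0.
    rewrite ltr_pM2l //.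
    have : `|x 0 j - v 0 j| <= \sum_j `|x 0 j - v 0 j|.
      by rewrite (bigD1 j) //= lerDl sumr_ge0.
    have h0 : 0 <= \sum_j `|x 0 j - v 0 j| by rewrite sumr_ge0.
    by rewrite /K; lra.
  exists 2%N, (fun i => if i == 0 then 1 + s else - s), (fun i => if i == 0 then v else x).
  split.
  - by move=> i; case: ifP.
  - by rewrite !big_ord_recl big_ord0 /=; ring.
  - rewrite !big_ord_recl big_ord0 /= addr0 /y; apply/rowP => j; rewrite !mxE; ring.
have yv : y <> v.
  move=> /eqP; rewrite /y -subr_eq0 addrAC subrr add0r oppr_eq0 scaler_eq0 gt_eqF //=.
  by rewrite subr_eq0 (negPf xv).
have := cv _ Py yv; have := cv _ Px (elimN eqP xv).
rewrite -!/(dot _ c) /y dotBl dotZl dotBl => h1 h2.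
have : 0 < s * (dot v c - dot x c) by rewrite mulr_gt0 // subr_gt0.
by lra.
Qed.

End Polytopes.

(** * A unimodular cover near the boundary forces very ampleness *)

Section CoverVeryAmple.
Context {R : realType} {n : nat}.

Lemma Zbasis_unit (b : 'I_n -> 'rV[R]_n) : Zbasis b -> let N := \matrix_i b i in
  [/\ intmx N, N \in unitmx & intmx (invmx N)].
Proof.
move=> [bZ bspan] N.
have iN : intmx N by apply/mxOverP => i j; rewrite mxE; exact: (mxOverP (bZ i)).
have /choice[a aP] : forall k, exists a : {ffun 'I_n -> int},
    delta_mx 0 k = \sum_i b i *~ a i.
  move=> k; have [|a [aE _]] := bspan (delta_mx 0 k).
    by apply/mxOverP => ? ?; rewrite mxE; case: (_ && _).
  by exists a.
pose C : 'M[R]_n := \matrix_(k, i) (a k i)%:~R.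
have CN : C *m N = 1%:M.
  apply/row_matrixP => k; rewrite row_mul mulmx_sum_row row1 aP.
  by apply: eq_bigr => i _; rewrite rowK !mxE scaler_int.
have [_ uN] := mulmx1_unit CN; split=> //.
have -> : invmx N = C by rewrite -[LHS]mul1mx -CN mulmxK.
by apply/mxOverP => i j; rewrite mxE intr_int.
Qed.

(** Transfers the basis condition from the edges at [x ord0] to those at an arbitrary vertex [x i0];
    coordinates are read off by the dual basis. *)
Lemma unimodular_coord_int m (x : 'I_m.+1 -> 'rV[R]_n) (s : 'I_m.+1 -> R) i0 :
    part_of_Zbasis (fun i : 'I_m => x (lift ord0 i) - x ord0) ->
    intmx (\sum_i s i *: (x i - x i0)) ->
  forall i, i != i0 -> s i \is a Num.int.
Proof.
move=> [b [f [bZ f_inj fE]]] iw.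
have [_ uN iN'] := Zbasis_unit bZ; set N := \matrix_i b i in uN iN'.
pose kap i (w : 'rV[R]_n) := (w *m invmx N) 0 (f i).
have kapI i w : intmx w -> kap i w \is a Num.int.
  by move=> iw'; apply: (mxOverP (intmxM iw' iN')).
have kapD i u w : kap i (u - w) = kap i u - kap i w by rewrite /kap mulmxBl !mxE.
have kapb i j : kap i (x (lift ord0 j) - x ord0) = (i == j)%:R.
  have -> : x (lift ord0 j) - x ord0 = delta_mx 0 (f j) *m N by rewrite fE -rowE rowK.
  by rewrite /kap mulmxK // mxE eqxx (inj_eq f_inj).
have kapx i j : kap i (x j - x ord0) = (j == lift ord0 i)%:R.
  have [k ->|->] := unliftP ord0 j.
    by rewrite kapb eq_sym (inj_eq lift_inj).
  rewrite subrr /kap mul0mx mxE; by have := neq_lift ord0 i => /negPf ->.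
have kapw i : s (lift ord0 i) - (i0 == lift ord0 i)%:R * \sum_j s j \is a Num.int.
  have := kapI i _ iw; rewrite /kap mulmx_suml summxE.
  suff -> : \sum_j (s j *: (x j - x i0) *m invmx N) 0 (f i) =
    s (lift ord0 i) - (i0 == lift ord0 i)%:R * \sum_j s j by [].
  rewrite (eq_bigr (fun j => s j * (j == lift ord0 i)%:R - (i0 == lift ord0 i)%:R * s j)).
    rewrite sumrB -mulr_sumr; congr (_ - _).
    rewrite (bigD1 (lift ord0 i)) //= eqxx mulr1 big1 ?addr0 // => j ji.
    by rewrite (negPf ji) mulr0.
  move=> j _; rewrite -scalemxAl mxE -/(kap i _).
  have -> : x j - x i0 = (x j - x ord0) - (x i0 - x ord0) by rewrite opprB addrA subrK.
  by rewrite kapD !kapx mulrBr [_ * s j]mulrC.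
move=> i ii0; have [k ik|i00] := unliftP ord0 i.
  have := kapw k; rewrite -ik [i0 == i]eq_sym (negPf ii0) mul0r subr0; exact.
have [k0 k0E|i0E] := unliftP ord0 i0; last by rewrite i00 i0E eqxx in ii0.
(* The vertex [ord0] has no dual coordinate of its own; its coefficient results from summing all
   dual coordinates. *)
have rest : \sum_(j | j != i) s j - \sum_j s j \is a Num.int.
  have : \sum_(k : 'I_m) (s (lift ord0 k) - (i0 == lift ord0 k)%:R * \sum_j s j) \is a Num.int.
    by apply: rpred_sum => k _; exact: kapw.
  suff -> : \sum_(k : 'I_m) (s (lift ord0 k) - (i0 == lift ord0 k)%:R * \sum_j s j) =
    \sum_(j | j != i) s j - \sum_j s j by [].
  rewrite sumrB; congr (_ - _).
    rewrite [RHS]big_mkcond [RHS](bigD1_ord ord0) //= i00 eqxx add0r.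
    by apply: eq_bigr.
  rewrite (bigD1 k0) //= {1}k0E eqxx mul1r [X in _ + X]big1 ?addr0 // => k kk0.
  by rewrite k0E (inj_eq lift_inj) eq_sym (negPf kk0) mul0r.
rewrite -rpredN; move: rest; rewrite [X in _ - X](bigD1 i) //=.
by rewrite opprD addrCA subrr addr0.
Qed.

Lemma cover_very_ample (P : set 'rV[R]_n) : lattice_polytope P ->
  within P (set_nbhs (rel_boundary P)) (unimodular_cover P) -> very_ample P.
Proof.
move=> lP cov v vv h [].
have [pP vZ] := lP; have [l lE] := lattice_points_enum pP.
have PE := lattice_polytope_hull lP lE.
have Zv : Zlat v by exact: vZ.
have [Pv [c cv]] := vv.
move=> [] [a a0 [_ [x Px <-] hE]] ih h0 hirr.
have a_neq0 : a != 0 by apply/eqP => a00; apply: h0; rewrite hE a00 scale0r.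
have ap : 0 < a by rewrite lt0r a_neq0.
have xv : x != v.
  by apply/eqP => xv; apply: h0; rewrite hE xv subrr scaler0.
have bv := vertex_rel_boundary vv Px xv.
have /nbhs_rowP[e e0 he] := cov _ bv.
(* A gap between the value of [c] at [v] and its values at the other lattice points of [P]. *)
have [|g g0 hg] := @eventually_small_seq R _ l (fun w d => w <> v -> d <= dot v c - dot w c).
  move=> w /lE[Pw _]; have [->|wv] := eqVneq w v; first by exists 1.
  have := cv _ Pw (elimN eqP wv); rewrite -!/(dot _ c) => cw.
  by exists (dot v c - dot w c); rewrite ?subr_gt0 // => d /andP[].
have {hg} hg w : w \in l -> w <> v -> g <= dot v c - dot w c.
  by move=> wl; apply: hg => //; rewrite g0 lexx.
have gap0 : 0 < dot v c - dot x c by rewrite subr_gt0; apply: cv => //; exact/eqP.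
pose K := 1 + \sum_j `|x 0 j - v 0 j|.
have K0 : 0 < K by rewrite ltr_pwDl // sumr_ge0.
(* So small that the point [y] on the segment from [v] to [x] lies in the covered neighbourhood and
   loses less than [g] in [c]; the simplex over [y] then must have [v] as a vertex. *)
pose tau := Num.min 1 (Num.min (e / (2 * K)) (g / (2 * (dot v c - dot x c)))).
have tau0 : 0 < tau by rewrite !lt_min ltr01 !divr_gt0 // mulr_gt0.
have tau1 : tau <= 1 by rewrite ge_min lexx.
have taue : tau * K < e.
  have : tau <= e / (2 * K) by rewrite !ge_min lexx orbT.
  rewrite ler_pdivlMr ?mulr_gt0 // => h'; have : 0 < tau * K by rewrite mulr_gt0.
  by lra.
have taug : tau * (dot v c - dot x c) < g.
  have : tau <= g / (2 * (dot v c - dot x c)) by rewrite !ge_min lexx !orbT.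
  rewrite ler_pdivlMr ?mulr_gt0 // => h'; have : 0 < tau * (dot v c - dot x c) by rewrite mulr_gt0.
  by lra.
pose y := tau *: x + (1 - tau) *: v.
have Py : P y.
  rewrite PE; apply: convex_hull_convex; rewrite -?PE // ltW //=.
have yv : y - v = tau *: (x - v) by apply/rowP => j; rewrite !mxE; ring.
have [] := he y _ Py.
  move=> j; have -> : y 0 j - v 0 j = tau * (x 0 j - v 0 j) by rewrite !mxE; ring.
  rewrite normrM gtr0_norm //; apply: le_lt_trans taue; rewrite ler_pM2l //.
  rewrite /K (bigD1 j) //= addrCA lerDl addr_ge0 // sumr_ge0 //.
move=> T [[m [X [XZ Xb TE]]] TP] Ty.
have Xl i : X i \in l.
  apply/lE; split; last exact: XZ.
  by apply: TP; rewrite TE; apply: sub_convex_hull; exists i.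
have [t t0 tE] : exists2 t : 'I_m.+1 -> R, (forall i, 0 <= t i) &
    hrow 1 y = \sum_i t i *: hrow 1 (X i).
  apply: conic_range; move: Ty; rewrite TE => /convex_hull_conic.
  by apply: conic_subset => _ [_ [i _ <-] <-]; exists i.
have hsum (s : 'I_m.+1 -> R) : \sum_i s i *: hrow 1 (X i) = hrow (\sum_i s i) (\sum_i s i *: X i).
  rewrite (eq_bigr (fun i => hrow (s i) (s i *: X i))).
    apply: (big_ind3 (fun u v w => u = hrow v w)) => //; first by rewrite hrow00.
    by move=> ? ? ? ? ? ? -> ->; rewrite hrowD.
  by move=> i _; rewrite -hrowZ mulr1.
move: tE; rewrite hsum => /hrow_inj[t1 yE].
have [i0 i0v] : exists i, X i = v.
  apply: contrapT => nov.
  have : g <= dot v c - dot y c.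
    rewrite yE dot_suml -[X in X - _]mul1r t1 mulr_suml -sumrB.
    rewrite -[g]mul1r t1 mulr_suml; apply: ler_sum => i _.
    rewrite dotZl -mulrBr ler_wpM2l // hg // => Xv; apply: nov; by exists i.
  rewrite -dotBl -opprB dotNl yv dotZl dotBl -mulrN opprB leNgt => /negP; exact.
(* The coordinates of [h] along the edges at [v]. *)
pose s i := a / tau * t i.
have s0 i : 0 <= s i by rewrite mulr_ge0 // divr_ge0 // ltW.
have hE2 : h = \sum_i s i *: (X i - X i0).
  have -> : h = (a / tau) *: (y - v) by rewrite yv scalerA divfK ?gt_eqF.
  rewrite i0v yE -[v in LHS]scale1r t1 scaler_suml -sumrB scaler_sumr.
  by apply: eq_bigr => i _; rewrite -scalerBr scalerA.
have sI : forall i, i != i0 -> s i \is a Num.int.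
  by apply: (unimodular_coord_int Xb); rewrite -hE2.
have [i1 [si1 Xi1]] : exists i, s i != 0 /\ X i != v.
  apply: contrapT => no; apply: h0; rewrite hE2 big1 // => i _.
  have [->|si] := eqVneq (s i) 0; first by rewrite scale0r.
  have [->|Xi] := eqVneq (X i) v; first by rewrite i0v subrr scaler0.
  by exfalso; apply: no; exists i.
have i10 : i1 != i0 by apply: contraNneq Xi1 => ->; rewrite i0v.
have si1_ge1 : 1 <= s i1.
  rewrite leNgt; apply/negP => lt1; move: si1.
  by rewrite (int_itv01_eq0 (sI _ i10)) ?eqxx // s0 lt1.
have cPv w : cone [set x - v | x in P] w <-> conic [set x - v | x in [set` l]] w.
  exact: lattice_hull.
have Xcone i : conic [set x - v | x in [set` l]] (X i - v).
  by apply: conic_in; exists (X i) => //=.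
(* One edge can be split off because its coefficient is at least 1; the indecomposable [h] is then
   equal to this edge. *)
pose rest := (s i1 - 1) *: (X i1 - X i0) + \sum_(i | i != i1) s i *: (X i - X i0).
have hE3 : h = (X i1 - v) + rest.
  rewrite hE2 (bigD1 i1) //= /rest addrA; congr (_ + _).
  by rewrite scalerBl scale1r -i0v addrC subrK.
have cX : (cone [set x - v | x in P] `&` Zlat) (X i1 - v).
  by split; [exact/cPv | apply: intmxB => //; exact: XZ].
have crest : (cone [set x - v | x in P] `&` Zlat) rest.
  split.
    apply/cPv; rewrite /rest i0v; apply: conic_add.
      by apply: conic_scale => //; rewrite subr_ge0.
    by apply: conic_sum => i _; apply: conic_scale.
  have -> : rest = h - (X i1 - v) by rewrite hE3 addrC addKr.
  by apply: intmxB => //; case: cX.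
have [/eqP|r0] := hirr _ _ cX crest hE3.
  by rewrite subr_eq0 (negPf Xi1).
exists (X i1); first by have /lE[] := Xl i1.
by rewrite hE3 r0 addr0.
Qed.

End CoverVeryAmple.

(** * Hilbert bases of the cones at vertices *)

Section HilbertBasis.
Context {R : realType} {n : nat}.
Implicit Types (P : set 'rV[R]_n) (l : seq 'rV[R]_n) (v w x y z : 'rV[R]_n).

(** The form exposing the vertex dominates the coordinates on the cone at [v], which bounds it away
    from 0 at nonzero lattice points. *)
Lemma vertex_cone_bound P v l : vertex P v -> (forall x, x \in l -> P x) ->
  exists lam : 'cV[R]_n, exists2 e : R, 0 < e &
    forall z, conic [set x - v | x in [set` l]] z ->
      0 <= dot z lam /\ forall j, e * `|z 0 j| <= dot z lam.
Proof.
move=> [Pv [c cv]] lP; exists (- c).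
have [|e e0 he] := @eventually_small_seq R _ l
    (fun w d => forall j, d * `|(w - v) 0 j| <= dot (w - v) (- c)).
  move=> w /lP Pw; have [->|wv] := eqVneq w v.
    by exists 1 => // d _ j; rewrite subrr mxE normr0 mulr0 dot0l.
  pose K := 1 + \sum_j `|(w - v) 0 j|.
  have K0 : 0 < K by rewrite ltr_pwDl // sumr_ge0.
  have g0 : 0 < dot (w - v) (- c).
    by rewrite dotNr dotBl opprB subr_gt0; apply: cv => //; exact/eqP.
  exists (dot (w - v) (- c) / K); first by rewrite divr_gt0.
  move=> d /andP[d0]; rewrite ler_pdivlMr // => dK j.
  apply: le_trans dK; rewrite ler_pM2l // /K (bigD1 j) //= addrCA lerDl.
  by rewrite addr_ge0 // sumr_ge0.
exists e => // z; elim=> [|s _ y s0 [w /= wl <-] _ [IH0 IH]].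
  by rewrite dot0l; split=> // j; rewrite mxE normr0 mulr0.
rewrite dotDl dotZl; have hw j : e * `|(w - v) 0 j| <= dot (w - v) (- c).
  by apply: he => //; rewrite e0 lexx.
split.
  rewrite addr_ge0 // mulr_ge0 // dotNr dotBl opprB subr_ge0.
  have [->//|wv] := eqVneq w v.
  by apply/ltW/cv; [exact: lP | exact/eqP].
move: (w - v) hw => u hw j; rewrite !mxE.
apply: (@le_trans _ _ (e * (s * `|u 0 j| + `|y 0 j|))).
  rewrite ler_pM2l //; apply: le_trans (ler_normD _ _) _.
  by rewrite normrM ger0_norm.
by rewrite mulrDr lerD // mulrCA ler_wpM2l.
Qed.

(** Nonzero lattice points of the cone have [lam]-value at least [e], so decomposing lowers the
    value by at least [e], and induction on the value in units of [e] terminates. *)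
Lemma Hilb_generates P v l : vertex P v -> P = convex_hull [set` l] ->
    (forall x, x \in l -> P x) -> forall z,
    conic [set x - v | x in [set` l]] z -> intmx z ->
  exists s : seq 'rV[R]_n, (forall h, h \in s -> Hilb (cone [set x - v | x in P]) h) /\
    z = \sum_(h <- s) h.
Proof.
move=> vv PE lP; have [lam [e e0 he]] := vertex_cone_bound vv lP.
have [Pv _] := vv.
have coneE w := lattice_hull w PE Pv.
have lam_ge z : conic [set x - v | x in [set` l]] z -> intmx z -> z != 0 -> e <= dot z lam.
  move=> cz iz /rV0Pn[j zj]; have [_ /(_ j)] := he _ cz; apply: le_trans.
  rewrite -[X in X <= _]mulr1 ler_pM2l //.
  by apply: norm_intr_ge1 => //; exact: (mxOverP iz).
move=> z cz iz.
have [k] : exists k : nat, dot z lam < k%:R * e.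
  have [h0 _] := he _ cz.
  have : 0 <= dot z lam / e by rewrite divr_ge0 // ltW.
  by move=> /archi_boundP; rewrite ltr_pdivrMr // => hk; eexists; exact: hk.
elim: k z cz iz => [|k IH] z cz iz zk.
  by have [h0 _] := he _ cz; move: zk; rewrite mul0r ltNge h0.
have [->|z0] := eqVneq z 0; first by exists [::]; rewrite big_nil.
have [Hz|nHz] := pselect (Hilb (cone [set x - v | x in P]) z).
  by exists [:: z]; rewrite big_seq1; split=> // h; rewrite inE => /eqP ->.
have [y [z' [cy iy y0 [cz' iz' z0' zE]]]] : exists y z',
    [/\ conic [set x - v | x in [set` l]] y, intmx y, y != 0 &
      [/\ conic [set x - v | x in [set` l]] z', intmx z', z' != 0 & z = y + z']].
  apply: contrapT => no; apply: nHz; split.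
  - by split => //; exact/coneE.
  - exact/eqP.
  move=> y z' [cy iy] [cz' iz'] zE.
  have [y0|y0] := eqVneq y 0; first by left.
  have [z'0|z'0] := eqVneq z' 0; first by right.
  exfalso; apply: no; exists y, z'; split=> //; first exact/coneE.
  by split=> //; exact/coneE.
have yk : dot y lam < k%:R * e.
  move: zk; rewrite zE dotDl -nat1r mulrDl mul1r; have := lam_ge _ cz' iz' z0'; lra.
have zk' : dot z' lam < k%:R * e.
  move: zk; rewrite zE dotDl -nat1r mulrDl mul1r; have := lam_ge _ cy iy y0; lra.
have [s1 [hs1 s1E]] := IH _ cy iy yk; have [s2 [hs2 s2E]] := IH _ cz' iz' zk'.
exists (s1 ++ s2); rewrite big_cat /= -s1E -s2E; split=> // h.
by rewrite mem_cat => /orP[/hs1|/hs2].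
Qed.

End HilbertBasis.

(** * Unimodular subcones at a vertex of a very ample polytope *)

Section VeryAmpleCone.
Context {R : realType}.

(** By very ampleness the nonzero differences [H] contain the Hilbert basis and so generate the
    lattice points of the cone; [sebo] applies to them with [lam] rescaled. *)
Lemma very_ample_cone (P : set 'rV[R]_3) (l : seq 'rV[R]_3) v y : very_ample P ->
    vertex P v -> P = convex_hull [set` l] -> (forall x, x \in l <-> P x /\ Zlat x) ->
    Zlat v -> conic [set x - v | x in [set` l]] y ->
  exists X t, frame [set u | v + u \in l] y X t /\ intmx (invmx X).
Proof.
move=> va vv PE lE Zv cy.
have lP x : x \in l -> P x by move=> /lE[].
pose H := [seq w - v | w <- l & w != v].
have HE h : h \in H <-> h != 0 /\ v + h \in l.
  split=> [/mapP[w]|[h0 hl]].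
    by rewrite mem_filter => /andP[wv wl] ->; rewrite subr_eq0 addrCA subrr addr0.
  apply/mapP; exists (v + h); last by rewrite addrAC subrr add0r.
  by rewrite mem_filter hl andbT -subr_eq0 addrAC subrr add0r.
have iH h : h \in H -> intmx h.
  move=> /HE[_ /lE[_ iv]].
  have -> : h = (v + h) - v by rewrite addrAC subrr add0r.
  by apply: intmxB.
have cH z : conic [set x - v | x in [set` l]] z <-> conic [set` H] z.
  split; apply: conic_conic.
    move=> _ [x /= xl <-]; have [->|xv] := eqVneq x v; first by rewrite subrr; exact: conic0.
    by apply: conic_in => /=; apply/HE; rewrite subr_eq0 xv addrCA subrr addr0.
  move=> h /= /HE[_ hl]; apply: conic_in; exists (v + h) => //.
  by rewrite addrAC subrr add0r.
have [lam [e e0 he]] := vertex_cone_bound vv lP.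
have Hlam h : h \in H -> 1 <= dot h (e^-1 *: lam).
  move=> hH; have ch : conic [set` H] h by exact: conic_in.
  have [_ hb] := he _ ((cH h).2 ch); have [/rV0Pn[j hj] _] := (HE h).1 hH.
  rewrite dotZr ler_pdivlMl // mulr1; apply: le_trans (hb j).
  rewrite -[X in X <= _]mulr1 ler_pM2l //.
  by apply: norm_intr_ge1 => //; exact: (mxOverP (iH _ hH)).
have [||X [t [[iX uX yE t0 tH] iX']]] := @sebo R H (e^-1 *: lam) y iH Hlam.
- move=> z iz /cH cz; have [s [hs ->]] := Hilb_generates vv PE lP cz iz.
  exists s => // h /hs hh; apply/HE; have [[_ ih] h0 _] := hh.
  split; first exact/eqP.
  have [x Px xE] := va _ vv _ hh; apply/lE.
  have -> : v + h = x by rewrite -xE addrCA subrr addr0.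
  split=> //; have -> : x = h + v by rewrite -xE subrK.
  exact: intmxD.
- exact/cH.
by exists X, t; split=> //; split=> // i /tH /= /HE[].
Qed.

End VeryAmpleCone.

(** * The smallest face containing a given point *)

Section Faces.
Context {R : realType} {n : nat}.
Context (V : set 'rV[R]_n) (x0 : 'rV[R]_n).
Local Notation hom := (fun S : set 'rV[R]_n => [set hrow 1 w | w in S]).
Local Notation D := (conic (hom V)).

(* The smallest face of the cone over conv V that contains x0. *)
Definition face (p : 'rV[R]_(1 + n)) : Prop :=
  D p /\ exists2 e : R, 0 < e & D (hrow 1 x0 - e *: p).

Definition face_points : set 'rV[R]_n := [set w | V w /\ face (hrow 1 w)].

Lemma face_split p q : D p -> D q -> face (p + q) -> face p /\ face q.
Proof.
move=> Dp Dq [_ [e e0 De]]; split; split=> //; exists e => //.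
  have -> : hrow 1 x0 - e *: p = (hrow 1 x0 - e *: (p + q)) + e *: q.
    by rewrite scalerDr opprD addrA subrK.
  by apply: conic_add => //; apply: conic_scale => //; exact: ltW.
have -> : hrow 1 x0 - e *: q = (hrow 1 x0 - e *: (p + q)) + e *: p.
  by rewrite [p + q]addrC scalerDr opprD addrA subrK.
by apply: conic_add => //; apply: conic_scale => //; exact: ltW.
Qed.

Lemma face_small p e d : D p -> d <= e -> D (hrow 1 x0 - e *: p) -> D (hrow 1 x0 - d *: p).
Proof.
move=> Dp de De.
have -> : hrow 1 x0 - d *: p = (hrow 1 x0 - e *: p) + (e - d) *: p.
  by rewrite scalerBl addrA subrK.
by apply: conic_add => //; apply: conic_scale; rewrite ?subr_ge0.
Qed.

Lemma face_add p q : face p -> face q -> face (p + q).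
Proof.
move=> [Dp [e1 e10 De1]] [Dq [e2 e20 De2]]; split; first exact: conic_add.
pose e := Num.min e1 e2; have e0 : 0 < e by rewrite lt_min e10.
exists (e / 2); first by rewrite divr_gt0.
have -> : hrow 1 x0 - (e / 2) *: (p + q) =
    2^-1 *: (hrow 1 x0 - e *: p) + 2^-1 *: (hrow 1 x0 - e *: q).
  by apply/rowP => j; rewrite !mxE; field.
apply: conic_add; apply: conic_scale; rewrite ?invr_ge0 //.
  by apply: face_small De1; rewrite ?ge_min ?lexx.
by apply: face_small De2; rewrite ?ge_min ?lexx ?orbT.
Qed.

Lemma face_scale a p : D (hrow 1 x0) -> 0 <= a -> face p -> face (a *: p).
Proof.
move=> Dx a0 [Dp [e e0 De]]; split; first exact: conic_scale.
have [->|an0] := eqVneq a 0.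
  by exists 1 => //; rewrite scale0r scaler0 subr0.
exists (e / a); first by rewrite divr_gt0 // lt0r an0.
by rewrite scalerA divfK.
Qed.

Lemma face_unscale a p : D p -> 0 < a -> face (a *: p) -> face p.
Proof.
move=> Dp a0 [_ [e e0 De]]; split=> //; exists (e * a); first by rewrite mulr_gt0.
by rewrite -scalerA.
Qed.

Lemma face_apex : D (hrow 1 x0) -> face (hrow 1 x0).
Proof.
move=> Dx; split=> //; exists 2^-1; first by rewrite invr_gt0.
have -> : hrow 1 x0 - 2^-1 *: hrow 1 x0 = 2^-1 *: hrow 1 x0.
  by apply/rowP => j; rewrite !mxE; field.
by apply: conic_scale; rewrite ?invr_ge0.
Qed.

Lemma face_conic p (T : set 'rV[R]_n) : T `<=` V -> conic (hom T) p -> face p ->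
  conic (hom (T `&` face_points)) p.
Proof.
move=> TV; elim=> [|s h y s0 [w Tw <-] cy IH] fp; first exact: conic0.
have Dw : D (hrow 1 w) by apply: conic_in; exists w => //; exact: TV.
have Dy : D y by apply: conic_subset cy => _ [x Tx <-]; exists x => //; exact: TV.
have [fw fy] := face_split (conic_scale s0 Dw) Dy fp.
apply: conic_add; last exact: IH.
have [->|sn0] := eqVneq s 0; first by rewrite scale0r; exact: conic0.
apply: conic_scale => //; apply: conic_in; exists w => //; split=> //.
by split; [exact: TV | apply: face_unscale fw; rewrite ?lt0r ?sn0].
Qed.

Lemma conic_face p : D (hrow 1 x0) -> conic (hom face_points) p -> face p.
Proof.
move=> Dx; elim=> [|s _ y s0 [w [_ fw] <-] _ IH].
  by rewrite -(scale0r (hrow 1 x0)); apply: face_scale => //; exact: face_apex.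
by apply: face_add => //; exact: face_scale.
Qed.

(** The form taking (r, w) to r times the value of [c] at [v], minus its value at [w], is
    nonnegative on the cone and 0 at [v], hence 0 on the face; but it is positive at every other
    point. *)
Lemma vertex_face v w : vertex (convex_hull V) v -> x0 = v -> face_points w -> w = v.
Proof.
move=> [Vv [c cv]] x0v [Vw [_ [e e0]]]; rewrite x0v => De.
apply: contrapT => wv.
have hw : dot w c < dot v c by apply: cv => //; exact: sub_convex_hull.
have := conic_dot_ge0 (c := col_mx (dot v c)%:M (- c)) _ De.
rewrite dotBl dotZl !dot_hrow_col !mul1r !dotNr subrr sub0r oppr_ge0 => /(_ _) h.
have : e * (dot v c - dot w c) <= 0.
  apply: h => _ [x Vx <-]; rewrite dot_hrow_col mul1r dotNr subr_ge0.
  have [->//|xv] := eqVneq x v.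
  by apply/ltW/cv; [exact: sub_convex_hull | exact/eqP].
by rewrite leNgt mulr_gt0 // subr_gt0.
Qed.

End Faces.

(** * The face of a boundary point lies in a hyperplane *)

Section BoundaryFunctional.
Context {R : realType} {n : nat}.

Lemma mulmx_bound p q (N : 'M[R]_(p, q)) : exists2 K : R, 0 < K &
  forall (u : 'rV[R]_p) d, 0 <= d -> (forall j, `|u 0 j| <= d) ->
    forall i, `|(u *m N) 0 i| <= K * d.
Proof.
exists (1 + \sum_j \sum_i `|N j i|).
  by rewrite ltr_pwDl // sumr_ge0 // => j _; rewrite sumr_ge0.
move=> u d d0 ud i; rewrite mxE; apply: le_trans (ler_norm_sum _ _ _) _.
apply: (@le_trans _ _ (\sum_j `|N j i| * d)).
  by apply: ler_sum => j _; rewrite normrM mulrC ler_wpM2l.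
rewrite -mulr_suml ler_wpM2r // ler_wpDl //; apply: ler_sum => j _.
by rewrite (bigD1 i) //= lerDl sumr_ge0.
Qed.

(** If the face spanned the whole space, [x0] minus a small multiple of the sum of its points would
    remain in the cone, and adding these points back with slightly changed weights would reach every
    nearby point, so [x0] would be interior. *)
Lemma boundary_functional (P : set 'rV[R]_n) (l : seq 'rV[R]_n) x0 :
    P = convex_hull [set` l] -> rel_boundary P x0 ->
  exists2 psi : 'cV[R]_(1 + n), psi != 0 &
    forall w, face_points [set` l] x0 w -> dot (hrow 1 w) psi = 0.
Proof.
move=> PE [Px0 nint].
have Dx : conic [set hrow 1 w | w in [set` l]] (hrow 1 x0).
  by apply/convex_hull_conic; rewrite -PE.
pose W := [seq w <- l | `[< face_points [set` l] x0 w >]].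
have WE w : w \in W <-> face_points [set` l] x0 w.
  rewrite mem_filter; split=> [/andP[/asboolP]//|fw].
  by rewrite (asboolT fw); case: fw.
pose M : 'M[R]_(size W, 1 + n) := \matrix_i hrow 1 (nth 0 W i).
have MW (i : 'I_(size W)) : face_points [set` l] x0 (nth 0 W i).
  by apply/WE; rewrite mem_nth.
have [full|nfull] := boolP (row_free M^T); last first.
  have := nfull; rewrite -kermx_eq0 => /rowV0Pn[r rk r0].
  exists r^T; first by rewrite -(inj_eq trmx_inj) trmxK trmx0.
  move=> w /WE wW; have iw : (index w W < size W)%N by rewrite index_mem.
  have -> : hrow 1 w = row (Ordinal iw) M by rewrite rowK /= nth_index.
  rewrite /dot -row_mul; have -> : M *m r^T = 0.
    by rewrite -[M]trmxK -trmx_mul (sub_kermxP rk) trmx0.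
  by rewrite row0 mxE.
exfalso; apply: nint; split=> //.
have fullM : row_full M by move: full; rewrite /row_free /row_full mxrank_tr.
pose p := \sum_i row i M.
have fp : face [set` l] x0 p.
  apply: (big_ind (face [set` l] x0)) => [|? ?|i _].
  - by rewrite -(scale0r (hrow 1 x0)); apply: face_scale => //; exact: face_apex.
  - exact: face_add.
  - by rewrite rowK; have [] := MW i.
have [_ [e e0 De]] := fp.
have [K K0 hK] := mulmx_bound (pinvmx M).
have Ke0 : 0 < e / K by rewrite divr_gt0.
apply/nbhs_rowP; exists (e / K) => // y hy _; rewrite PE; apply/convex_hull_conic.
pose u := hrow 0 (y - x0) *m pinvmx M.
have uE : hrow 1 y = (hrow 1 x0 - e *: p) + \sum_i (e + u 0 i) *: row i M.
  have -> : \sum_i (e + u 0 i) *: row i M = e *: p + u *m M.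
    rewrite mulmx_sum_row /p scaler_sumr -big_split /=.
    by apply: eq_bigr => i _; rewrite scalerDl.
  rewrite addrA subrK /u -mulmxA mulVpmx // mulmx1 -hrowD addr0.
  by congr hrow; rewrite addrC subrK.
rewrite uE; apply: conic_add => //; apply: conic_sum => i _; apply: conic_scale.
  have : `|u 0 i| <= K * (e / K).
    apply: hK => [|j]; first exact: ltW.
    rewrite mxE; case: splitP => k _; first by rewrite ord1 mxE mul0rn normr0 ltW.
    by rewrite !mxE ltW.
  rewrite mulrCA divff ?gt_eqF // mulr1 ler_norml => /andP[]; lra.
rewrite rowK; apply: conic_in; exists (nth 0 W i) => //.
by have [] := MW i.
Qed.

End BoundaryFunctional.

(** * Very ampleness gives a unimodular cover near the boundary *)

Section VeryAmpleCover.
Context {R : realType}.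

Lemma pigeonhole_infinite (T : finType) (f : nat -> T) :
  exists tau, forall N, exists2 k, (N <= k)%N & f k = tau.
Proof.
apply: contrapT => /forallNP H.
have /choice[g gP] : forall tau, exists N, forall k, (N <= k)%N -> f k <> tau.
  move=> tau; have /existsNP[N hN] := H tau; exists N => k Nk fk; apply: hN.
  by exists k.
pose M := (\max_tau g tau)%N.
by apply: (gP (f M) M) => //; exact: leq_bigmax.
Qed.

(** For large [k] the quadratic term decides the sign, and if it vanishes, the linear one. *)
Lemma eventual_sign (r phi C : R) (del : nat -> R) : (forall k, `|del k| <= C) ->
    (forall N, exists2 k, (N <= k)%N &
       0 <= k.+1%:R ^+ 2 * r + k.+1%:R * phi + del k) ->
  0 <= r /\ (r = 0 -> 0 <= phi).
Proof.
move=> delC inf; have C0 : 0 <= C := le_trans (normr_ge0 _) (delC 0%N).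
have big (z : R) : 0 <= z -> exists N, forall k, (N <= k)%N -> z < k.+1%:R.
  move=> z0; exists (Num.bound z) => k Nk; apply: lt_trans (archi_boundP z0) _.
  by rewrite ltr_nat ltnS.
split=> [|r0]; rewrite leNgt; apply/negP => neg.
  have [|N hN] := big ((`|phi| + C) / - r).
    by rewrite divr_ge0 ?addr_ge0 // oppr_ge0 ltW.
  have [k Nk] := inf N; have := hN _ Nk; rewrite ltr_pdivrMr ?oppr_gt0 //.
  have k1 : 1 <= k.+1%:R :> R by rewrite ler1n.
  have := delC k; have := ler_norm (del k); have := ler_norm phi.
  move: (k.+1%:R : R) k1 => K k1 ph de dC hK.
  rewrite leNgt => /negP; apply.
  have h1 : K * phi <= K * `|phi| by rewrite ler_wpM2l //; lra.
  have h2 : del k <= K * C.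
    apply: le_trans (le_trans de dC) _; by rewrite ler_peMl.
  have h3 : K * (`|phi| + C) < K * (K * - r) by rewrite ltr_pM2l //; lra.
  rewrite expr2; lra.
have [|N hN] := big (C / - phi).
  by rewrite divr_ge0 // oppr_ge0 ltW.
have [k Nk] := inf N; have := hN _ Nk; rewrite ltr_pdivrMr ?oppr_gt0 // r0 mulr0 add0r.
have := delC k; have := ler_norm (del k); lra.
Qed.

(** A minimal frame on the points of the face and the extra points [v + row i X] is unimodular. The
    [i]-th coordinate with respect to [X] is 1 at its own extra point and 0 at all other vertices,
    so a class cannot use that point; a class on the face would need four independent points, but
    the face lies in a hyperplane. *)
Lemma unimodular_cover_face (P : set 'rV[R]_3) (l : seq 'rV[R]_3) x0 v (psi : 'cV[R]_(1 + 3))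
    (X : 'M[R]_3) (J : set 'I_3) y :
    P = convex_hull [set` l] -> (forall x, x \in l <-> P x /\ Zlat x) -> P x0 ->
    psi != 0 -> (forall w, face_points [set` l] x0 w -> dot (hrow 1 w) psi = 0) ->
    Zlat v -> X \in unitmx -> intmx (invmx X) -> (forall i, J i -> v + row i X \in l) ->
    (forall w i, face_points [set` l] x0 w -> J i -> ((w - v) *m invmx X) 0 i = 0) ->
    conic [set hrow 1 w | w in
       face_points [set` l] x0 `|` [set v + row i X | i in J]] (hrow 1 y) ->
  unimodular_cover P y.
Proof.
move=> PE lE Px0 psi0 psiW Zv uX iX' Jl Jzero cy.
set W0 := face_points [set` l] x0 in psiW Jzero cy *.
set S0 := W0 `|` _ in cy.
have Dx : conic [set hrow 1 w | w in [set` l]] (hrow 1 x0).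
  by apply/convex_hull_conic; rewrite -PE.
have S0l w : S0 w -> w \in l by case=> [[]//|[i /Jl h <-]].
have iS h : [set hrow 1 w | w in S0] h -> intmx h.
  by move=> [w /S0l/lE[_ iw] <-]; exact: hrow_int.
have [Y [s mY]] := minimal_frame_exists (conic_frame iS cy).
have [FY _] := mY; have [iY uY yE s0 sS] := FY.
suff iY' : intmx (invmx Y).
  have SE : [set hrow 1 w | w in S0] = [set hrow 1 w | w in S0 `&` Zlat].
    congr image; apply/seteqP; split=> [w Sw|w []//]; split=> //.
    by have /lE[] := S0l _ Sw.
  rewrite SE in FY.
  have [T [uT Ty TS]] := unimodular_frame_simplex FY iY'.
  exists T => //; split=> // z /TS; rewrite PE; apply: convex_hullS.
  by move=> w /S0l.
apply: contrapT => /negP/(lattice_class_exists iY uY)[b Cb].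
have [b01 b0 ibY] := Cb.
have suppb i : b 0 i != 0 -> [set hrow 1 w | w in S0] (row i Y).
  by move=> /(minimal_frame_class_support mY Cb); exact: sS.
pose th i (u : 'rV[R]_(1 + 3)) : R := (u *m drop_mx v *m invmx X) 0 i.
have th_int i u : intmx u -> th i u \is a Num.int.
  move=> iu; apply: (mxOverP _); apply: intmxM => //.
  rewrite [u]hrowE hrow_drop; apply: intmxB.
    by apply: (@hrow_int_inv _ _ (u 0 0)); rewrite -hrowE.
  by apply: intmxZ => //; exact: (mxOverP iu).
have thJ i j : th i (hrow 1 (v + row j X)) = (j == i)%:R.
  by rewrite /th hrow_drop scale1r addrAC subrr add0r rowE mulmxK // mxE eqxx eq_sym.
have thW i w : J i -> W0 w -> th i (hrow 1 w) = 0.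
  by move=> Ji Ww; rewrite /th hrow_drop scale1r; exact: Jzero.
have suppW i : b 0 i != 0 -> [set hrow 1 w | w in W0] (row i Y).
  move=> bi; have [w [Ww|[j Jj wE]] wY] := suppb _ bi; first by exists w.
  exfalso; have : b 0 i \is a Num.int.
    have := th_int j _ ibY; rewrite /th -[_ *m _ *m invmx X]mulmxA -mulmxA mulmxA.
    suff -> : (b *m Y *m (drop_mx v *m invmx X)) 0 j = b 0 i by [].
    rewrite [b *m Y]mulmx_sum_row mulmx_suml summxE (bigD1 i) //= big1 ?addr0.
      by rewrite -scalemxAl mxE mulmxA -/(th j _) -wY -wE thJ eqxx mulr1.
    move=> k ki; have [->|bk] := eqVneq (b 0 k) 0; first by rewrite scale0r mul0mx mxE.
    rewrite -scalemxAl mxE mulmxA -/(th j _).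
    have [w' [Ww'|[j' Jj' w'E]] w'Y] := suppb _ bk; first by rewrite -w'Y thW ?mulr0.
    rewrite -w'Y -w'E thJ; have [jj|_] := eqVneq j' j; last by rewrite mulr0.
    exfalso; have : (delta_mx 0 k - delta_mx 0 i : 'rV[R]_(1 + 3)) != 0.
      by apply/rV0Pn; exists k; rewrite !mxE !eqxx (negPf ki) subr0 oner_eq0.
    move=> /(class_comb_neq0 uY)/eqP; apply.
    by rewrite mulmxBl -!rowE -wY -w'Y -wE -w'E jj subrr.
  by move=> /int_itv01_eq0/(_ (b01 i)) bi0; rewrite bi0 eqxx in bi.
have closedW (u : 'rV[R]_(1 + 3)) : intmx u -> u 0 0 = 1 ->
    conic [set hrow 1 w | w in W0] u -> [set hrow 1 w | w in S0] u.
  move=> iu /height1 uE; rewrite uE => cu; exists (rsubmx u) => //; left.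
  have fu := conic_face Dx cu.
  split; last exact: fu.
  apply/lE; split; last by apply: (@hrow_int_inv _ _ 1); rewrite -uE.
  by rewrite PE; apply/convex_hull_conic; case: fu.
have [|_ b2 n2] := @affine_class_card R 3 _ [set hrow 1 w | w in W0] _ Y s b mY Cb suppW _ closedW.
  by move=> u [w _ <-]; rewrite hrow00E.
have bn0 : forall i, b 0 i != 0.
  by apply: class_card_full; rewrite -(ler_nat R); lra.
have : Y *m psi = 0.
  apply/row_matrixP => i; rewrite row_mul row0; have [w Ww <-] := suppW _ (bn0 i).
  by apply/matrixP => p q; rewrite !ord1 [RHS]mxE; exact: psiW.
by move=> /(congr1 (mulmx (invmx Y))); rewrite mulKmx // mulmx0; exact/eqP.
Qed.

(* The second direction [w' - v] is only needed when the face of [x0] is a polygon and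
   [x0 - v] points along a generator of a cone that meets the polygon in a line. *)
Lemma face_direction (l : seq 'rV[R]_3) x0 v :
    vertex (convex_hull [set` l]) v -> face_points [set` l] x0 v ->
  exists2 w', face_points [set` l] x0 w' & forall u : 'rV[R]_3,
    (exists r, x0 - v = r *: u) -> (exists r, w' - v = r *: u) ->
    forall w, face_points [set` l] x0 w -> exists r, w - v = r *: u.
Proof.
move=> vv fv.
have [[w' [fw' nw']]|all] := pselect (exists w', face_points [set` l] x0 w' /\
    forall r, w' - v <> r *: (x0 - v)).
  exists w' => // u [r rE] [p pE] w fw.
  have [r0|r0] := eqVneq r 0.
    have xv : x0 = v by apply/eqP; rewrite -subr_eq0 rE r0 scale0r.
    by rewrite (vertex_face vv xv fw) subrr; exists 0; rewrite scale0r.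
  by case: (nw' (p / r)); rewrite rE scalerA divfK.
exists v => // u [r rE] _ w fw.
have /existsNP[p /contrapT pE] : ~ forall r, w - v <> r *: (x0 - v).
  by move=> h; apply: all; exists w.
by exists (p * r); rewrite pE rE scalerA.
Qed.

Lemma ord3_cases (i j1 j2 j : 'I_3) : i != j1 -> i != j2 -> j1 != j2 ->
  [\/ j = i, j = j1 | j = j2].
Proof.
rewrite -!val_eqE /= => ij1 ij2 j12.
have [ji|ji] := eqVneq (val j) (val i); first by constructor 1; exact: val_inj.
have [j1E|j1E] := eqVneq (val j) (val j1); first by constructor 2; exact: val_inj.
constructor 3; apply: val_inj => /=; move: ij1 ij2 j12 ji j1E => /=.
by have := ltn_ord i; have := ltn_ord j; have := ltn_ord j1; have := ltn_ord j2; lia.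
Qed.

Theorem very_ample_cover (P : set 'rV[R]_3) : lattice_polytope P -> very_ample P ->
  within P (set_nbhs (rel_boundary P)) (unimodular_cover P).
Proof.
move=> lP va x0 bx0; have [pP vZ] := lP.
have [l lE] := lattice_points_enum pP.
have PE := lattice_polytope_hull lP lE.
have [Px0 _] := bx0.
have [psi psi0 psiW] := boundary_functional PE bx0.
set W0 := face_points [set` l] x0 in psiW.
pose D := conic [set hrow 1 w | w in [set` l]].
have PD x : P x <-> D (hrow 1 x) by rewrite PE; exact: convex_hull_conic.
have Dx : D (hrow 1 x0) by exact/PD.
have lD w : w \in l -> D (hrow 1 w) by move=> wl; apply: conic_in; exists w.
(* A representation of [x0] by vertices of [P] uses only points of its face. *)
have [v [vv Wv]] : exists v, vertex P v /\ W0 v.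
  have [s [Ps sv]] := polytope_vertices pP.
  have sl : [set` s] `<=` [set` l].
    by move=> v /= /sv vv; apply/lE; split; [case: vv | exact: vZ].
  have /convex_hull_conic cs : convex_hull [set` s] x0 by rewrite -Ps.
  have := face_conic sl cs (face_apex Dx).
  apply: contraPP => nov cs'.
  suff : hrow 1 x0 = 0 :> 'rV[R]_(1 + 3).
    by move=> /rowP/(_ 0); rewrite hrow00E mxE => /eqP; rewrite oner_eq0.
  elim: cs' => // c h y _ [w [/= ws Ww] _] _ _.
  by exfalso; apply: nov; exists w; split=> //; exact: sv.
have Zv : Zlat v by exact: vZ.
have [Pv _] := vv.
have [w' Ww' dirw] : exists2 w', W0 w' & forall u : 'rV[R]_3,
    (exists r, x0 - v = r *: u) -> (exists r, w' - v = r *: u) ->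
    forall w, W0 w -> exists r, w - v = r *: u.
  by apply: face_direction => //; rewrite -PE.
pose f := w' - v.
have [w'l _] := Ww'.
apply: contrapT => nnb.
(* Uncovered points of [P] that converge to [x0]. *)
have /choice[xs xsP] : forall k : nat, exists x, [/\ P x,
    forall j, `|x 0 j - x0 0 j| < k.+1%:R^-1 & ~ unimodular_cover P x].
  move=> k; apply: contrapT => no; apply: nnb; apply/nbhs_rowP.
  exists k.+1%:R^-1; first by rewrite invr_gt0.
  move=> x hx Px; apply: contrapT => nU; apply: no; exists x; by split.
have conicP x : P x -> conic [set x - v | x in [set` l]] (x - v).
  by move=> /PD Dxx; rewrite -[v in _ - v]scale1r; exact: conic_hrow_drop.
(* A cone containing [y k] for infinitely many [k] contains [x0 - v], and, by the second
   term, its generators inside the face of [x0] span that face. *)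
pose y (k : nat) := k.+1%:R ^+ 2 *: (x0 - v) + k.+1%:R *: f + (xs k - x0).
have cy k : conic [set x - v | x in [set` l]] (y k).
  have -> : y k = (xs k - v) + (k.+1%:R ^+ 2 - 1) *: (x0 - v) + k.+1%:R *: f.
    by apply/rowP => j; rewrite !mxE; ring.
  have [Pxk _ _] := xsP k.
  apply: conic_add; last by apply: conic_scale => //; apply/conicP; have /lE[] := w'l.
  apply: conic_add; first exact: conicP.
  apply: conic_scale; last exact: conicP.
  by rewrite subr_ge0 exprn_ege1 // ler1n.
have /choice[Xt XtP] : forall k, exists Xt : 'M[R]_3 * 'rV[R]_3,
    frame [set u | v + u \in l] (y k) Xt.1 Xt.2 /\ intmx (invmx Xt.1).
  move=> k; have [X [t XtP]] := very_ample_cone va vv PE lE Zv (cy k).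
  by exists (X, t).
pose tt k := (Xt k).2.
(* The pattern records which rows are used and which lattice points they are; having finitely many
   values, it takes one of them infinitely often. *)
pose pat (k : nat) : {ffun 'I_3 -> option 'I_(size l)} := [ffun i =>
  if 0 < tt k 0 i then insub (index (v + row i (Xt k).1) l) else None].
have [tau tauP] := pigeonhole_infinite pat.
have [k0 _ k0tau] := tauP 0%N.
set X := (Xt k0).1 in k0tau; pose K i := 0 < tt k0 0 i.
have [[iX uX _ _ tX] iX'] := XtP k0; rewrite -/X in iX uX tX iX'.
have agree k : pat k = tau -> forall i, (0 < tt k 0 i) = K i /\
    (0 < tt k 0 i -> row i (Xt k).1 = row i X).
  move=> kt i; have [[_ _ _ _ tk] _] := XtP k.
  have : pat k i = pat k0 i by rewrite kt k0tau.
  rewrite !ffunE -/(K i) /K.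
  case: ifP => ti; case: ifP => ti0; rewrite ?ti ?ti0 //.
  - have hi : (index (v + row i (Xt k).1)%R l < size l)%N by rewrite index_mem; exact: tk ti.
    have hi0 : (index (v + row i X)%R l < size l)%N by rewrite index_mem; exact: tX ti0.
    rewrite !insubT => -[/(congr1 (nth 0 l))].
    rewrite !nth_index; [by move=> /addrI | exact: tX ti0 | exact: tk ti].
  - have hi : (index (v + row i (Xt k).1)%R l < size l)%N by rewrite index_mem; exact: tk ti.
    by rewrite insubT.
  - have hi0 : (index (v + row i X)%R l < size l)%N by rewrite index_mem; exact: tX ti0.
    by rewrite insubT.
pose r := (x0 - v) *m invmx X; pose phi := f *m invmx X.
pose del k := (xs k - x0) *m invmx X.
have t_ge0 k i : 0 <= tt k 0 i by have [[_ _ _ h _] _] := XtP k.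
have tE k : pat k = tau -> forall i,
    tt k 0 i = k.+1%:R ^+ 2 * r 0 i + k.+1%:R * phi 0 i + del k 0 i.
  move=> kt i; have [[_ _ yE _ _] _] := XtP k.
  have : y k = tt k *m X.
    rewrite yE !mulmx_sum_row; apply: eq_bigr => j _.
    have [_ h] := agree _ kt j.
    have [t0|/h -> //] := leP (tt k 0 j) 0.
    have -> : (Xt k).2 0 j = 0 by apply/eqP; rewrite eq_le t0 t_ge0.
    by rewrite !scale0r.
  move=> /(congr1 (mulmx^~ (invmx X))); rewrite mulmxK // => <-.
  have -> : y k *m invmx X = k.+1%:R ^+ 2 *: r + k.+1%:R *: phi + del k.
    by rewrite /y mulmxDl mulmxDl -!scalemxAl.
  by move: r phi (del k) => a b c; rewrite !mxE.
have [B B0 hB] := mulmx_bound (invmx X).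
have delB k i : `|del k 0 i| <= B * k.+1%:R^-1.
  apply: hB => [|j]; first by rewrite invr_ge0.
  by rewrite !mxE; have [_ h _] := xsP k; exact: ltW.
have delB' k i : `|del k 0 i| <= B.
  apply: le_trans (delB k i) _; rewrite ler_piMr ?(ltW B0) //.
  by rewrite invf_le1 ?ltr0n // ler1n.
have sign i : 0 <= r 0 i /\ (r 0 i = 0 -> 0 <= phi 0 i).
  apply: (@eventual_sign _ _ B (fun k => del k 0 i)) => // N.
  by have [k Nk kt] := tauP N; exists k => //; rewrite -tE.
have offK i : ~~ K i -> r 0 i = 0 /\ phi 0 i = 0.
  move=> nK; have [r0 ph0] := sign i.
  have [r1 ph1] : 0 <= - r 0 i /\ (- r 0 i = 0 -> 0 <= - phi 0 i).
    apply: (@eventual_sign _ _ B (fun k => - del k 0 i)) => [k|N]; first by rewrite normrN.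
    have [k Nk kt] := tauP N; exists k => //.
    have : tt k 0 i = 0.
      by apply/eqP; rewrite eq_le t_ge0 andbT leNgt; have [-> _] := agree _ kt i.
    by rewrite tE // => h; lra.
  have r00 : r 0 i = 0 by lra.
  by split=> //; have := ph0 r00; have := ph1; rewrite r00 oppr0 => /(_ erefl); lra.
(* The rows used by the two leading terms; the other rows of [K] only carry the perturbation
   [del]. *)
pose K' i := (0 < r 0 i) || (0 < phi 0 i).
have K'K i : K' i -> K i.
  by apply: contraLR => /offK[r0 p0]; rewrite /K' r0 p0 ltxx.
have offK' i : ~~ K' i -> r 0 i = 0 /\ phi 0 i = 0.
  rewrite /K' negb_or -!leNgt => /andP[r1 p1]; have [r2 p2] := sign i.
  have r00 : r 0 i = 0 by lra.
  by split=> //; have := p2 r00; lra.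
pose u i := v + row i X.
have ul i : K i -> u i \in l by move=> /tX.
(* For small [eps] the coordinates of [x0 - v + eps *: f] are nonnegative, and positive exactly on
   [K']. *)
have [eps eps0 hrho] : exists2 e : R, 0 < e & forall d, 0 < d <= e ->
    forall i, i \in enum 'I_3 -> 0 <= r 0 i + d * phi 0 i /\ (K' i -> 0 < r 0 i + d * phi 0 i).
  apply: eventually_small_seq => i _; have [r0 p0] := sign i.
  have [rz|rn] := eqVneq (r 0 i) 0.
    exists 1 => // d /andP[d0 _]; rewrite /K' rz ltxx /= add0r.
    by split=> [|?]; [apply: mulr_ge0; [exact: ltW | exact: p0] | rewrite mulr_gt0].
  have rp : 0 < r 0 i by rewrite lt0r rn.
  exists (r 0 i / (1 + `|phi 0 i|)).
    by rewrite divr_gt0 // ltr_pwDl.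
  have q0 : 0 < 1 + `|phi 0 i| by rewrite ltr_pwDl.
  move=> d /andP[d0]; rewrite ler_pdivlMr // mulrDr mulr1 => h.
  have h2 : d * - phi 0 i <= d * `|phi 0 i|.
    by rewrite ler_pM2l // -normrN ler_norm.
  have : 0 < r 0 i + d * phi 0 i by lra.
  by move=> h3; split; first exact: ltW.
pose rho i := r 0 i + eps * phi 0 i.
have {hrho} hrho i : 0 <= rho i /\ (K' i -> 0 < rho i).
  by apply: hrho; rewrite ?mem_enum ?eps0 ?lexx.
have rhoK' i : rho i != 0 -> K' i.
  by apply: contra_neqT => /offK'[r0 p0]; rewrite /rho r0 p0 mulr0 addr0.
have rowX (a : 'rV[R]_3) : a = \sum_i (a *m invmx X) 0 i *: row i X.
  by rewrite -mulmx_sum_row mulmxKV.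
have hrow_sum (c : 'I_3 -> R) (Q : pred 'I_3) : hrow 0 (\sum_(i | Q i) c i *: row i X) =
    \sum_(i | Q i) c i *: hrow 1 (u i) - (\sum_(i | Q i) c i) *: hrow 1 v.
  rewrite scaler_suml -sumrB.
  rewrite (eq_bigr (fun i => hrow 0 (c i *: row i X))); last first.
    move=> i _; rewrite -scalerBr -hrowB -hrowZ; congr hrow; first by ring.
    by rewrite /u addrAC subrr add0r.
  by apply: (big_ind2 (fun a b => hrow 0 a = b)) => // [|? ? ? ? <- <-];
    rewrite ?hrow00 // -hrowD addr0.
(* Rewritten without negative coefficients, that vector exhibits the points [u i] as summands of an
   element of the face, so they belong to it. *)
have faceU i : K' i -> face [set` l] x0 (hrow 1 (u i)).
  move=> Ki; have [_ /(_ Ki) rhoi] := hrho i.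
  have key : hrow 1 x0 + eps *: hrow 1 w' + (\sum_j rho j) *: hrow 1 v =
      (1 + eps) *: hrow 1 v + \sum_j rho j *: hrow 1 (u j).
    have : hrow 0 ((x0 - v) + eps *: f) = \sum_j rho j *: hrow 1 (u j) - (\sum_j rho j) *: hrow 1 v.
      rewrite -hrow_sum; congr hrow; rewrite [LHS]rowX; apply: eq_bigr => j _.
      have -> : (x0 - v + eps *: f) *m invmx X = r + eps *: phi.
        by rewrite mulmxDl -scalemxAl.
      by rewrite mxE [(eps *: phi) 0 j]mxE.
    have -> : hrow 0 ((x0 - v) + eps *: f) = hrow 1 x0 + eps *: hrow 1 w' - (1 + eps) *: hrow 1 v.
      rewrite -!hrowZ -hrowD -hrowB; congr hrow; first by ring.
      by apply/rowP => j; rewrite !mxE; ring.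
    move=> /eqP; rewrite subr_eq => /eqP ->.
    by apply/rowP => j; rewrite !mxE; ring.
  have fL : face [set` l] x0 ((1 + eps) *: hrow 1 v + \sum_j rho j *: hrow 1 (u j)).
    rewrite -key; apply: face_add; last first.
      apply: face_scale => //; last by case: Wv.
      by apply: sumr_ge0 => j _; have [] := hrho j.
    apply: face_add; first exact: face_apex.
    by apply: face_scale => //; [exact: ltW | case: Ww'].
  have Drho j : D (rho j *: hrow 1 (u j)).
    have [->|rn] := eqVneq (rho j) 0; first by rewrite scale0r; exact: conic0.
    apply: conic_scale; first by have [] := hrho j.
    by apply/lD/ul/K'K/rhoK'.
  have [||_ fS] := face_split _ _ fL.
  - apply: conic_scale; first by rewrite addr_ge0 // ltW.
    by apply: lD; case: Wv.
  - by apply: conic_sum => j _; exact: Drho.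
  move: fS; rewrite (bigD1 i) //= => fS.
  have [||fi _] := face_split _ _ fS.
  - exact: Drho.
  - by apply: conic_sum => j _; exact: Drho.
  by apply: face_unscale fi => //; apply/lD/ul/K'K.
(* Subtracting [e *: p] from [x0] within the face leaves a margin [e] at [v] and at each [u i] with
   [i] in [K']. *)
pose p := hrow 1 v + \sum_(i | K' i) hrow 1 (u i).
have fp : face [set` l] x0 p.
  apply: face_add; first by case: Wv.
  apply: (big_ind (face [set` l] x0)) => [|? ?|i Ki].
  - by rewrite -(scale0r (hrow 1 x0)); apply: face_scale => //; exact: face_apex.
  - exact: face_add.
  - exact: faceU.
have [Dp [e e0 De]] := fp.
have cWe : conic [set hrow 1 w | w in W0] (hrow 1 x0 - e *: p).
  have [|||fe _] := @face_split _ _ [set` l] x0 (hrow 1 x0 - e *: p) (e *: p).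
  - exact: De.
  - by apply: conic_scale => //; exact: ltW.
  - by rewrite subrK; exact: face_apex.
  have := face_conic (fun w h => h) De fe.
  by apply: conic_subset => _ [w [_ Ww] <-]; exists w.
(* With each of the three entries of [del k] at most [e / 3], the coefficient of [v] remains
   nonnegative. *)
have [k [kt kB]] : exists k, pat k = tau /\ B * k.+1%:R^-1 <= e / 3.
  have z0 : 0 <= B * 3 / e by rewrite divr_ge0 ?mulr_ge0 ?ltW.
  have [k Nk kt] := tauP (Num.bound (B * 3 / e)); exists k; split=> //.
  have : B * 3 / e < k.+1%:R.
    by apply: lt_trans (archi_boundP z0) _; rewrite ltr_nat ltnS.
  rewrite ltr_pdivrMr // ler_pdivrMr ?ltr0n // => h; lra.
have [_ _ nU] := xsP k; apply: nU.
have dele i : `|del k 0 i| <= e / 3 by exact: le_trans (delB k i) kB.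
have del_lo i : - (e / 3) <= del k 0 i by have := dele i; rewrite ler_norml => /andP[].
have del_hi i : del k 0 i <= e / 3 by have := dele i; rewrite ler_norml => /andP[].
have delK' i : ~~ K' i -> 0 <= del k 0 i /\ (del k 0 i != 0 -> K i).
  move=> nK; have [r0 p0] := offK' _ nK; have := tE _ kt i; rewrite r0 p0 !mulr0 !add0r => tk.
  rewrite -tk; split; first exact: t_ge0.
  by move=> tn; have [<- _] := agree _ kt i; rewrite lt0r tn t_ge0.
pose J := [set i | K i && ~~ K' i].
apply: (@unimodular_cover_face P l x0 v psi X J) => //.
- by move=> i /andP[Ki _]; exact: ul.
- move=> w i Ww /andP[Ki nK'].
  have qE := rowX (w - v); set q := (w - v) *m invmx X in qE *.
  (* Two rows along the face: a nonzero coordinate at [i] would put all rows of [X] into the kernel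
     of the linear part of [psi], so that [psi] would vanish. *)
  have [[j1 [j2 [j12 K1 K2]]]|no2] := pselect (exists j1 j2, [/\ j1 != j2, K' j1 & K' j2]).
    apply/eqP; apply: contrapT => /negP qi.
    have ij1 : i != j1 by apply: contraNneq nK' => ->.
    have ij2 : i != j2 by apply: contraNneq nK' => ->.
    have psiv := psiW _ Wv.
    have psi_row j : K' j -> dot (row j X) (dsubmx psi) = 0.
      move=> Kj; have : dot (hrow 1 (u j)) psi = 0.
        by apply: psiW; split; [exact/ul/K'K | exact: faceU].
      by move: psiv; rewrite !dot_hrow /u dotDl; lra.
    have psiw : dot (w - v) (dsubmx psi) = 0.
      by have := psiW _ Ww; move: psiv; rewrite !dot_hrow dotBl; lra.
    have row_i : dot (row i X) (dsubmx psi) = 0.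
      move: psiw; rewrite qE dot_suml (bigD1 i) //= big1 ?addr0.
        by rewrite dotZl => /eqP; rewrite mulf_eq0 (negPf qi) => /eqP.
      move=> j ji; rewrite dotZl; have [jE|->|->] := ord3_cases j ij1 ij2 j12.
      - by rewrite jE eqxx in ji.
      - by rewrite psi_row // mulr0.
      - by rewrite psi_row // mulr0.
    have dpsi : dsubmx psi = 0.
      have Xpsi : X *m dsubmx psi = 0.
        apply/row_matrixP => j; rewrite row_mul row0.
        apply/matrixP => a b; rewrite !ord1 [RHS]mxE -/(dot _ _).
        by have [->|->|->] := ord3_cases j ij1 ij2 j12; [exact: row_i | exact: psi_row..].
      by rewrite -(mulKmx uX (dsubmx psi)) Xpsi mulmx0.
    move/eqP: psi0; apply.
    rewrite -[psi]vsubmxK dpsi; move: psiv; rewrite dot_hrow dpsi /dot mulmx0 mxE addr0 mul1r => h.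
    rewrite (_ : usubmx psi = 0) ?col_mx0 //; apply/matrixP => a b.
    by rewrite !ord1 !mxE -h; congr (psi _ _); apply: val_inj.
  (* Otherwise the rows of [K'] span at most a line, which by the choice of [w'] contains the
     differences from [v] of all points of the face. *)
  have [j1 [j1i only]] : exists j1, j1 != i /\ forall j, K' j -> j = j1.
    have [[j1 K1]|none] := pselect (exists j, K' j).
      exists j1; split; first by apply: contraNneq nK' => <-.
      move=> j Kj; apply/eqP; apply: contrapT => /negP jj1; apply: no2.
      by exists j, j1.
    have [j1 j1i] : exists j1, j1 != i.
      have [->|] := eqVneq i 0; first by exists 1.
      by exists 0; rewrite eq_sym.
    by exists j1; split=> // j Kj; exfalso; apply: none; exists j.
  have line (a : 'rV[R]_3) : (forall j, ~~ K' j -> (a *m invmx X) 0 j = 0) ->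
      exists c, a = c *: row j1 X.
    move=> h; exists ((a *m invmx X) 0 j1); rewrite {1}(rowX a) (bigD1 j1) //= big1 ?addr0 //.
    move=> j jj1; rewrite h ?scale0r //; apply: contraNN jj1 => /only ->; exact: eqxx.
  have [||c wE] := dirw (row j1 X) _ _ w Ww.
  - by apply: line => j /offK'[].
  - by apply: line => j /offK'[].
  rewrite /q wE -scalemxAl rowE mulmxK // !mxE eq_sym.
  by rewrite eq_sym [i == j1]eq_sym (negPf j1i) andbF mulr0.
(* The margin absorbs [del] at [v] and on [K']; outside [K'] the entries of [del] are weights of the
   frame, hence nonnegative. *)
have -> : hrow 1 (xs k) = (hrow 1 x0 - e *: p) + (e - \sum_i del k 0 i) *: hrow 1 v +
    \sum_(i | K' i) (e + del k 0 i) *: hrow 1 (u i) +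
    \sum_(i | ~~ K' i) del k 0 i *: hrow 1 (u i).
  have xE : hrow 1 (xs k) = hrow 1 x0 + hrow 0 (xs k - x0).
    by rewrite -hrowD addr0 addrC subrK.
  rewrite xE (rowX (xs k - x0)) hrow_sum -/(del k) [in LHS](bigID K') /=.
  have -> : \sum_(i | K' i) (e + del k 0 i) *: hrow 1 (u i) =
      e *: (\sum_(i | K' i) hrow 1 (u i)) + \sum_(i | K' i) del k 0 i *: hrow 1 (u i).
    by rewrite scaler_sumr -big_split /=; apply: eq_bigr => i _; rewrite scalerDl.
  rewrite /p; move: (\sum_(i | K' i) hrow 1 (u i)) => a1.
  move: (\sum_(i | K' i) _ *: _) (\sum_(i | ~~ K' i) _ *: _) (\sum_i _) => a2 a3 c.
  by apply/rowP => j; rewrite !mxE; ring.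
have sub0 : conic [set hrow 1 w | w in W0] `<=`
    conic [set hrow 1 w | w in W0 `|` [set v + row i X | i in J]].
  by apply: conic_subset => _ [w Ww <-]; exists w => //; left.
have inW w : W0 w -> conic [set hrow 1 w | w in W0 `|` [set v + row i X | i in J]] (hrow 1 w).
  by move=> Ww; apply: conic_in; exists w => //; left.
apply: conic_add; last first.
  apply: conic_sum => i nK; have [d0 dK] := delK' _ nK.
  have [->|dn] := eqVneq (del k 0 i) 0; first by rewrite scale0r; exact: conic0.
  apply: conic_scale => //; apply: conic_in; exists (u i) => //; right; exists i => //=.
  by rewrite /J /= dK.
apply: conic_add; last first.
  apply: conic_sum => i Ki; apply: conic_scale; first by have := del_lo i; lra.
  by apply: inW; split; [exact/ul/K'K | exact: faceU].
apply: conic_add; first exact: sub0.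
apply: conic_scale; last exact: inW.
by rewrite sum3; have := del_hi 0; have := del_hi 1; have := del_hi 2; lra.
Qed.

End VeryAmpleCover.

Theorem mainTheorem1 (R : realType) :
  (forall P : set 'rV[R]_3, lattice_polytope P ->
     (within P (set_nbhs (rel_boundary P)) (unimodular_cover P)
        <-> very_ample P))
  /\
  (forall E : set 'rV[R]_3, ellipsoid E ->
     ellipsoid_polytope E = unimodular_cover (ellipsoid_polytope E))
  /\
  (forall d : nat, (6 <= d)%N ->
     exists E : set 'rV[R]_d,
       [/\ ellipsoid E,
           gp (ellipsoid_polytope E) = Zlat
         & ~ normal_polytope (ellipsoid_polytope E)]).
Proof.
split; last split.
- by move=> P lP; split; [exact: cover_very_ample | exact: very_ample_cover].
- exact: ellipsoid_unimodular_cover.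
- by case=> [|[|[|[|[|[|m]]]]]] // _; exact: nonnormal_ellipsoid.
Qed.
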